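(* Let $\rho\sim E(m_0,\Sigma_0,g)$ and $\nu\sim E(m_1,\Sigma_1,g)$ be elliptic densities on $\mathbb{R}^d$ with the same generator $g$, and set $\Delta m=m_1-m_0$. Assume that the Otto-dual geodesic from $\rho$ to $\nu$ generated by a quadratic potential is the unique Otto-dual geodesic from $\rho$ to $\nu$ (so that $D^{\mathrm O}(\rho\mid\nu)$ is its action). Then $$D^{\mathrm O}(\rho\mid\nu)=\frac{\kappa_g}{4}\operatorname{tr}\!\big(\Sigma_0-\Sigma_1+\Sigma_0R^2\log(R^2)\big)+\frac14\Big\|\sqrt{Q+2\log(R)^{\perp}}\,\Delta m\Big\|^2,$$ where $$R=\Sigma_0^{-1/2}\big(\Sigma_0^{1/2}\Sigma_1\Sigma_0^{1/2}\big)^{1/2}\Sigma_0^{-1/2},\qquad Q=(R-I)^{\dagger}\big(\log(R^2)R^2-R^2+I\big)(R-I)^{\dagger},$$ and $A^\perp=I-AA^\dagger$ for any symmetric matrix $A$. Furthermore, if $\Sigma_0\Sigma_1=\Sigma_1\Sigma_0$, then $$D^{\mathrm O}(\rho\mid\nu)=\frac{\kappa_g}{4}\Big\|\sqrt Q\big(\sqrt{\Sigma_1}-\sqrt{\Sigma_0}\big)\Big\|_F^2+\frac14\Big\|\sqrt{Q+2\log(R)^\perp}\,\Delta m\Big\|^2 .$$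
   Context: Elliptic densities: $\rho\sim E(m,\Sigma,g)$ means $\rho(x)=\det(\Sigma)^{-1/2}g((x-m)^\top\Sigma^{-1}(x-m))$ with $m\in\mathbb{R}^d$, $\Sigma$ symmetric positive definite, and $g\colon[0,\infty)\to(0,\infty)$ smooth, integrable with $\frac{\pi^{d/2}}{\Gamma(d/2)}\int_0^\infty r^{d/2-1}g(r)\,dr=1$, $\int_0^\infty r^{(d-1)/2}g(r)\,dr<\infty$, $\int_0^\infty r^{d/2}g(r)\,dr<\infty$. Set $\kappa_g=\frac1d\int_{\mathbb{R}^d}\|y\|^2g(\|y\|^2)\,dy$. $\dagger$ is the Moore–Penrose inverse, $\|\cdot\|$ the Euclidean norm, $\|\cdot\|_F$ the Frobenius norm; $\log$ and square roots are the symmetric matrix functions. Otto (Wasserstein) geometry on the smooth positive densities $P_+^\infty(\mathbb{R}^d)$: $\phi^{\mathrm O}_\rho([f])=-\nabla\cdot(\rho\nabla f)$, where $[f]$ is the class of $f\in C^\infty(\mathbb{R}^d)$ modulo constants. An Otto-dual geodesic is a curve $\gamma\colon[0,1]\to P_+^\infty(\mathbb{R}^d)$ for which there is a fixed (time-independent) potential $f$ with $\dot\gamma(t)=\phi^{\mathrm O}_{\gamma(t)}([f])$ for all $t$; along it $g^{\mathrm O}_{\gamma(t)}(\dot\gamma(t),\dot\gamma(t))=\int_{\mathbb{R}^d}\|\nabla f\|^2\gamma(t)\,dx$. The divergence is $$D^{\mathrm O}(\rho\mid\nu)=\inf\Big\{\int_0^1t\,g^{\mathrm O}_{\gamma(t)}(\dot\gamma(t),\dot\gamma(t))\,dt:\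 \gamma\text{ Otto-dual geodesic},\ \gamma(0)=\rho,\ \gamma(1)=\nu\Big\}.$$ A quadratic potential is $f(x)=\frac12x^\top Bx+b^\top x$ with $B$ symmetric and $b\in\mathbb{R}^d$. Standing assumption: the dual geodesic from $\rho$ to $\nu$ with quadratic potential is the unique dual geodesic joining them, so $D^{\mathrm O}(\rho\mid\nu)$ is the value of the integral along it. *)

(* Defs.v *)
From HB Require Import structures.
From mathcomp Require Import all_boot all_order all_algebra.
From mathcomp Require Import all_classical all_reals all_analysis.

Set Implicit Arguments.
Unset Strict Implicit.
Unset Printing Implicit Defensive.

Import Order.TTheory GRing.Theory Num.Theory.
Import numFieldNormedType.Exports.

Local Open Scope classical_set_scope.
Local Open Scope ring_scope.

(* The library has a sigma-algebra on [n.-tuple T] but no Lebesgue measure in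
   dimension n: it is obtained here as an iterated product measure. *)
Section cons_measure.
Local Open Scope ereal_scope.
Context {R : realType} {n : nat}.
Let T := measurableTypeR R.
Variables (lam : {sigma_finite_measure set T -> \bar R})
  (mu : {sigma_finite_measure set (n.-tuple T) -> \bar R}).

Definition cons_pair (p : T * n.-tuple T) : n.+1.-tuple T :=
  [the n.+1.-tuple T of p.1 :: p.2].

Definition uncons (v : n.+1.-tuple T) : T * n.-tuple T :=
  (thead v, [tuple of behead v]).

Lemma measurable_cons_pair : measurable_fun setT cons_pair.
Proof. exact: measurable_cons. Qed.

Lemma measurable_uncons : measurable_fun setT uncons.
Proof.
apply/measurable_fun_pairP; split.
- exact: measurable_tnth.
- exact: measurable_behead.
Qed.

Lemma cons_pairK : cancel cons_pair uncons.
Proof. by case=> x v; congr pair; apply/val_inj. Qed.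

Definition cons_measure : set (n.+1.-tuple T) -> \bar R :=
  pushforward (lam \x mu) cons_pair.

Let cons_measure0 : cons_measure set0 = 0.
Proof. by rewrite /cons_measure /pushforward preimage_set0 measure0. Qed.

Let cons_measure_ge0 A : 0 <= cons_measure A.
Proof. by rewrite /cons_measure /pushforward measure_ge0. Qed.

Let cons_measure_sigma_additive : semi_sigma_additive cons_measure.
Proof.
have mp A : measurable A -> measurable (cons_pair @^-1` A).
  by move=> mA; rewrite -[X in measurable X]setTI; exact: measurable_cons_pair.
move=> F mF tF mUF; rewrite /cons_measure /pushforward preimage_bigcup.
apply: measure_semi_sigma_additive.
- by move=> k; exact: mp.
- apply/trivIsetP => /= i j _ _ ij; rewrite -preimage_setI.
  by move/trivIsetP : tF => /(_ _ _ _ _ ij) ->//; rewrite preimage_set0.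
- by rewrite -preimage_bigcup; exact: mp.
Qed.

HB.instance Definition _ := isMeasure.Build _ _ _ cons_measure
  cons_measure0 cons_measure_ge0 cons_measure_sigma_additive.

Let cons_measure_sigma_finite : sigma_finite setT cons_measure.
Proof.
have /sigma_finiteP[F [TF ndF Foo]] := sigma_finiteT lam.
have /sigma_finiteP[G [TG ndG Goo]] := sigma_finiteT mu.
exists (fun k => uncons @^-1` (F k `*` G k)).
  rewrite -preimage_bigcup (_ : \bigcup_k _ = setT) ?preimage_setT//.
  rewrite -subTset => -[x y] _.
  have [[i _ Fix] [j _ Gjy]] : (\bigcup_k F k) x /\ (\bigcup_k G k) y.
    by rewrite -TF -TG.
  exists (maxn i j) => //; split => /=.
  - by move: x Fix; exact/subsetPset/ndF/leq_maxl.
  - by move: y Gjy; exact/subsetPset/ndG/leq_maxr.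
move=> k; have [mF Fk] := Foo k; have [mG Gk] := Goo k; split.
  rewrite -[X in measurable X]setTI; apply: measurable_uncons => //.
  exact: measurableX.
rewrite /cons_measure /pushforward -comp_preimage.
rewrite (_ : uncons \o cons_pair = id); last first.
  by rewrite funeqE => p /=; rewrite cons_pairK.
by rewrite preimage_id product_measure1E// lte_mul_pinfty// ge0_fin_numE.
Qed.

HB.instance Definition _ := Measure_isSigmaFinite.Build _ _ _ cons_measure
  cons_measure_sigma_finite.

End cons_measure.

Fixpoint lebesgue_tuple (R : realType) (n : nat) :
    {sigma_finite_measure set (n.-tuple (measurableTypeR R)) -> \bar R} :=
  match n with
  | 0 => [the sigma_finite_measure _ _ of \d_([tuple])]
  | n'.+1 => [the sigma_finite_measure _ _ of
      cons_measure lebesgue_measure (lebesgue_tuple R n')]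
  end.

Section euclidean_space.
Context {R : realType} {d : nat}.
Implicit Types (f rho : 'cV[R]_d -> R) (X : 'cV[R]_d -> 'cV[R]_d).

Definition int_Rd (F : 'cV[R]_d -> \bar R) : \bar R :=
  (\int[lebesgue_tuple R d]_(v in setT) F (\col_i tnth v i))%E.

(* Matrices carry the sup norm in the library, hence explicit Euclidean and
   Frobenius norms. *)
Definition fnorm m n (A : 'M[R]_(m, n)) : R :=
  Num.sqrt (\sum_i \sum_j A i j ^+ 2).
Definition enorm (x : 'cV[R]_d) : R := Num.sqrt (\sum_i x i 0 ^+ 2).

Definition partial (i : 'I_d) f : 'cV[R]_d -> R :=
  fun x => 'D_(delta_mx i 0) f x.

Fixpoint Ck (k : nat) f : Prop :=
  match k with
  | 0 => continuous f
  | k'.+1 => (forall x, differentiable f x) /\ forall i, Ck k' (partial i f)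
  end.

Definition smooth f : Prop := forall k, Ck k f.

Definition grad f : 'cV[R]_d -> 'cV[R]_d := fun x => \col_i partial i f x.

Definition divergence X : 'cV[R]_d -> R :=
  fun x => \sum_i partial i (fun y => X y i 0) x.

Definition smooth_pos_density rho : Prop :=
  [/\ smooth rho, forall x, 0 < rho x & int_Rd (fun x => (rho x)%:E) = 1%:E].

End euclidean_space.

(* Derivative relative to a subset, so one-sided at the end points of an
   interval. *)
Definition has_derivative_within (R : realType) (A : set R) (h : R -> R)
    (t l : R) : Prop :=
  (fun s => (h s - h t) / (s - t)) @ within A (t^') --> l.

Section otto.
Context {R : realType} {d : nat}.
Implicit Types (f rho nu : 'cV[R]_d -> R) (gamma : R -> 'cV[R]_d -> R).

Definition otto_phi rho f : 'cV[R]_d -> R :=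
  fun x => - divergence (fun y => rho y *: grad f y) x.

(* [gamma] is a dual geodesic from [rho] to [nu] with potential [f]; only the
   restriction of [gamma] to [0, 1] is relevant. *)
Definition otto_dual_geodesic rho nu gamma f : Prop :=
  [/\ smooth f,
      forall t, t \in `[0, 1] -> smooth_pos_density (gamma t),
      forall t x, t \in `[0, 1] ->
        has_derivative_within `[0, 1] (gamma ^~ x) t (otto_phi (gamma t) f x),
      gamma 0 = rho
    & gamma 1 = nu].

Definition otto_metric rho f : \bar R :=
  int_Rd (fun x => (enorm (grad f x) ^+ 2 * rho x)%:E).

Definition otto_action gamma f : \bar R :=
  (\int[lebesgue_measure]_(t in `[0%R, 1%R]) (t%:E * otto_metric (gamma t) f))%E.

Definition otto_divergence rho nu : \bar R :=
  ereal_inf [set a | exists gamma f,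
    otto_dual_geodesic rho nu gamma f /\ a = otto_action gamma f].

Definition quadratic (B : 'M[R]_d) (b : 'cV[R]_d) : 'cV[R]_d -> R :=
  fun x => 2^-1 * (x^T *m B *m x) 0 0 + (b^T *m x) 0 0.

(* Uniqueness is that of the curve, not of its potential.  Existence of a
   geodesic with quadratic potential is not part of the hypothesis. *)
Definition quadratic_dual_geodesic_unique rho nu : Prop :=
  forall gamma B b, B^T = B ->
    otto_dual_geodesic rho nu gamma (quadratic B b) ->
  forall gamma' f, otto_dual_geodesic rho nu gamma' f ->
  forall t, t \in `[0, 1] -> gamma' t = gamma t.

End otto.

Section matrix_functions.
Context {R : realType} {d : nat}.
Implicit Types (A B X : 'M[R]_d).

(* Spectral calculus: [B] below is uniquely determined, and exists when [A] is
   symmetric; [spectral_fun phi A] is 0 if [A] is not symmetric. *)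
Definition spectral_fun (phi : R -> R) A : 'M[R]_d :=
  xget 0 [set B | exists (P : 'M[R]_d) (a : 'rV[R]_d),
    [/\ P^T *m P = 1%:M,
        A = P *m diag_mx a *m P^T
      & B = P *m diag_mx (map_mx phi a) *m P^T]].

Definition logmx A := spectral_fun (@ln R) A.
Definition sqrtmx A := spectral_fun Num.sqrt A.

Definition is_mp_inv A X : Prop :=
  [/\ A *m X *m A = A, X *m A *m X = X,
      (A *m X)^T = A *m X & (X *m A)^T = X *m A].

Definition mp_inv A : 'M[R]_d := xget 0 [set X | is_mp_inv A X].

Definition perpmx A : 'M[R]_d := 1%:M - A *m mp_inv A.

Definition spd A : Prop :=
  A^T = A /\ forall v : 'cV[R]_d, v != 0 -> 0 < (v^T *m A *m v) 0 0.

End matrix_functions.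

Section elliptic.
Context {R : realType}.
Local Notation mu := (@lebesgue_measure R).

Definition smooth_halfline (g : R -> R) : Prop :=
  exists h : nat -> R -> R, h 0%N = g /\
    forall k r, 0 <= r -> has_derivative_within `[0, +oo[ (h k) r (h k.+1 r).

Definition Gamma (s : R) : R :=
  (\int[mu]_(t in `[0%R, +oo[) (t `^ (s - 1) * expR (- t)))%R.

Definition elliptic_generator (d : nat) (g : R -> R) : Prop :=
  [/\ smooth_halfline g,
      forall r, 0 <= r -> 0 < g r,
      mu.-integrable `[0%R, +oo[ (EFin \o g),
      ((pi `^ (d%:R / 2) / Gamma (d%:R / 2))%:E *
        \int[mu]_(r in `[0%R, +oo[) (r `^ (d%:R / 2 - 1) * g r)%:E = 1)%E
    & (\int[mu]_(r in `[0%R, +oo[) (r `^ ((d%:R - 1) / 2) * g r)%:E < +oo)%E /\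
      (\int[mu]_(r in `[0%R, +oo[) (r `^ (d%:R / 2) * g r)%:E < +oo)%E].

Definition elliptic (d : nat) (m : 'cV[R]_d) (S : 'M[R]_d) (g : R -> R)
    (rho : 'cV[R]_d -> R) : Prop :=
  [/\ spd S, elliptic_generator d g
    & forall x, rho x =
        (Num.sqrt (\det S))^-1 * g (((x - m)^T *m invmx S *m (x - m)) 0 0)].

Definition kappa (d : nat) (g : R -> R) : R :=
  d%:R^-1 * fine (int_Rd (fun y : 'cV[R]_d =>
    (enorm y ^+ 2 * g (enorm y ^+ 2))%:E)).

End elliptic.

(* Main.v *)
Require Import Defs.
From HB Require Import structures.
From mathcomp Require Import all_boot all_order all_algebra.
From mathcomp Require Import all_classical all_reals all_analysis.
From mathcomp Require Import measurable_realfun complex ring lra.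

(** Some affine gradient field transports [rho] to [nu]:
    with [R] the transport matrix, which satisfies [R S0 R = S1], the potential
    whose gradient is [x |-> (log R) (x - m0) + beta] generates a flow of affine
    maps, namely [exp (t log R)] about a moving mean, and a suitable [beta]
    brings [m0] to [m1] at time 1.  Transporting [rho] by this flow gives a curve
    of elliptic densities from [rho] to [nu] with one and the same generator;
    differentiating the density in time gives the continuity equation
    ([flow_continuity]), so the curve is an Otto-dual geodesic with quadratic
    potential ([flow_geodesic]).

    Along it, the energy is the integral of the squared norm of an affine
    function, so it involves only the first two moments of an elliptic density
    ([elliptic_second_moment]).  In an orthonormal basis of eigenvectors of
    [log R], with eigenvalues [l k], each component of the velocity grows like
    [exp (t * l k)], so the energy is a sum of terms
    [exp (2 t l k) * mode_energy k] ([flow_metric]) and the action has an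
    elementary primitive in time ([time_integral]).  The closed formulas of the
    theorem are functions of [R], hence diagonal in the same basis, and the
    comparison is made eigenvalue by eigenvalue ([divergence_formula_spectral],
    [flow_energy_sum]).

    By the uniqueness hypothesis, every other dual geodesic from [rho] to [nu]
    follows the same curve, but perhaps with another potential [f'].  Both
    potentials then induce the same tangent vector at each time, so the field
    [rho (grad f' - grad f)] is divergence free.  If this field were integrable
    against [grad f], then [grad f] would be the orthogonal projection of
    [grad f'] and have the smaller norm.  No growth of [f'] is assumed, but [f] is
    quadratic and [rho] has a second moment, which is enough to carry this
    out with [f] truncated ([energy_le]).  So the quadratic potential attains
    the infimum ([flow_divergence]).

    The moments rest on two facts about the iterated Lebesgue measure: the
    change of variables under an invertible affine map ([int_Rd_affine], by
    block elimination) and the reduction of radial integrals to one variable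
    ([radial_integral]).  The diagonalisation of symmetric matrices over
    the real field is [spectral_thm]. *)

Set Implicit Arguments.
Unset Strict Implicit.
Unset Printing Implicit Defensive.

Import Order.TTheory GRing.Theory Num.Theory.
Import numFieldNormedType.Exports.

Local Open Scope classical_set_scope.
Local Open Scope ring_scope.

(** * Symmetric real matrices are orthogonally diagonalisable *)

Section spectral_theorem.
Context {T : realType}.

Lemma mx11_mulC n (u v : 'cV[T]_n) : (u^T *m v) 0 0 = (v^T *m u) 0 0.
Proof. by rewrite -{1}(trmxK v) -trmx_mul mxE. Qed.

Lemma sqnormE n (u : 'cV[T]_n) : (u^T *m u) 0 0 = \sum_i u i 0 ^+ 2.
Proof. by rewrite mxE; apply: eq_bigr => i _; rewrite mxE expr2. Qed.

Lemma sqnorm_ge0 n (u : 'cV[T]_n) : 0 <= (u^T *m u) 0 0.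
Proof. by rewrite sqnormE sumr_ge0// => i _; exact: sqr_ge0. Qed.

Lemma sqnorm_eq0 n (u : 'cV[T]_n) : ((u^T *m u) 0 0 == 0) = (u == 0).
Proof.
rewrite sqnormE; apply/eqP/eqP => [/eqP|->]; last first.
  by apply: big1 => i _; rewrite mxE expr0n.
rewrite psumr_eq0; last by move=> i _; exact: sqr_ge0.
move=> /allP u0; apply/matrixP => i j; rewrite ord1 mxE.
by have := u0 i (mem_index_enum i); rewrite sqrf_eq0 => /eqP.
Qed.

Lemma mulmx11 n (u : 'cV[T]_n) (a : 'M[T]_1) : u *m a = a 0 0 *: u.
Proof.
by apply/matrixP => i j; rewrite !mxE big_ord1 !ord1 mulrC.
Qed.

(** The reflection in the hyperplane orthogonal to [u - |u| e0].  When this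
    vector vanishes, [q^-1 = 0] makes [H] the identity, which then is right. *)
Lemma householder n (u : 'cV[T]_n.+1) : exists H : 'M[T]_n.+1,
  [/\ H^T = H, H *m H = 1%:M &
      H *m u = Num.sqrt ((u^T *m u) 0 0) *: delta_mx 0 0].
Proof.
set s := Num.sqrt _; pose e : 'cV[T]_n.+1 := delta_mx 0 0.
have ss : s ^+ 2 = (u^T *m u) 0 0 by rewrite sqr_sqrtr// sqnorm_ge0.
pose w := u - s *: e; pose q := (w^T *m w) 0 0.
pose H := 1%:M - (2 / q) *: (w *m w^T).
have ee : (e^T *m e) 0 0 = 1.
  rewrite sqnormE (bigD1 0)//= mxE/= expr1n big1 ?addr0// => i i0.
  by rewrite mxE (negbTE i0) expr0n.
have qE : q = 2 * (w^T *m u) 0 0.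
  rewrite /q /w [trmx _]raddfB/= [trmx (s *: e)]linearZ/=.
  rewrite !(mulmxDl, mulmxDr, mulNmx, mulmxN) -!(scalemxAl, scalemxAr).
  have := mx11_mulC u e; move: ss ee.
  move: (u^T *m u) (e^T *m e) (u^T *m e) (e^T *m u) => uu EE ue eu.
  rewrite !mxE; nra.
have ww : w *m w^T *m (w *m w^T) = q *: (w *m w^T).
  by rewrite mulmxA -(mulmxA w) mulmx11 -scalemxAl.
exists H; split.
- by rewrite /H linearB/= linearZ/= trmx_mul trmxK tr_scalar_mx.
- rewrite /H mulmxBl mul1mx mulmxBr mulmx1 -scalemxAl -scalemxAr ww !scalerA.
  have [->|q0] := eqVneq q 0; first by rewrite invr0 !(mulr0, mul0r) !scale0r !subr0.
  have -> : 2 / q * (2 / q) * q = 2 / q + 2 / q by field.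
  by rewrite scalerDl opprB addrK subrK.
- rewrite /H mulmxBl mul1mx -scalemxAl -mulmxA mulmx11 scalerA.
  have [q0|q0] := eqVneq q 0.
    rewrite q0 invr0 mulr0 mul0r scale0r subr0.
    by move/eqP : q0; rewrite sqnorm_eq0 subr_eq0 => /eqP.
  have -> : 2 / q * (w^T *m u) 0 0 = 1 by rewrite mulrAC -qE divff.
  by rewrite scale1r /w opprB addrC subrK.
Qed.

(** Over the complex numbers there is an eigenvector [x + i y] with eigenvalue
    [a + i b]; symmetry of [A] forces [b (|x|^2 + |y|^2) = 0], hence [b = 0],
    and then [x] or [y] is a real eigenvector. *)
Lemma sym_eigenvector n (A : 'M[T]_n.+1) : A^T = A ->
  exists (l : T) (v : 'cV[T]_n.+1), v != 0 /\ A *m v = l *: v.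
Proof.
move=> As.
pose f : {rmorphism T -> T[i]} := real_complex T.
have [z zr] : exists z, root (char_poly (map_mx f A)) z.
  by apply/closed_rootP; rewrite size_char_poly.
move: zr; rewrite -eigenvalue_root_char => /eigenvalueP [v vA v0].
pose x : 'cV[T]_n.+1 := \col_i complex.Re (v 0 i).
pose y : 'cV[T]_n.+1 := \col_i complex.Im (v 0 i).
pose a := complex.Re z; pose b := complex.Im z.
have AE (i : 'I_n.+1) : (A *m x) i 0 = a * x i 0 - b * y i 0 /\
     (A *m y) i 0 = b * x i 0 + a * y i 0.
  have /matrixP/(_ 0 i) := vA; rewrite !mxE.
  have -> : \sum_j v 0 j * map_mx f A j i =
    Complex (\sum_j A i j * x j 0) (\sum_j A i j * y j 0).
    rewrite (eq_bigr (fun j => Complex (A i j * x j 0) (A i j * y j 0))).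
      elim: (index_enum _) => [|j r IH]; rewrite ?big_nil// !big_cons IH//.
    move=> j _; have <- : A j i = A i j by rewrite -{1}As mxE.
    rewrite !mxE; case: (v 0 j) => p q /=.
    by rewrite /GRing.mul/= !mulr0 !subr0 !add0r ![_ * A _ _]mulrC.
  have -> : z = Complex a b by rewrite /a /b; case: (z).
  case: (v 0 i) => p q /=; rewrite {1}/GRing.mul/=.
  by case=> -> ->; split=> //; rewrite addrC.
have Ax : A *m x = a *: x - b *: y.
  by apply/matrixP => i j; rewrite ord1 (AE i).1 !mxE.
have Ay : A *m y = b *: x + a *: y.
  by apply/matrixP => i j; rewrite ord1 (AE i).2 !mxE.
have b0 : b * ((x^T *m x) 0 0 + (y^T *m y) 0 0) = 0.
  have : (y^T *m (A *m x)) 0 0 = (x^T *m (A *m y)) 0 0.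
    by rewrite mx11_mulC trmx_mul As mulmxA.
  rewrite Ax Ay !(mulmxBr, mulmxDr) -!scalemxAr.
  have := mx11_mulC x y; set xy := (x^T *m y); set yx := (y^T *m x).
  by rewrite !mxE => ->; lra.
have xy0 : ~ (x = 0 /\ y = 0).
  move=> [x0 y0]; case/eqP: v0; apply/matrixP => i j; rewrite ord1 [RHS]mxE.
  have := congr1 (fun M : 'cV_ _ => M j 0) x0.
  have := congr1 (fun M : 'cV_ _ => M j 0) y0.
  by rewrite !mxE; case: (v 0 j) => p q /= -> ->.
have {}b0 : b = 0.
  move/eqP : b0; rewrite mulf_eq0 => /orP[/eqP//|].
  rewrite paddr_eq0 ?sqnorm_ge0// !sqnorm_eq0 => /andP[/eqP ? /eqP ?].
  by case: xy0.
rewrite b0 scale0r subr0 in Ax; rewrite b0 scale0r add0r in Ay.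
have [x0|x0] := eqVneq x 0; last by exists a, x.
exists a, y; split=> //; apply/eqP => y0; exact: xy0.
Qed.

(** Induction on the size: the reflection that sends an eigenvector to the first
    axis conjugates [A] to a block diagonal matrix. *)
Lemma spectral_thm n (A : 'M[T]_n) : A^T = A ->
  exists (P : 'M[T]_n) (a : 'rV[T]_n),
    P^T *m P = 1%:M /\ A = P *m diag_mx a *m P^T.
Proof.
elim: n A => [|n IH] A As.
  by exists 1%:M, 0; split; apply/matrixP => -[].
have [l [v [v0 Av]]] := sym_eigenvector As.
have [H [Hs HH Hv]] := householder v.
set s := Num.sqrt _ in Hv.
have s0 : s != 0 by rewrite sqrtr_eq0 -ltNge lt_neqAle eq_sym sqnorm_eq0 v0 sqnorm_ge0.
pose C : 'M[T]_(1 + n) := H *m A *m H.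
have Cs : C^T = C by rewrite /C !trmx_mul Hs As mulmxA.
have Ce : C *m delta_mx 0 0 = l *: (delta_mx 0 0 : 'cV_(1 + n)).
  have -> : delta_mx 0 0 = s^-1 *: (H *m v) by rewrite Hv scalerA mulVf// scale1r.
  by rewrite /C -!scalemxAr -!mulmxA (mulmxA H H) HH mul1mx Av -scalemxAr !scalerA mulrC.
have CD : C = H *m A *m H by [].
have C0 i : C i 0 = l *+ (i == 0).
  have := congr1 (fun M : 'cV_ _ => M i 0) Ce.
  rewrite -colE !mxE => ->.
  by rewrite andbT mulr_natr.
have [|P [a [PP E]]] := IH (drsubmx C); first by rewrite trmx_drsub Cs.
clearbody C.
have l0 : lshift n (0 : 'I_1) = 0 by apply/val_inj.
have CE : C = block_mx l%:M 0 0 (drsubmx C).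
  rewrite -[LHS]submxK; congr block_mx.
  - by apply/matrixP => i j; rewrite !ord1 !mxE l0 [LHS]C0.
  - by apply/matrixP => i j; rewrite ord1 -Cs !mxE l0 [LHS]C0.
  - by apply/matrixP => i j; rewrite ord1 !mxE l0 [LHS]C0.
pose P' : 'M[T]_(1 + n) := block_mx 1%:M 0 0 P.
have tP' : P'^T = block_mx 1%:M 0 0 P^T by rewrite tr_block_mx !trmx0 tr_scalar_mx.
have PP' : P'^T *m P' = 1%:M.
  rewrite tP' /P' mulmx_block.
  by rewrite !(mulmx0, mul0mx, addr0, add0r, mulmx1) PP -scalar_mx_block.
have CE' : C = P' *m diag_mx (row_mx l%:M a) *m P'^T.
  rewrite CE E tP' /P' diag_mx_row !mulmx_block.
  rewrite !(mulmx0, mul0mx, addr0, add0r, mulmx1, mul1mx).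
  congr block_mx.
  by apply/matrixP => i j; rewrite !ord1 !mxE /= mulr1n.
exists (H *m P'), (row_mx l%:M a); split.
  by rewrite trmx_mul Hs -mulmxA (mulmxA H) HH mul1mx PP'.
have -> : A = H *m C *m H.
  by rewrite CD !mulmxA HH mul1mx -mulmxA HH mulmx1.
by rewrite trmx_mul Hs CE' !mulmxA.
Qed.

End spectral_theorem.

(** * Functions of a symmetric matrix *)

Section spectral_calculus.
Context {T : realType} {d : nat}.
Implicit Types (P A B S X : 'M[T]_d) (f g : 'I_d -> T).

(** All the matrix functions below are diagonal in the basis of the columns of
    one and the same [P], so that identities between them reduce to
    identities between the diagonals [f]. *)
Definition spmx P f : 'M[T]_d := P *m diag_mx (\row_i f i) *m P^T.

Lemma orthogonal_mulmxtr P : P^T *m P = 1%:M -> P *m P^T = 1%:M.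
Proof. exact: mulmx1C. Qed.

Lemma eq_spmx P f g : f =1 g -> spmx P f = spmx P g.
Proof. by move=> /funext ->. Qed.

Lemma trmx_spmx P f : (spmx P f)^T = spmx P f.
Proof. by rewrite /spmx !trmx_mul trmxK tr_diag_mx mulmxA. Qed.

Lemma spmxD P f g : spmx P f + spmx P g = spmx P (fun i => f i + g i).
Proof.
rewrite /spmx -mulmxDl -mulmxDr -raddfD/=; congr (_ *m diag_mx _ *m _).
by apply/matrixP => i j; rewrite !mxE.
Qed.

Lemma spmxZ P c f : c *: spmx P f = spmx P (fun i => c * f i).
Proof.
rewrite /spmx scalemxAl scalemxAr -linearZ/=; congr (_ *m diag_mx _ *m _).
by apply/matrixP => i j; rewrite !mxE.
Qed.

Lemma spmxB P f g : spmx P f - spmx P g = spmx P (fun i => f i - g i).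
Proof.
rewrite -scaleN1r spmxZ spmxD; apply: eq_spmx => i.
by rewrite mulN1r.
Qed.

Lemma spmxM P f g : P^T *m P = 1%:M ->
  spmx P f *m spmx P g = spmx P (fun i => f i * g i).
Proof.
move=> PP; rewrite /spmx -!mulmxA (mulmxA P^T) PP mul1mx; congr (_ *m _).
rewrite !mulmxA mulmx_diag; congr (diag_mx _ *m _).
by apply/matrixP => i j; rewrite !mxE.
Qed.

Lemma spmx1 P : P^T *m P = 1%:M -> spmx P (fun=> 1) = 1%:M.
Proof.
move=> /orthogonal_mulmxtr PP; rewrite /spmx.
have -> : \row_i 1 = const_mx 1 :> 'rV[T]_d by apply/matrixP => i j; rewrite !mxE.
by rewrite diag_const_mx mulmx1.
Qed.

Lemma spmx_inv P f : P^T *m P = 1%:M -> (forall i, f i != 0) ->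
  spmx P f \in unitmx /\ invmx (spmx P f) = spmx P (fun i => (f i)^-1).
Proof.
move=> PP f0.
have E : spmx P f *m spmx P (fun i => (f i)^-1) = 1%:M.
  by rewrite spmxM// -(spmx1 PP); apply: eq_spmx => i; rewrite divff.
have [U _] := mulmx1_unit E; split => //.
by rewrite -[LHS]mulmx1 -E mulmxA mulVmx// mul1mx.
Qed.

Lemma tr_spmx P f A :
  \tr (A *m spmx P f) = \sum_i f i * (P^T *m A *m P) i i.
Proof.
rewrite /spmx mulmxA mxtrace_mulC !mulmxA mul_mx_diag /mxtrace.
by apply: eq_bigr => i _; rewrite !mxE mulrC.
Qed.

Lemma det_spmx P f : P^T *m P = 1%:M -> \det (spmx P f) = \prod_i f i.
Proof.
move=> PP; rewrite /spmx !det_mulmx mulrAC -det_mulmx orthogonal_mulmxtr//.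
by rewrite det1 mul1r det_diag; apply: eq_bigr => i _; rewrite mxE.
Qed.

Lemma spmx_mulr P f (x : 'cV_d) (i : 'I_d) : P^T *m P = 1%:M ->
  (P^T *m (spmx P f *m x)) i 0 = f i * (P^T *m x) i 0.
Proof.
move=> PP; rewrite /spmx -!mulmxA (mulmxA P^T P) PP mul1mx mul_diag_mx mxE.
by rewrite !mxE.
Qed.

Lemma quad_spmx P f (x : 'cV_d) :
  (x^T *m spmx P f *m x) 0 0 = \sum_i f i * (P^T *m x) i 0 ^+ 2.
Proof.
rewrite /spmx -!mulmxA mul_diag_mx mulmxA -[x^T *m P]trmxK trmx_mul trmxK.
set y := P^T *m x; rewrite mxE; apply: eq_bigr => i _.
by rewrite !mxE expr2 mulrCA.
Qed.

Lemma sqnorm_orth P (x : 'cV_d) : P^T *m P = 1%:M ->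
  ((P^T *m x)^T *m (P^T *m x)) 0 0 = (x^T *m x) 0 0.
Proof.
move=> PP; rewrite trmx_mul trmxK -mulmxA (mulmxA P) orthogonal_mulmxtr//.
by rewrite mul1mx.
Qed.

Lemma enorm_sqr (x : 'cV[T]_d) : enorm x ^+ 2 = (x^T *m x) 0 0.
Proof. by rewrite /enorm -sqnormE sqr_sqrtr// sqnorm_ge0. Qed.

Lemma enorm_spmx P f (x : 'cV_d) : P^T *m P = 1%:M ->
  enorm (spmx P f *m x) ^+ 2 = \sum_i f i ^+ 2 * (P^T *m x) i 0 ^+ 2.
Proof.
move=> PP; rewrite enorm_sqr trmx_mul trmx_spmx mulmxA -(mulmxA x^T) spmxM//.
by rewrite quad_spmx; apply: eq_bigr => i _; rewrite expr2.
Qed.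

(** The entries of an intertwiner [U] of two diagonal matrices vanish unless
    the corresponding eigenvalues agree, so [U] also intertwines any function
    of them.  This gives both the uniqueness of the spectral calculus and the
    fact that it commutes with whatever commutes with the matrix. *)
Lemma diag_intertwine (phi : T -> T) (a b : 'rV[T]_d) (U : 'M[T]_d) :
  diag_mx a *m U = U *m diag_mx b ->
  diag_mx (map_mx phi a) *m U = U *m diag_mx (map_mx phi b).
Proof.
rewrite !mul_diag_mx !mul_mx_diag => /matrixP E; apply/matrixP => i j.
have := E i j; rewrite !mxE => {}E.
have [->|U0] := eqVneq (U i j) 0; first by rewrite mul0r mulr0.
suff -> : a 0 i = b 0 j by rewrite mulrC.
by apply: (mulIf U0); rewrite E mulrC.
Qed.

(** Apply [diag_intertwine] to [P^T *m Q]. *)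
Lemma spectral_decomp_unique (phi : T -> T) P Q (a b : 'rV_d) :
  P^T *m P = 1%:M -> Q^T *m Q = 1%:M ->
  P *m diag_mx a *m P^T = Q *m diag_mx b *m Q^T ->
  P *m diag_mx (map_mx phi a) *m P^T = Q *m diag_mx (map_mx phi b) *m Q^T.
Proof.
move=> PP QQ E.
have H0 : diag_mx a *m (P^T *m Q) = P^T *m Q *m diag_mx b.
  have /(congr1 (fun M : 'M[T]_d => P^T *m M *m Q)) := E.
  by rewrite !mulmxA PP mul1mx => ->; rewrite -(mulmxA _ Q^T Q) QQ mulmx1.
have H := diag_intertwine phi H0.
rewrite -[LHS]mulmx1 -(orthogonal_mulmxtr QQ) -!mulmxA.
rewrite (mulmxA P^T Q) (mulmxA (diag_mx _) (P^T *m Q)) H !mulmxA orthogonal_mulmxtr//.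
by rewrite mul1mx.
Qed.

Lemma spectral_funE (phi : T -> T) P f : P^T *m P = 1%:M ->
  spectral_fun phi (spmx P f) = spmx P (phi \o f).
Proof.
move=> PP; rewrite /spectral_fun.
have mapE g : map_mx phi (\row_i g i) = \row_i (phi \o g) i :> 'rV[T]_d.
  by apply/matrixP => i j; rewrite !mxE.
case: xgetP => [B _ /= [Q [a [QQ E ->]]]|/(_ (spmx P (phi \o f)))].
  rewrite /spmx -mapE; apply: (@spectral_decomp_unique phi Q P a); rewrite // -E.
by case; exists P, (\row_i f i); split; rewrite // mapE.
Qed.

Lemma sym_spectral A : A^T = A ->
  exists P f, P^T *m P = 1%:M /\ A = spmx P f.
Proof.
move=> /spectral_thm [P [a [PP ->]]]; exists P, (fun i => a 0 i); split => //.
by congr (_ *m diag_mx _ *m _); apply/matrixP => i j; rewrite !mxE ord1.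
Qed.

Lemma spectral_fun_comm (phi : T -> T) A X : A^T = A ->
  A *m X = X *m A -> spectral_fun phi A *m X = X *m spectral_fun phi A.
Proof.
move=> /sym_spectral [P [f [PP ->]]]; rewrite spectral_funE//.
set a := \row_i f i => E.
have H : diag_mx (map_mx phi a) *m (P^T *m X *m P) =
         (P^T *m X *m P) *m diag_mx (map_mx phi a).
  apply: diag_intertwine.
  have /(congr1 (fun M : 'M[T]_d => P^T *m M *m P)) := E; rewrite /spmx -/a.
  by rewrite !mulmxA PP mul1mx -!mulmxA PP mulmx1.
have -> : spmx P (phi \o f) = P *m diag_mx (map_mx phi a) *m P^T.
  by congr (_ *m diag_mx _ *m _); apply/matrixP => i j; rewrite !mxE.
have PP' := orthogonal_mulmxtr PP.
have /(congr1 (fun M : 'M[T]_d => P *m M *m P^T)) := H.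
rewrite -!mulmxA PP' mulmx1 => ->.
by rewrite !mulmxA PP' mul1mx.
Qed.

Lemma mp_inv_unique A X Y : is_mp_inv A X -> is_mp_inv A Y -> X = Y.
Proof.
move=> [X1 X2 X3 X4] [Y1 Y2 Y3 Y4].
have E1 : A *m X = A *m Y.
  have /(congr1 trmx) : A *m X *m (A *m Y) = A *m Y by rewrite mulmxA X1.
  by rewrite trmx_mul X3 Y3 mulmxA Y1.
have E2 : X *m A = Y *m A.
  have /(congr1 trmx) : Y *m A *m (X *m A) = Y *m A by rewrite -!mulmxA (mulmxA A) X1.
  by rewrite trmx_mul X4 Y4 -!mulmxA (mulmxA A) Y1.
by rewrite -X2 -mulmxA E1 mulmxA E2 Y2.
Qed.

(** The convention [0^-1 = 0] makes entrywise inversion of the diagonal a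
    pseudo-inverse. *)
Lemma mp_inv_spmx P f : P^T *m P = 1%:M ->
  mp_inv (spmx P f) = spmx P (fun i => (f i)^-1).
Proof.
move=> PP.
have H : is_mp_inv (spmx P f) (spmx P (fun i => (f i)^-1)).
  split; rewrite !spmxM// ?trmx_spmx//; apply: eq_spmx => i;
  by have [->|f0] := eqVneq (f i) 0; rewrite ?(invr0, mulr0)//; field.
rewrite /mp_inv; case: xgetP => [B _ /= HB|/(_ _ H)//].
exact: mp_inv_unique HB H.
Qed.

Lemma spmx_spd P f : P^T *m P = 1%:M -> (forall i, 0 < f i) -> spd (spmx P f).
Proof.
move=> PP f0; split; first exact: trmx_spmx.
move=> v v0; rewrite quad_spmx lt_neqAle sumr_ge0 ?andbT; last first.
  by move=> i _; rewrite mulr_ge0 ?sqr_ge0// ltW.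
rewrite eq_sym psumr_eq0; last by move=> i _; rewrite mulr_ge0 ?sqr_ge0// ltW.
apply: contra v0 => /allP H.
rewrite -(mul1mx v) -(orthogonal_mulmxtr PP) -mulmxA.
suff -> : P^T *m v = 0 by rewrite mulmx0.
apply/matrixP => i j; rewrite ord1 [RHS]mxE; have := H i (mem_index_enum i).
by rewrite mulf_eq0 gt_eqF//= sqrf_eq0 => /eqP.
Qed.

Lemma spd_spectral A : spd A ->
  exists P f, [/\ P^T *m P = 1%:M, A = spmx P f & forall i, 0 < f i].
Proof.
move=> [/sym_spectral [P [f [PP AE]]] pA]; exists P, f; split => // i.
have := pA (P *m delta_mx i 0) _; rewrite AE quad_spmx mulmxA PP mul1mx.
rewrite (bigD1 i)//= big1 ?addr0 => [|j ji]; last first.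
  by rewrite mxE (negbTE ji) expr0n mulr0.
rewrite mxE !eqxx expr1n mulr1; apply.
apply/eqP => /(congr1 (mulmx P^T)); rewrite mulmxA PP mul1mx mulmx0.
move=> /matrixP /(_ i 0); rewrite !mxE !eqxx => /eqP; by rewrite oner_eq0.
Qed.

Lemma spd_unit A : spd A -> A \in unitmx.
Proof.
move=> /spd_spectral[P [f [PP -> f0]]].
by apply: (spmx_inv PP _).1 => i; rewrite gt_eqF.
Qed.

Lemma spd_inv A : spd A -> spd (invmx A).
Proof.
move=> /spd_spectral[P [f [PP -> f0]]]; rewrite (spmx_inv PP _).2; last first.
  by move=> i; rewrite gt_eqF.
by apply: spmx_spd => // i; rewrite invr_gt0.
Qed.

Lemma det_spd_gt0 A : spd A -> 0 < \det A.
Proof.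
by move=> /spd_spectral[P [f [PP -> f0]]]; rewrite det_spmx// prodr_gt0.
Qed.

Lemma spd_congr A B : B \in unitmx -> B^T = B -> spd A -> spd (B *m A *m B).
Proof.
move=> uB Bs [As pA]; split; first by rewrite !trmx_mul Bs As mulmxA.
move=> v v0; have := pA (B *m v) _; rewrite trmx_mul Bs !mulmxA; apply.
by apply: contra_neq v0 => /(congr1 (mulmx (invmx B))); rewrite mulKmx// mulmx0.
Qed.

Lemma sqrtmx_spd A : spd A -> spd (sqrtmx A) /\ sqrtmx A *m sqrtmx A = A.
Proof.
move=> /spd_spectral[P [f [PP -> f0]]]; rewrite /sqrtmx spectral_funE//; split.
  by apply: spmx_spd => // i /=; rewrite sqrtr_gt0.
by rewrite spmxM//; apply: eq_spmx => i /=; rewrite -expr2 sqr_sqrtr// ltW.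
Qed.

Lemma sqrtmx_mul_self A : spd A -> sqrtmx (A *m A) = A.
Proof.
move=> /spd_spectral[P [f [PP -> f0]]]; rewrite /sqrtmx spmxM// spectral_funE//.
by apply: eq_spmx => i /=; rewrite -expr2 sqrtr_sqr gtr0_norm.
Qed.

(** [transport_mx S0 S1] is the unique positive definite solution [R] of
    [R *m S0 *m R = S1], that is, the linear part of the optimal map between
    centred Gaussians. *)
Definition transport_mx S0 S1 : 'M[T]_d :=
  let h := sqrtmx S0 in invmx h *m sqrtmx (h *m S1 *m h) *m invmx h.

Lemma transport_mx_spd S0 S1 : spd S0 -> spd S1 ->
  spd (transport_mx S0 S1) /\
  transport_mx S0 S1 *m S0 *m transport_mx S0 S1 = S1.
Proof.
move=> p0 p1; rewrite /transport_mx /=.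
have [ph hh] := sqrtmx_spd p0; set h := sqrtmx S0 in ph hh *.
have uh := spd_unit ph; have [hs _] := ph.
have [pM MM] := sqrtmx_spd (spd_congr uh hs p1).
set M := sqrtmx _ in pM MM *; split.
  by apply: spd_congr => //; [rewrite unitmx_inv|rewrite trmx_inv hs].
rewrite -{1}hh !mulmxA mulmxKV// -!mulmxA (mulmxA h) mulmxV// mul1mx.
by rewrite (mulmxA M) MM !mulmxA mulVmx// mul1mx mulmxK.
Qed.

(** If [S0] and [S1] commute then so do all functions of them, and the square
    root of [h S1 h = (k h)^2] is the positive definite matrix [k h], where
    [h] and [k] are the square roots of [S0] and [S1]. *)
Lemma transport_mx_comm S0 S1 : spd S0 -> spd S1 -> S0 *m S1 = S1 *m S0 ->
  transport_mx S0 S1 *m sqrtmx S0 = sqrtmx S1.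
Proof.
move=> p0 p1 C; rewrite /transport_mx /=.
have [ph hh] := sqrtmx_spd p0; have [pk kk] := sqrtmx_spd p1.
have hC : sqrtmx S0 *m S1 = S1 *m sqrtmx S0 by apply: spectral_fun_comm => //; case: p0.
have kC : sqrtmx S1 *m sqrtmx S0 = sqrtmx S0 *m sqrtmx S1.
  by apply: spectral_fun_comm => //; case: p1.
set h := sqrtmx S0 in ph hh hC kC *; set k := sqrtmx S1 in pk kk kC *.
have uh := spd_unit ph; have [hs _] := ph.
have [pq qq] := sqrtmx_spd ph; set q := sqrtmx h in pq qq.
have qC : q *m k = k *m q by apply: spectral_fun_comm.
have -> : h *m S1 *m h = (k *m h) *m (k *m h).
  by rewrite hC -kk mulmxA -(mulmxA _ h k) -kC !mulmxA.
rewrite sqrtmx_mul_self; last first.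
  have -> : k *m h = q *m k *m q by rewrite qC -mulmxA qq.
  by apply: spd_congr; [exact: spd_unit|case: pq|].
by rewrite kC mulmxKV// mulKmx.
Qed.

End spectral_calculus.

(** * The closed formula in an eigenbasis of the transport matrix *)

Section closed_form.
Context {T : realType} {d : nat}.
Implicit Types (S : 'M[T]_d).

(** [action_weight l = 4 l^2 a] where [a] is the integral of
    [t * expR (2 * t * l)] for [t] from 0 to 1; see [time_weight_action]. *)
Definition action_weight (l : T) : T := 2 * l * expR (2 * l) - expR (2 * l) + 1.

(** The eigenvalue of [Q + 2 (log R)^perp] for the eigenvalue [expR l] of [R].
    The pseudo-inverse kills the eigenvalue 1 of [R], and the projection puts
    2 there, the limit of the generic formula as [l] tends to 0. *)
Definition mean_weight (l : T) : T :=
  if l == 0 then 2 else action_weight l / (expR l - 1) ^+ 2.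

(** The weight is [expR (2 * l)] times the gap in the convexity inequality
    [1 - 2 * l <= expR (- (2 * l))]. *)
Lemma action_weight_ge0 l : 0 <= action_weight l.
Proof.
have -> : action_weight l = expR (2 * l) * (expR (- (2 * l)) - (1 - 2 * l)).
  by rewrite mulrBr -expRD subrr expR0 /action_weight; ring.
by rewrite mulr_ge0 ?expR_ge0// subr_ge0 expR_ge1Dx.
Qed.

Lemma action_weight0 : action_weight 0 = 0.
Proof. by rewrite /action_weight !mulr0 expR0; lra. Qed.

Lemma mean_weight_ge0 l : 0 <= mean_weight l.
Proof.
by rewrite /mean_weight; case: ifP => // _; rewrite divr_ge0 ?action_weight_ge0 ?sqr_ge0.
Qed.

Lemma expR_sub1_eq0 (l : T) : (expR l - 1 == 0) = (l == 0).
Proof. by rewrite subr_eq0 -expR0 (inj_eq (@expR_inj T)). Qed.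

Lemma fnorm_sqr (A : 'M[T]_d) : fnorm A ^+ 2 = \tr (A^T *m A).
Proof.
rewrite /fnorm sqr_sqrtr; last first.
  by apply: sumr_ge0 => i _; apply: sumr_ge0 => j _; exact: sqr_ge0.
rewrite exchange_big /mxtrace; apply: eq_bigr => i _; rewrite mxE.
by apply: eq_bigr => j _; rewrite mxE expr2.
Qed.

(** Everything is a function of [R].  In the trace, [S1 = R S0 R] is replaced by
    [S0 R^2], so that the whole trace is that of [S0] times a function of
    [R].  In the commuting case, [sqrtmx S1 - sqrtmx S0 = (R - 1) sqrtmx S0] and
    the factor [R - 1] cancels the two pseudo-inverses in [Q]; where it
    vanishes, so does [action_weight]. *)
Lemma divergence_formula_spectral S0 S1 (Dm : 'cV[T]_d) :
  spd S0 -> spd S1 ->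
  let R := transport_mx S0 S1 in
  let R2 := R *m R in
  let Q := mp_inv (R - 1%:M) *m (logmx R2 *m R2 - R2 + 1%:M) *m mp_inv (R - 1%:M) in
  exists (P : 'M[T]_d) (l : 'I_d -> T),
  [/\ P^T *m P = 1%:M, R = spmx P (fun i => expR (l i)),
   \tr (S0 - S1 + S0 *m R2 *m logmx R2) =
     \sum_i action_weight (l i) * (P^T *m S0 *m P) i i,
   enorm (sqrtmx (Q + 2 *: perpmx (logmx R)) *m Dm) ^+ 2 =
     \sum_i mean_weight (l i) * (P^T *m Dm) i 0 ^+ 2
  & S0 *m S1 = S1 *m S0 ->
    fnorm (sqrtmx Q *m (sqrtmx S1 - sqrtmx S0)) ^+ 2 =
     \sum_i action_weight (l i) * (P^T *m S0 *m P) i i].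
Proof.
move=> p0 p1 R R2 Q.
have [pR RSR] := transport_mx_spd p0 p1; rewrite -/R in pR RSR.
have [P [r [PP RE r0]]] := spd_spectral pR.
pose l i := ln (r i).
have {}RE : R = spmx P (fun i => expR (l i)).
  by rewrite RE; apply: eq_spmx => i; rewrite lnK// posrE.
have R2E : R2 = spmx P (fun i => expR (2 * l i)).
  by rewrite /R2 RE spmxM//; apply: eq_spmx => i; rewrite -expRD -mulr2n mulr_natl.
have lR2 : logmx R2 = spmx P (fun i => 2 * l i).
  by rewrite R2E /logmx spectral_funE//; apply: eq_spmx => i /=; rewrite expRK.
have lR : logmx R = spmx P l.
  by rewrite RE /logmx spectral_funE//; apply: eq_spmx => i /=; rewrite expRK.
have R1 : R - 1%:M = spmx P (fun i => expR (l i) - 1).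
  by rewrite RE -(spmx1 PP) spmxB.
have QE : Q = spmx P (fun i => action_weight (l i) / (expR (l i) - 1) ^+ 2).
  rewrite /Q R1 mp_inv_spmx// lR2 R2E spmxM// spmxB -(spmx1 PP) spmxD !spmxM//.
  by apply: eq_spmx => i; rewrite /action_weight -exprVn expr2; ring.
have WE : 1%:M - R2 + R2 *m logmx R2 = spmx P (action_weight \o l).
  rewrite lR2 R2E spmxM// -(spmx1 PP) spmxB spmxD; apply: eq_spmx => i /=.
  by rewrite /action_weight; ring.
exists P, l; split => //.
- have tr1 : \tr S1 = \tr (S0 *m R2).
    by rewrite -RSR -mulmxA mxtrace_mulC -mulmxA.
  rewrite -(tr_spmx _ (action_weight \o l)) -WE !(mulmxDr, mulmxN) mulmx1 mulmxA.
  by rewrite !(mxtraceD, raddfN)/= tr1.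
- have -> : Q + 2 *: perpmx (logmx R) = spmx P (mean_weight \o l).
    rewrite QE lR /perpmx mp_inv_spmx// spmxM// -(spmx1 PP) spmxB spmxZ spmxD.
    apply: eq_spmx => i /=; rewrite /mean_weight.
    have [->|l0] := eqVneq (l i) 0.
      by rewrite action_weight0 invr0; ring.
    by rewrite divff//; ring.
  rewrite /sqrtmx spectral_funE// enorm_spmx//; apply: eq_bigr => i _ /=.
  by rewrite sqr_sqrtr// mean_weight_ge0.
- move=> C; have kE := transport_mx_comm p0 p1 C; rewrite -/R in kE.
  have [[hs _] hh] := sqrtmx_spd p0.
  have -> : sqrtmx S1 - sqrtmx S0 = (R - 1%:M) *m sqrtmx S0.
    by rewrite mulmxBl mul1mx kE.
  rewrite QE R1 /sqrtmx spectral_funE// -/(sqrtmx S0) mulmxA spmxM//.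
  have trX (X : 'M[T]_d) : X^T = X ->
      fnorm (X *m sqrtmx S0) ^+ 2 = \tr (S0 *m (X *m X)).
    move=> Xs; rewrite fnorm_sqr trmx_mul hs Xs -mulmxA mxtrace_mulC -!mulmxA hh.
    by rewrite mulmxA mxtrace_mulC.
  rewrite trX ?trmx_spmx// spmxM// tr_spmx; apply: eq_bigr => i _ /=.
  congr (_ * _); rewrite mulrACA -!expr2 sqr_sqrtr; last first.
    by rewrite divr_ge0 ?action_weight_ge0 ?sqr_ge0.
  have [->|l0] := eqVneq (l i) 0; first by rewrite action_weight0 !mul0r.
  by rewrite divfK// sqrf_eq0 expR_sub1_eq0.
Qed.

End closed_form.

(** * Affine changes of variables *)

Section lebesgue_tuple_integral.
Context {T : realType}.
Local Open Scope ereal_scope.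
Local Notation mu := (@lebesgue_measure T).
Local Notation tup n := (n.-tuple (measurableTypeR T)).

Definition tcol n (v : tup n) : 'cV[T]_n := \col_i tnth v i.

(** Integrals over column vectors are integrals over tuples; measurability of a
    function of a column vector is therefore that of its composite with
    [tcol]. *)
Definition mfunRd n (F : 'cV[T]_n -> \bar T) :=
  @measurable_fun _ _ (tup n) (\bar T) setT (fun v => F (tcol v)).

Definition mfunRdR n (f : 'cV[T]_n -> T) :=
  @measurable_fun _ _ (tup n) (measurableTypeR T) setT (fun v => f (tcol v)).

Lemma int_RdZl n (k : T) (F : 'cV[T]_n -> \bar T) : (0 <= k)%R -> mfunRd F ->
  (forall x, 0 <= F x) -> int_Rd (fun x => k%:E * F x) = k%:E * int_Rd F.
Proof. by move=> k0 mF F0; rewrite /int_Rd ge0_integralZl_EFin. Qed.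

Lemma mfunRdR_coord n (i : 'I_n) : mfunRdR (fun x => x i 0%R).
Proof.
rewrite /mfunRdR; under eq_fun do rewrite mxE; exact: measurable_tnth.
Qed.

Lemma mfunRd_measurable d (X : measurableType d) n (F : 'cV[T]_n -> \bar T)
    (h : X -> 'cV[T]_n) : mfunRd F ->
  (forall i, @measurable_fun _ _ X (measurableTypeR T) setT (fun x => h x i 0%R)) ->
  measurable_fun setT (F \o h).
Proof.
move=> mF mh.
rewrite (_ : _ \o _ = (fun w : tup n => F (tcol w)) \o
    (fun x : X => [tuple h x i 0%R | i < n])).
  apply: measurableT_comp => //; apply/measurable_fun_tnthP => i.
  by apply: eq_measurable_fun (mh i) => v _ /=; rewrite tnth_mktuple.
apply/funext => v /=; congr F; apply/matrixP => i j.
by rewrite ord1 mxE tnth_mktuple.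
Qed.

Lemma mfunRd_comp m n (F : 'cV[T]_n -> \bar T) (h : 'cV[T]_m -> 'cV[T]_n) :
  mfunRd F -> (forall i, mfunRdR (fun x => h x i 0%R)) ->
  mfunRd (F \o h).
Proof.
move=> mF mh; exact: (@mfunRd_measurable _ _ _ F (fun v => h (tcol v)) mF mh).
Qed.

Lemma mfunRd_affine m n (F : 'cV[T]_n -> \bar T) (A : 'M[T]_(n, m)) c :
  mfunRd F -> mfunRd (fun x => F (A *m x + c)%R).
Proof.
move=> mF; apply: (mfunRd_comp (h := fun x => A *m x + c)%R) => // i.
rewrite /mfunRdR; under eq_fun do rewrite mxE mxE.
apply: measurable_funD => //; apply: measurable_sum => j.
by apply: measurable_funM => //; exact: mfunRdR_coord.
Qed.

(** Lebesgue measure is [`|a|] times its image under [x |-> a * x + c], since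
    both give the same mass to intervals. *)
Lemma integral_affine1 (a c : T) (F : T -> \bar T) : (a != 0)%R ->
  measurable_fun setT F -> (forall x, 0 <= F x) ->
  \int[mu]_x F (a * x + c)%R = `|a|^-1%:E * \int[mu]_x F x.
Proof.
move=> a0 mF F0.
pose h : measurableTypeR T -> measurableTypeR T := fun x => (a * x + c)%R.
have mh : measurable_fun setT h.
  by apply: measurable_funD => //; exact: measurable_funM.
have an0 : (0 <= `|a|^-1)%R by rewrite invr_ge0.
have E A : measurable A -> mu A = mscale (NngNum (normr_ge0 a)) (pushforward mu h) A.
  apply: lebesgue_measure_unique => /= _ [[u v]] /= _ <-.
  rewrite /mscale/= /pushforward lebesgue_measure_itv/= lte_fin.
  have [a_gt0|a_le0] := ltP 0%R a.
    have -> : h @^-1` `]u, v] = `]((u - c) / a)%R, ((v - c) / a)%R]%classic.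
      apply/seteqP; split => x /=; rewrite !in_itv/= /h;
      by rewrite ltr_pdivrMr// ler_pdivlMr// ltrBlDr lerBrDr [(x * a)%R]mulrC.
    rewrite lebesgue_measure_itv/= lte_fin ltr_pM2r ?invr_gt0// ltrD2r.
    case: ifPn => // _; last by rewrite mule0.
    rewrite -!EFinB -EFinM gtr0_norm//; congr EFin; field.
    exact: lt0r_neq0.
  have {a_le0}a_lt0 : (a < 0)%R by rewrite lt_neqAle a0.
  have -> : h @^-1` `]u, v] = `[((v - c) / a)%R, ((u - c) / a)%R[%classic.
    apply/seteqP; split => x /=; rewrite !in_itv/= /h;
    by rewrite ltr_ndivlMr// ler_ndivrMr// ltrBlDr lerBrDr [(x * a)%R]mulrC andbC.
  rewrite lebesgue_measure_itv/= lte_fin ltr_nM2r ?invr_lt0// ltrD2r.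
  case: ifPn => // _; last by rewrite mule0.
  rewrite -!EFinB -EFinM ltr0_norm//; congr EFin; field.
  exact: ltr0_neq0.
have -> : \int[mu]_x F x = `|a|%:E * \int[pushforward mu h]_x F x.
  rewrite -(ge0_integral_mscale _ _ (NngNum (normr_ge0 a)))//.
  by apply: eq_measure_integral => A mA _; exact: E.
rewrite muleA -EFinM mulVf ?normr_eq0// mul1e ge0_integral_pushforward//.
Qed.

(** Tonelli's theorem for the first coordinate against the others.  The inner
    integrals are themselves subjected to changes of variables, which is why
    their measurability is recorded. *)
Lemma int_Rd_pair n (F : 'cV[T]_(1 + n) -> \bar T) :
  mfunRd F -> (forall x, 0 <= F x) ->
  int_Rd (d := n.+1) F = \int[mu]_x int_Rd (fun v => F (col_mx x%:M v)) /\
  int_Rd (d := n.+1) F =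
    int_Rd (fun v : 'cV[T]_n => \int[mu]_x F (col_mx x%:M v)) /\
  mfunRd (fun v : 'cV[T]_n => \int[mu]_x F (col_mx x%:M v)) /\
  measurable_fun setT
    (fun x : measurableTypeR T => int_Rd (fun v : 'cV[T]_n => F (col_mx x%:M v))).
Proof.
move=> mF F0.
pose F2 := fun p : measurableTypeR T * tup n => F (tcol (cons_pair p)).
have mF2 : measurable_fun setT F2.
  apply: (@measurableT_comp _ _ _ _ _ _ (fun v : tup n.+1 => F (tcol v)) _ cons_pair) => //.
  exact: measurable_cons_pair.
have F20 p : 0 <= F2 p by exact: F0.
have E1 : int_Rd (d := n.+1) F = \int[mu \x lebesgue_tuple T n]_p F2 p.
  by rewrite /int_Rd ge0_integral_pushforward// ; exact: measurable_cons_pair.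
have cE x (v : tup n) : tcol (cons_pair (x, v)) = col_mx x%:M (tcol v) :> 'cV[T]_(1 + n).
  apply/matrixP => i j; rewrite ord1 mxE; case: (split_ordP i) => k ->.
    by rewrite col_mxEu ord1 mxE eqxx (tnth_nth 0%R).
  by rewrite col_mxEd mxE !(tnth_nth 0%R).
split; last split; last split.
- rewrite E1 (fubini_tonelli1 _ mF2 F20); apply: eq_integral => x _.
  by rewrite /fubini_F /int_Rd; apply: eq_integral => v _; rewrite /F2 cE.
- rewrite E1 (fubini_tonelli2 _ mF2 F20); apply: eq_integral => v _.
  by rewrite /fubini_G /int_Rd; apply: eq_integral => x _; rewrite /F2 cE.
- have := @measurable_fun_fubini_tonelli_G _ _ _ _ _ mu F2 mF2 F20.
  apply: eq_measurable_fun => v _; apply: eq_integral => x _.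
  by rewrite /F2 cE.
- have := @measurable_fun_fubini_tonelli_F _ _ _ _ _ (lebesgue_tuple T n) F2 mF2 F20.
  apply: eq_measurable_fun => x _; apply: eq_integral => v _.
  by rewrite /F2 cE.
Qed.

Definition affine_change n (A : 'M[T]_n) := forall c (F : 'cV[T]_n -> \bar T),
  mfunRd F -> (forall x, 0 <= F x) ->
  int_Rd (fun x => F (A *m x + c)%R) = `|\det A|^-1%:E * int_Rd F.

Lemma affine_change_mul n (A B : 'M[T]_n) :
  affine_change A -> affine_change B -> affine_change (A *m B).
Proof.
move=> hA hB c F mF F0.
transitivity (int_Rd (fun x => (fun y => F (A *m y + c)%R) (B *m x + 0)%R)).
  by congr int_Rd; apply/funext => x; rewrite addr0 mulmxA.
have -> := hB 0%R _ (mfunRd_affine A c mF) (fun x => F0 _).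
by rewrite hA// muleA -EFinM det_mulmx normrM invfM mulrC.
Qed.

Lemma affine_change_dim0 (A : 'M[T]_0) : affine_change A.
Proof.
move=> c F _ _; rewrite det_mx00 normr1 invr1 mul1e; congr int_Rd.
by apply/funext => x; congr F; apply/matrixP => -[].
Qed.

Lemma col_mx_mfunRd n (F : 'cV[T]_(1 + n) -> \bar T) (x : T) :
  mfunRd F -> mfunRd (fun v : 'cV[T]_n => F (col_mx x%:M v)).
Proof.
move=> mF; apply: (mfunRd_comp (h := fun v : 'cV[T]_n => col_mx x%:M v)) => // i.
rewrite /mfunRdR; case: (split_ordP i) => k ->.
  by under eq_fun do rewrite col_mxEu; exact: measurable_cst.
by under eq_fun do rewrite col_mxEd; exact: mfunRdR_coord.
Qed.

(** For fixed remaining coordinates, the first one undergoes an affine map with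
    slope [a], so integrate it first. *)
Lemma affine_change_ublock n (a : T) (u : 'rV[T]_n) (A : 'M[T]_n) :
  (a != 0)%R -> affine_change A ->
  affine_change (block_mx a%:M u 0%R A : 'M[T]_(1 + n)).
Proof.
move=> a0 hA c F mF F0.
have E (x : T) (v : 'cV[T]_n) :
    ((block_mx a%:M u 0 A : 'M[T]_(1 + n)) *m col_mx x%:M v + c =
    col_mx (a * x + ((u *m v) 0 0 + usubmx c 0 0))%:M (A *m v + dsubmx c) :> 'cV[T]_(1 + n))%R.
  rewrite -{1}(vsubmxK c) mul_block_col mul0mx add0r add_col_mx; congr col_mx.
  apply/matrixP => i j; rewrite !ord1 -scalar_mxM !mxE eqxx !mulr1n.
  by rewrite addrA.
have [_ [-> _]] := int_Rd_pair (mfunRd_affine (block_mx a%:M u 0%R A) c mF) (fun x => F0 _).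
have [_ [-> [mG _]]] := int_Rd_pair mF F0.
transitivity (int_Rd (fun v : 'cV[T]_n =>
   `|a|^-1%:E * \int[mu]_x F (col_mx x%:M (A *m v + dsubmx c)%R))).
  congr int_Rd; apply/funext => v.
  rewrite -(integral_affine1 ((u *m v) 0 0 + usubmx c 0 0)%R a0)//.
    by apply: eq_integral => x _; rewrite E.
  apply: (@mfunRd_measurable _ _ _ F
    (fun x : measurableTypeR T => col_mx x%:M (A *m v + dsubmx c)%R)) => // i.
  case: (split_ordP i) => k ->.
    by under eq_fun do rewrite col_mxEu ord1 mxE eqxx mulr1n; exact: measurable_id.
  by under eq_fun do rewrite col_mxEd; exact: measurable_cst.
have a0' : (0 <= `|a|^-1)%R by rewrite invr_ge0.
have G0 v : 0 <= \int[mu]_x F (col_mx x%:M v) by exact: integral_ge0.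
rewrite (int_RdZl a0' (mfunRd_affine A (dsubmx c) mG) (fun v => G0 _)).
rewrite (hA (dsubmx c) _ mG G0) muleA -EFinM; congr (_%:E * _).
by rewrite det_ublock det_scalar1 normrM invfM.
Qed.

(** For a fixed first coordinate, the remaining ones are translated. *)
Lemma affine_change_lblock n (u : 'cV[T]_n) :
  affine_change (block_mx 1%:M 0%R u 1%:M : 'M[T]_(1 + n)).
Proof.
have tr k (G : 'cV[T]_k -> \bar T) : affine_change (1%:M : 'M[T]_k) ->
  forall c, mfunRd G -> (forall x, 0 <= G x) ->
  int_Rd (fun x => G (x + c)%R) = int_Rd G.
  move=> h1 c mG G0; have := h1 c G mG G0.
  rewrite det1 normr1 invr1 mul1e => <-.
  by congr int_Rd; apply/funext => x; rewrite mul1mx.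
have h1 : affine_change (1%:M : 'M[T]_n).
  elim: n {u} => [|k IH]; first exact: affine_change_dim0.
  have := @affine_change_ublock k 1%R 0%R 1%:M (oner_neq0 _) IH.
  by rewrite -scalar_mx_block.
move=> c F mF F0.
have E (x : T) (v : 'cV[T]_n) :
    ((block_mx 1%:M 0 u 1%:M : 'M[T]_(1 + n)) *m col_mx x%:M v + c =
    col_mx (1 * x + usubmx c 0 0)%:M (v + (u *m x%:M + dsubmx c)) :> 'cV[T]_(1 + n))%R.
  rewrite -{1}(vsubmxK c) mul_block_col mul0mx addr0 !mul1mx add_col_mx; congr col_mx.
    by apply/matrixP => i j; rewrite !ord1 !mxE eqxx !mulr1n mul1r.
  by rewrite addrCA addrA.
have [-> _] := int_Rd_pair (mfunRd_affine (block_mx 1%:M 0%R u 1%:M) c mF) (fun x => F0 _).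
have [EF [_ [_ mE]]] := int_Rd_pair mF F0.
transitivity (\int[mu]_x (fun y => int_Rd (fun v : 'cV[T]_n => F (col_mx y%:M v)))
   (1 * x + usubmx c 0 0)%R).
  apply: eq_integral => x _; under eq_fun do rewrite E.
  rewrite (tr n (fun v => F (col_mx (1 * x + usubmx c 0 0)%R%:M v)))//.
  exact: col_mx_mfunRd.
have mE0 x : 0 <= int_Rd (fun v : 'cV[T]_n => F (col_mx x%:M v)).
  exact: integral_ge0.
apply: (etrans (integral_affine1 (usubmx c 0%R 0%R) (oner_neq0 T) mE mE0)).
by rewrite -EF det_lblock !det1 mulr1.
Qed.

(** Block elimination reduces any invertible matrix to the two block triangular
    shapes; a first row operation makes the top left entry a pivot. *)
Theorem int_Rd_affine n (A : 'M[T]_n) : A \in unitmx -> affine_change A.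
Proof.
elim: n A => [|n IH] A uA; first exact: affine_change_dim0.
have pivot (B : 'M[T]_(1 + n)) : B \in unitmx -> (B 0 0 != 0)%R -> affine_change B.
  move=> uB B0; pose a := B 0%R 0%R; pose u := ursubmx B; pose w := dlsubmx B.
  pose A' := (drsubmx B - a^-1 *: (w *m u))%R.
  have aE : ulsubmx B = a%:M.
    apply/matrixP => i j; rewrite !ord1 !mxE eqxx mulr1n /a.
    by congr (B _ _); apply/val_inj.
  have BE : B = (block_mx 1%:M 0 (a^-1 *: w) 1%:M *m block_mx a%:M u 0 A')%R.
    rewrite mulmx_block !mul1mx !mul0mx !addr0 -[LHS]submxK aE.
    congr block_mx; last by rewrite /A' -scalemxAl addrC subrK.
    by rewrite mul_mx_scalar scalerA divff// scale1r.
  have uA' : A' \in unitmx.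
    move: uB; rewrite !unitmxE BE det_mulmx det_lblock det_ublock !det1 !mul1r.
    by rewrite unitrM => /andP[].
  rewrite BE; apply: affine_change_mul; first exact: affine_change_lblock.
  by apply: affine_change_ublock => //; exact: IH.
have [A0|A0] := eqVneq (A 0%R 0%R) 0%R; last exact: (pivot A).
have [i Ai0] : exists i : 'I_n, A (rshift 1 i) 0%R != 0%R.
  apply/existsP; rewrite -negb_forall; apply: contraL uA => /forallP Ai0.
  have : col (0%R : 'I_(1 + n)) A = 0%R.
    apply/matrixP => j k; rewrite !mxE; case: (@split_ordP 1 n j) => l ->.
      by rewrite !ord1 -[RHS]A0; congr (A _ _); apply/val_inj.
    exact/eqP/Ai0.
  rewrite colE => Ad0; apply/negP => uA.
  have := congr1 (mulmx (invmx A)) Ad0; rewrite mulKmx// mulmx0.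
  by move=> /matrixP/(_ 0%R 0%R); rewrite !mxE !eqxx => /eqP; rewrite oner_eq0.
pose U (c : T) : 'M[T]_(1 + n) := block_mx 1%:M (c *: delta_mx 0 i)%R 0%R 1%:M.
have gU c : affine_change (U c).
  apply: affine_change_ublock; first exact: oner_neq0.
  apply: IH; exact: unitmx1.
have UU : U (-1)%R *m U 1%R = 1%:M.
  rewrite /U mulmx_block !mul1mx !mulmx1 !mul0mx !mulmx0 !addr0 !add0r.
  by rewrite -scalerDl subrr scale0r -scalar_mx_block.
have -> : A = (U (-1) *m (U 1 *m A : 'M[T]_(1 + n)))%R by rewrite mulmxA UU mul1mx.
apply: affine_change_mul => //; apply: pivot.
  rewrite unitmx_mul uA andbT.
  by have [_] := mulmx1_unit UU.
rewrite (_ : _ 0%R 0%R = A (rshift 1 i) 0%R)//.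
have z0 : (0 : 'I_(1 + n))%R = lshift n 0%R by apply/val_inj.
rewrite mxE big_split_ord/= big_ord1 -z0 A0 mulr0 add0r (bigD1 i)//= big1 => [|j ji].
  by rewrite addr0 z0 block_mxEur !mxE !eqxx mulr1 mul1r.
by rewrite z0 block_mxEur !mxE (negbTE ji) mulr0 mul0r.
Qed.

End lebesgue_tuple_integral.

Section continuous_measurable.
Context {T : realType}.
Local Notation tup n := (n.-tuple (measurableTypeR T)).

(** An open set is the union of the countably many boxes with rational centre
    and radius [1 / k.+1] that it contains. *)
Lemma measurable_tcol_open n (U : set 'cV[T]_n) : open U ->
  measurable ((@tcol T n) @^-1` U).
Proof.
move=> oU.
pose box (p : 'rV[rat]_n * nat) : set 'cV[T]_n :=
  [set x | forall i, `|ratr (p.1 0 i) - x i 0| < p.2.+1%:R^-1].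
pose F p := if `[< box p `<=` U >] then (@tcol T n) @^-1` (box p) else set0.
have -> : (@tcol T n) @^-1` U = \bigcup_p F p.
  apply/seteqP; split => [v /= Uv|v [p _]]; last first.
    by rewrite /F; case: asboolP => // + /=; exact.
  have /nbhs_ballP[e /= e0 eU] : nbhs (tcol v) U by exact: open_nbhs_nbhs.
  have [k ke] : exists k, k.+1%:R^-1 < e / 2.
    by have := ltr_add_invr (divr_gt0 e0 (ltr0Sn _ 1)) => -[k]; rewrite add0r; exists k.
  pose w : T := k.+1%:R^-1.
  have w0 : 0 < w by rewrite invr_gt0.
  have /choice[q qv] : forall i, exists r : rat, `|ratr r - tcol v i 0| < w.
    move=> i; have : tcol v i 0 - w < tcol v i 0 + w by rewrite ltrBlDr -addrA ltrDl addr_gt0.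
    by move=> /rat_in_itvoo[r]; rewrite in_itv/= => rv; exists r; rewrite ltr_distl.
  have bU : box (\row_i q i, k) `<=` U.
    move=> x /= bx; apply: eU; split => // i j; rewrite ord1 /ball/=.
    rewrite (le_lt_trans (ler_distD (ratr (q i)) _ _))//.
    rewrite (splitr e) ltrD//; first by rewrite distrC (lt_trans (qv i)).
    by have := bx i; rewrite mxE => /lt_trans; apply.
  exists (\row_i q i, k) => //; rewrite /F; case: asboolP => // _ i /=.
  by rewrite mxE.
apply: countable_bigcupT_measurable => // p.
rewrite /F; case: asboolP => // _.
rewrite (_ : _ @^-1` _ = \bigcap_(i in [set: 'I_n])
    ((fun v : tup n => tnth v i) @^-1` [set y | `|ratr (p.1 0 i) - y| < p.2.+1%:R^-1])).
  apply: fin_bigcap_measurable => // i _.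
  rewrite -[X in measurable X]setTI; apply: measurable_tnth => //.
  apply: open_measurable.
  rewrite (_ : [set y | _] = ball (ratr (p.1 0 i) : T) (p.2.+1%:R^-1)) //.
  exact: ball_open.
apply/seteqP; split => v /=.
  by move=> h i _ /=; have := h i; rewrite mxE.
by move=> h i; rewrite mxE; exact: h.
Qed.

Lemma continuous_mfunRdR n (f : 'cV[T]_n -> T) : continuous f -> mfunRdR f.
Proof.
move=> /continuousP cf; apply: (measurability _ (RGenOpens.measurableE T)).
move=> _ [_ [a [b ->] <-]]; rewrite setTI.
apply: (@measurable_tcol_open n (f @^-1` `]a, b[)); exact/cf/interval_open.
Qed.

Lemma mfunRd_EFin n (f : 'cV[T]_n -> T) : mfunRdR f -> mfunRd (EFin \o f).
Proof. by move=> mf; exact/measurable_EFinP. Qed.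

End continuous_measurable.

(** * Polar coordinates *)

Section density_measure.
Local Open Scope ereal_scope.
Context d (X : measurableType d) (T : realType).
Variables (mu : {measure set X -> \bar T}) (w : X -> T).
Hypotheses (mw : measurable_fun setT w) (w0 : forall x, (0 <= w x)%R).

Let mEw : measurable_fun setT (EFin \o w).
Proof. exact/measurable_EFinP. Qed.

Let w0E x : 0 <= (w x)%:E. Proof. by rewrite lee_fin. Qed.

(** The two side conditions are arguments so that the measure structure can be
    inferred from the term. *)
Definition density_measure of measurable_fun setT w & (forall x, (0 <= w x)%R) :=
  fun A : set X => \int[mu]_(x in A) (w x)%:E.

Local Notation dw := (density_measure mw w0).

Let dw0 : dw set0 = 0. Proof. exact: integral_set0. Qed.

Let dw_ge0 A : 0 <= dw A. Proof. exact: integral_ge0. Qed.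

Let dw_sigma_additive : semi_sigma_additive dw.
Proof.
move=> F mF tF mUF; rewrite /density_measure ge0_integral_bigcup//; last first.
  exact: measurable_funTS.
by apply: is_cvg_ereal_nneg_natsum_cond => n _ _; exact: integral_ge0.
Qed.

HB.instance Definition _ := isMeasure.Build _ _ _ dw dw0 dw_ge0 dw_sigma_additive.

Import HBNNSimple.

(** True by definition for indicators, hence for nonnegative simple functions,
    and then by monotone convergence. *)
Lemma integral_density_measure (f : X -> \bar T) :
  measurable_fun setT f -> (forall x, 0 <= f x) ->
  \int[dw]_x f x = \int[mu]_x ((w x)%:E * f x).
Proof.
move=> mf f0; pose f_ := nnsfun_approx measurableT mf.
transitivity (limn (fun n => \int[dw]_x (f_ n x)%:E)).
  rewrite -monotone_convergence//.
  - apply: eq_integral => y _; apply/esym/cvg_lim => //.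
    exact: cvg_nnsfun_approx.
  - by move=> n; exact/measurable_EFinP/measurable_funP.
  - by move=> n y _; rewrite lee_fin.
  - by move=> y _ m n mn; rewrite lee_fin; exact/lefP/nd_nnsfun_approx.
rewrite [X in limn X](_ : _ = (fun n => \int[mu]_x ((w x)%:E * (f_ n x)%:E))).
  rewrite -monotone_convergence//; last 3 first.
    - move=> n; apply: emeasurable_funM => //.
      exact/measurable_EFinP/measurable_funP.
    - by move=> n x _; rewrite mule_ge0// lee_fin.
    - by move=> x _ m n mn; rewrite lee_wpmul2l// lee_fin; exact/lefP/nd_nnsfun_approx.
  apply: eq_integral => x _; apply/cvg_lim => //.
  by apply: cvgeZl => //; exact: cvg_nnsfun_approx.
apply/funext => n.
have mk k : measurable (f_ n @^-1` [set k]) by [].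
transitivity (\sum_(k \in range (f_ n))
    \int[mu]_x (k%:E * ((w x)%:E * (\1_(f_ n @^-1` [set k]) x)%:E))).
  under eq_integral do rewrite fimfunE -fsumEFin//.
  rewrite ge0_integral_fsum//; last 2 first.
  - by move=> y; exact/measurable_EFinP/measurable_funM.
  - by move=> y x _; rewrite nnfun_muleindic_ge0.
  apply: eq_fsbigr => r /[!inE] -[x _ rE]; have r0 : (0 <= r)%R by rewrite -rE.
  rewrite integralZl_indic_nnsfun// integral_indic// setIT.
  rewrite ge0_integralZl//; last 2 first.
  - by apply: emeasurable_funM => //; exact/measurable_EFinP.
  - by move=> y _; rewrite mule_ge0// lee_fin.
  congr (_ * _); rewrite /= /density_measure [LHS]integral_mkcond.
  apply: eq_integral => y _; rewrite patchE indicE.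
  by case: (y \in _); rewrite ?mule1 ?mule0.
rewrite -ge0_integral_fsum//.
- apply: eq_integral => x _; rewrite fimfunE -fsumEFin// ge0_mule_fsumr.
    by apply: eq_fsbigr => k _; rewrite muleCA.
  by move=> k; rewrite EFinM nnfun_muleindic_ge0.
- move=> r; apply: emeasurable_funM => //; apply: emeasurable_funM => //.
  exact/measurable_EFinP.
- move=> r x _; rewrite muleCA mule_ge0//.
  by rewrite nnfun_muleindic_ge0.
Qed.

End density_measure.

Section radial_integral.
Context {T : realType}.
Local Notation mu := (@lebesgue_measure T).
Local Notation tup n := (n.-tuple (measurableTypeR T)).

Lemma mfunRdR_prod n (f : T -> T) : measurable_fun setT f ->
  mfunRdR (fun x : 'cV[T]_n => \prod_i f (x i 0)).
Proof.
move=> mf; rewrite /mfunRdR; apply: measurable_prod => i _.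
by apply: measurableT_comp => //; exact: mfunRdR_coord.
Qed.

Lemma int_Rd_prod n (f : T -> T) (I : T) : measurable_fun setT f ->
  (forall x, 0 <= f x) -> (\int[mu]_x (f x)%:E = I%:E)%E ->
  int_Rd (fun x : 'cV[T]_n => (\prod_i f (x i 0))%:E) = (I ^+ n)%:E.
Proof.
move=> mf f0 fI; elim: n => [|n IH].
  rewrite /int_Rd; under eq_integral do rewrite big_ord0.
  by rewrite integral_cst//= diracT mule1.
have [-> _] := int_Rd_pair (n := n) (F := fun x : 'cV[T]_n.+1 => (\prod_i f (x i 0))%:E)
  (mfunRd_EFin (mfunRdR_prod mf)) (fun x => ltac:(by rewrite lee_fin prodr_ge0)).
transitivity (\int[mu]_x ((I ^+ n)%:E * (f x)%:E))%E.
  apply: eq_integral => x _.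
  transitivity (int_Rd (fun v : 'cV[T]_n => (f x)%:E * (\prod_i f (v i 0))%:E)%E).
    congr int_Rd; apply/funext => v; rewrite -EFinM; congr EFin.
    rewrite (@big_split_ord _ _ _ 1 n)/= big_ord1.
    congr (f _ * _).
      by apply: (etrans (col_mxEu _ _ _ _)); rewrite mxE eqxx mulr1n.
    by apply: eq_bigr => i _; congr f; exact: col_mxEd.
  rewrite /int_Rd ge0_integralZl_EFin//.
  - by rewrite -/(int_Rd (fun v : 'cV[T]_n => (\prod_i f (v i 0))%:E)) IH muleC.
  - by move=> v _; rewrite lee_fin prodr_ge0.
  - exact: (mfunRd_EFin (mfunRdR_prod mf)).
have I0 : 0 <= I by rewrite -lee_fin -fI integral_ge0// => x _; rewrite lee_fin.
rewrite ge0_integralZl_EFin//; last 3 first.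
- by move=> x _; rewrite lee_fin.
- exact/measurable_EFinP.
- exact: exprn_ge0.
by rewrite fI -EFinM exprSr.
Qed.

Lemma sq_enormE n (x : 'cV[T]_n) : enorm x ^+ 2 = \sum_i x i 0 ^+ 2.
Proof. by rewrite enorm_sqr sqnormE. Qed.

Lemma enormZ n c (x : 'cV[T]_n) : enorm (c *: x) ^+ 2 = c ^+ 2 * enorm x ^+ 2.
Proof.
by rewrite !sq_enormE mulr_sumr; apply: eq_bigr => i _; rewrite mxE exprMn.
Qed.

Lemma measurable_sq_enorm n :
  measurable_fun setT (fun v : tup n => enorm (tcol v) ^+ 2 : measurableTypeR T).
Proof.
under eq_fun do rewrite sq_enormE.
apply: measurable_sum => i; apply: measurable_funX; exact: mfunRdR_coord.
Qed.

(** The ball is parametrised by the square of its radius, because radial functions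
    enter as functions of the squared norm. *)
Definition ball_volume n (a : T) : \bar T :=
  lebesgue_tuple T n [set v | enorm (tcol v) ^+ 2 <= a].

Lemma measurable_sq_enorm_preimage n (A : set T) : measurable A ->
  measurable [set v : tup n | A (enorm (tcol v) ^+ 2)].
Proof.
move=> mA; rewrite -[X in measurable X]setTI.
exact: (@measurable_sq_enorm n measurableT A mA).
Qed.

Lemma ball_volumeE n a : ball_volume n a =
  int_Rd (fun x : 'cV[T]_n => (\1_[set y : 'cV[T]_n | enorm y ^+ 2 <= a] x)%:E).
Proof.
rewrite /ball_volume -[[set v | _]]setIT -integral_indic//.
exact: (@measurable_sq_enorm_preimage n `]-oo, a]).
Qed.

Lemma mfunRd_sq_enorm n (f : T -> \bar T) : measurable_fun setT f ->
  mfunRd (fun x : 'cV[T]_n => f (enorm x ^+ 2)).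
Proof. by move=> mf; apply: measurableT_comp mf (@measurable_sq_enorm n). Qed.

Lemma ball_volume_scale n c a : 0 < c ->
  ball_volume n (c ^+ 2 * a) = ((c ^+ n)%:E * ball_volume n a)%E.
Proof.
move=> c0; rewrite !ball_volumeE.
have uc : (c%:M : 'M[T]_n) \in unitmx.
  by rewrite unitmxE det_scalar unitfE expf_neq0// gt_eqF.
have mI : mfunRd (fun x : 'cV[T]_n =>
    (\1_[set y : 'cV[T]_n | enorm y ^+ 2 <= c ^+ 2 * a] x)%:E).
  have := @mfunRd_sq_enorm n (fun r => (\1_[set` `]-oo, c ^+ 2 * a]] r)%:E).
  apply; exact/measurable_EFinP.
have := int_Rd_affine uc 0 mI (fun x => ltac:(by rewrite lee_fin)).
rewrite det_scalar normrX gtr0_norm// => H.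
transitivity ((c ^+ n)%:E * ((c ^- n)%:E * int_Rd (fun x : 'cV[T]_n =>
    (\1_[set y : 'cV[T]_n | enorm y ^+ 2 <= c ^+ 2 * a] x)%:E)))%E.
  by rewrite muleA -EFinM divff ?mul1e// expf_neq0// gt_eqF.
rewrite -H; congr (_ * _)%E; congr int_Rd; apply/funext => x; congr EFin.
rewrite !indicE; congr (_%:R); congr nat_of_bool; apply/idP/idP; rewrite !inE/=;
by rewrite addr0 mul_scalar_mx enormZ ler_pM2l// exprn_gt0.
Qed.

(** The unit ball lies in the cube with side 2. *)
Lemma ball_volume_fin n : (ball_volume n 1 < +oo)%E.
Proof.
pose f (x : T) : T := \1_(`[-1, 1]%classic) x.
have mf : measurable_fun setT f by exact: measurable_indic.
have fI : (\int[mu]_x (f x)%:E = (2%R : T)%:E)%E.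
  rewrite /f integral_indic// setIT; apply: etrans (lebesgue_measure_itv `[-1, 1]) _.
  rewrite /= lte_fin ifT; last by lra.
  by rewrite -EFinB; congr EFin; lra.
apply: le_lt_trans (ltry (2 ^+ n)).
have f0 x : 0 <= f x by rewrite /f.
rewrite -(int_Rd_prod n mf f0 fI).
rewrite ball_volumeE; apply: ge0_le_integral => //.
- have := @mfunRd_sq_enorm n (fun r => (\1_[set` `]-oo, 1]] r)%:E).
  apply; exact/measurable_EFinP.
- exact: (mfunRd_EFin (mfunRdR_prod mf)).
move=> v _; rewrite lee_fin indicE.
case: (boolP (_ \in _)) => [|_]; last by rewrite prodr_ge0.
rewrite inE/= => v1; rewrite (eq_bigr (fun=> 1)) ?big1// => i _.
rewrite /f indicE mem_set//= in_itv/= -ler_norml -sqrtr1 -sqrtr_sqr ler_sqrt//.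
apply: le_trans v1; rewrite sq_enormE (bigD1 i)//= lerDl sumr_ge0// => j _.
exact: sqr_ge0.
Qed.

End radial_integral.

Section polar.
Context {T : realType}.
Local Notation mu := (@lebesgue_measure T).
Local Notation tup n := (n.-tuple (measurableTypeR T)).

Lemma FTC2_is_derive (f F : T -> T) (a b : T) : a < b ->
  {within `[a, b], continuous f} ->
  (forall x, x \in `[a, b] -> is_derive x (1 : T) F (f x)) ->
  (\int[mu]_(x in `[a, b]) (f x)%:E = (F b - F a)%:E)%E.
Proof.
move=> ab cf dF; rewrite EFinB; apply: continuous_FTC2 => //.
  have cF x : x \in `[a, b] -> {for x, continuous F}.
    move=> /dF dFx; apply/differentiable_continuous/derivable1_diffP.
    exact: @ex_derive _ _ _ _ _ _ _ dFx.
  split.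
  - move=> x xab; have /dF dFx : x \in `[a, b] by apply: subset_itv_oo_cc xab.
    exact: @ex_derive _ _ _ _ _ _ _ dFx.
  - by apply: cvg_at_right_filter; apply: cF; rewrite in_itv/= lexx ltW.
  - by apply: cvg_at_left_filter; apply: cF; rewrite in_itv/= lexx ltW.
move=> x xab; have /dF dFx : x \in `[a, b] by apply: subset_itv_oo_cc xab.
by rewrite derive1E derive_val.
Qed.

Lemma is_derive_powR (s x : T) : 0 < x ->
  is_derive x (1 : T) (fun y => y `^ s) (s * x `^ (s - 1)).
Proof.
move=> x0; have xi : x \in `]0, +oo[ by rewrite in_itv/= x0.
apply: DeriveDef; first exact: derivable_powR.
by rewrite -derive1E powR_derive1.
Qed.

Section fixed_dim.
Variable n : nat.
Hypothesis n0 : (0 < n)%N.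
Let s : T := n%:R / 2.
Let C : T := fine (ball_volume (T := T) n 1).
Let V (a : T) : T := C * (Num.max 0 a) `^ s.

Let s0 : 0 < s. Proof. by rewrite divr_gt0// ltr0n. Qed.

Let CE : ball_volume n 1 = C%:E.
Proof. by rewrite /C fineK// ge0_fin_numE ?ball_volume_fin// measure_ge0. Qed.

Let C0 : 0 <= C. Proof. by rewrite -lee_fin -CE measure_ge0. Qed.

Let sqrt_pow (a : T) : 0 <= a -> Num.sqrt a ^+ n = a `^ s.
Proof.
move=> a0; rewrite -powR12_sqrt// -powR_mulrn ?powR_ge0// -powRrM.
by rewrite /s mulrC.
Qed.

Let le_volume (a b : T) : a <= b -> (ball_volume (T := T) n a <= ball_volume n b)%E.
Proof.
move=> ab; apply: le_measure; rewrite ?inE.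
- exact: (measurable_sq_enorm_preimage (A := `]-oo, a]%classic)).
- exact: (measurable_sq_enorm_preimage (A := `]-oo, b]%classic)).
by move=> v /=/le_trans; exact.
Qed.

Let volumeE a : ball_volume (T := T) n a = (V a)%:E.
Proof.
have [a0|a0|->] := ltgtP a 0.
- rewrite /V max_l ?ltW// powR0 ?gt_eqF// mulr0.
  rewrite -[RHS](measure0 (lebesgue_tuple T n)); congr (lebesgue_tuple T n _).
  apply/seteqP; split => v //= va.
  by have := le_lt_trans va a0; rewrite ltNge sqr_ge0.
- rewrite /V max_r ?ltW// -sqrt_pow ?ltW// -{1}[a]mulr1 -{1}(sqr_sqrtr (ltW a0)).
  by rewrite ball_volume_scale ?sqrtr_gt0// CE -EFinM mulrC.
- rewrite /V maxxx powR0 ?gt_eqF// mulr0.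
  have := @ball_volume_scale T n 2 0 (ltr0Sn _ _); rewrite mulr0.
  have := le_volume ler01; rewrite CE.
  have : (0 <= ball_volume (T := T) n 0)%E by exact: measure_ge0.
  case: (ball_volume n 0) => // r.
  rewrite !lee_fin => r0 _ [] H; congr EFin.
  have : 1 < (2 : T) ^+ n by rewrite exprn_egt1// ?ltr1n// -lt0n.
  nra.
Qed.

Let N (v : tup n) : measurableTypeR T := enorm (tcol v) ^+ 2.
Let mN : measurable_fun setT N. Proof. exact: measurable_sq_enorm. Qed.
Let m1 := pushforward (lebesgue_tuple T n) N.

Let m1E (a b : T) : a <= b -> m1 `]a, b] = (V b - V a)%:E.
Proof.
move=> ab; have mA := measurable_itv (`]-oo, a] : interval T).
have mB := measurable_itv (`]a, b] : interval T).
have E : (m1 `]-oo, b] = m1 `]-oo, a] + m1 `]a, b])%E.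
  rewrite -measureU//.
    congr (m1 _); rewrite (@itv_bndbnd_setU _ _ -oo%O (BRight a) (BRight b))//.
  apply/seteqP; split => x //=; rewrite !in_itv/= => -[xa /andP[ax _]].
  by have := le_lt_trans xa ax; rewrite ltxx.
move: E; rewrite -[m1 `]-oo, b]]/(ball_volume n b) -[m1 `]-oo, a]]/(ball_volume n a).
rewrite !volumeE; case: (m1 _) => //= r [->].
by rewrite addrC addrK.
Qed.

Let w (r : T) : T := if 0 < r then C * s * r `^ (s - 1) else 0.

Let w0 r : 0 <= w r.
Proof.
rewrite /w; case: ifP => // _; apply: mulr_ge0; last exact: powR_ge0.
by rewrite mulr_ge0// ltW.
Qed.

Let mw : measurable_fun (setT : set (measurableTypeR T)) (w : T -> measurableTypeR T).
Proof.
apply: measurable_fun_ifT => //.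
  exact: measurable_fun_ltr.
apply: measurable_funM => //; exact: measurable_powR.
Qed.

Let m2 := density_measure mu mw w0.

Let m2E (a b : T) : 0 < a -> a <= b -> m2 `]a, b] = (V b - V a)%:E.
Proof.
move=> a0; rewrite le_eqVlt => /predU1P[<-|ab].
  by rewrite set_itvoc0 subrr; exact: measure0.
rewrite /m2 /density_measure integral_itv_obnd_cbnd; last first.
  by apply/measurable_EFinP; exact: measurable_funTS.
rewrite /V !max_r ?ltW// ?(lt_trans a0)//.
transitivity (\int[mu]_(r in `[a, b]) (C * (s * r `^ (s - 1)))%:E)%E.
  apply: eq_integral => x; rewrite inE/= in_itv/= => /andP[ax _].
  by rewrite /w (lt_le_trans a0 ax) mulrA.
apply: (FTC2_is_derive (F := fun r => C * r `^ s)) => //.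
- apply: derivable_within_continuous => x; rewrite in_itv/= => /andP[ax _].
  do 2 apply: derivableM => //.
  by apply: derivable_powR; rewrite in_itv/= (lt_le_trans a0).
- move=> x; rewrite in_itv/= => /andP[ax _].
  have := is_derive_powR s (lt_le_trans a0 ax) => dx.
  exact: is_deriveZ.
Qed.

Let m12_empty (a b : T) : b < a -> m1 `]a, b] = m2 `]a, b].
Proof.
move=> ba; rewrite set_itv_ge; first by transitivity (0%E : \bar T); [|symmetry]; exact: measure0.
by rewrite -leNgt bnd_simp ltW.
Qed.

Let m12_0 (b : T) : 0 < b -> m1 `]0, b] = m2 `]0, b].
Proof.
move=> b0; pose F k : set (measurableTypeR T) := `](b / k.+1%:R), b]%classic.
have FE : \bigcup_k F k = `]0, b]%classic.
  apply/seteqP; split => [x [k _]|x] /=; rewrite /F !in_itv/=.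
    by rewrite in_itv/= => /andP[bx ->]; rewrite andbT (le_lt_trans _ bx)// divr_ge0// ltW.
  move=> /andP[x0 xb]; have := ltr_add_invr (divr_gt0 x0 b0) => -[k].
  rewrite add0r => kx; exists k => //=; rewrite in_itv/= xb andbT.
  by move: kx; rewrite ltr_pdivlMr// mulrC.
have mF k : measurable (F k) by exact: measurable_itv.
have ndF : nondecreasing_seq F.
  move=> i j ij; apply/subsetPset => x; rewrite /F/= !in_itv/= => /andP[bx ->].
  rewrite andbT (le_lt_trans _ bx)// ler_pM2l// lef_pV2 ?posrE// ler_nat//.
have E k : m1 (F k) = m2 (F k).
  have k0 : 0 < b / k.+1%:R by rewrite divr_gt0.
  have kb : b / k.+1%:R <= b by rewrite ler_pdivrMr// ler_peMr ?ler1n// ltW.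
  by rewrite m1E// m2E.
have mU : measurable (\bigcup_k F k) by exact: bigcupT_measurable.
have c1 := nondecreasing_cvg_mu (mu := m1) mF mU ndF.
have c2 := nondecreasing_cvg_mu (mu := m2) mF mU ndF.
have l1 : limn (m1 \o F) = m1 `]0, b] by rewrite -FE; exact: cvg_lim (c1 mN).
have l2 : limn (m2 \o F) = m2 `]0, b] by rewrite -FE; exact: cvg_lim c2.
by rewrite -l1 -l2; congr (limn _); apply/funext => k; exact: E.
Qed.

Let m12_neg (a b : T) : b <= 0 -> m1 `]a, b] = m2 `]a, b].
Proof.
move=> b0; have [ba|ab] := ltP b a.
  exact: m12_empty.
rewrite m1E// /V !max_l ?(le_trans ab)// subrr.
rewrite /m2 /density_measure integral0_eq// => x /=.
rewrite in_itv/= => /andP[_ xb].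
by rewrite /w ltNge (le_trans xb b0).
Qed.

Let m12 A : measurable A -> m1 A = m2 A.
Proof.
pose M1 : {measure set (measurableTypeR T) -> \bar T} :=
  measure_function_pushforward__canonical__measure_function_Measure (lebesgue_tuple T n) mN.
pose M2 : {measure set (measurableTypeR T) -> \bar T} := [the measure _ _ of m2].
apply: (@measure_unique _ _ (measurableTypeR T) (@ocitv T)
  (fun k => `](- k%:R), k%:R]%classic) _ _ _ _ M1 M2) => //.
- exact: ocitvI.
- by move=> k; exact: is_ocitv.
- apply/seteqP; split => // x _.
  have [k kx] : exists k : nat, `|x| < k%:R.
    by exists (Num.bound `|x|); rewrite archi_boundP.
  by exists k => //=; rewrite in_itv/=; move: kx; rewrite ltr_norml => /andP[-> /ltW].
- move=> _ [[a b] _ <-] /=.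
  have [ba|ab] := ltP b a.
    exact: m12_empty.
  have [b0|b0] := leP b 0; first exact: m12_neg.
  have [a0|a0] := ltP 0 a; first by apply: etrans (m1E ab) _; rewrite -m2E.
  have -> : `]a, b]%classic = `]a, 0]%classic `|` `]0, b]%classic :> set T.
    by rewrite -itv_bndbnd_setU// bnd_simp// ltW.
  have dj : `]a, 0]%classic `&` `]0, b]%classic = set0 :> set T.
    apply/seteqP; split => x //=; rewrite !in_itv/= => -[/andP[_ xa] /andP[ax _]].
    by have := le_lt_trans xa ax; rewrite ltxx.
  transitivity (M1 `]a, 0%R]%classic + M1 `]0%R, b]%classic)%E; first exact: measureU.
  transitivity (M2 `]a, 0%R]%classic + M2 `]0%R, b]%classic)%E; last by symmetry; exact: measureU.
  by congr (_ + _)%E; [exact: m12_neg|exact: m12_0].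
- move=> k; apply: (@le_lt_trans _ _ (V k%:R - V (- k%:R))%:E); last exact: ltry.
  by rewrite -m1E// (le_trans (y := 0))// oppr_le0.
Qed.

(** By homogeneity the ball of squared radius [a] has volume [C * a^(n/2)], so
    the image of Lebesgue measure under the squared norm has density
    [C * (n/2) * r^(n/2 - 1)].  The two measures [m1] and [m2] on the line are
    compared on half-open intervals; those starting at 0 are reached as
    increasing unions, since the density may blow up at 0. *)
Lemma polar_integral : exists2 c : T, 0 <= c & forall f : T -> \bar T,
  measurable_fun (setT : set (measurableTypeR T)) f -> (forall r, 0 <= f r)%E ->
  int_Rd (fun x : 'cV[T]_n => f (enorm x ^+ 2)) =
  (c%:E * \int[mu]_(r in `]0%R, +oo[) ((r `^ (n%:R / 2 - 1))%:E * f r))%E.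
Proof.
exists (C * s); first by rewrite mulr_ge0// ltW.
move=> f mf f0.
have -> : int_Rd (fun x : 'cV[T]_n => f (enorm x ^+ 2)) = (\int[m1]_r f r)%E.
  by rewrite ge0_integral_pushforward.
have -> : (\int[m1]_r f r = \int[m2]_r f r)%E.
  by apply: eq_measure_integral => A mA _; exact: m12.
rewrite integral_density_measure// -ge0_integralZl_EFin//; last 3 first.
- by move=> r _; rewrite mule_ge0// lee_fin powR_ge0.
- apply: emeasurable_funM; last exact: measurable_funTS.
  by apply/measurable_EFinP; apply: measurable_funTS; exact: measurable_powR.
- by rewrite mulr_ge0// ltW.
rewrite [RHS]integral_mkcond; apply: eq_integral => r _.
rewrite patchE /w mem_setE in_itv/= andbT; case: ifP => _; last by rewrite mul0e.
by rewrite EFinM muleA.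
Qed.

End fixed_dim.
End polar.

Section radial_moments.
Context {T : realType}.
Local Notation mu := (@lebesgue_measure T).
Local Notation tup n := (n.-tuple (measurableTypeR T)).

Lemma sqrt_pi_pow n : Num.sqrt (pi : T) ^+ n = pi `^ (n%:R / 2).
Proof.
rewrite -powR12_sqrt ?pi_ge0// -powR_mulrn ?powR_ge0// -powRrM.
by rewrite mulrC.
Qed.

Lemma int_Rd_gauss n :
  int_Rd (fun x : 'cV[T]_n => (expR (- enorm x ^+ 2))%:E) = (pi `^ (n%:R / 2))%:E.
Proof.
rewrite -sqrt_pi_pow.
rewrite -(int_Rd_prod n (@measurable_gauss_fun T) (@gauss_fun_ge0 T) integralT_gauss).
congr int_Rd; apply/funext => x; congr EFin.
by rewrite sq_enormE -sumrN expR_sum; apply: eq_bigr.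
Qed.

(** The constant of [polar_integral] is found by testing on the Gaussian, whose
    integral is a product of one-dimensional ones on one side and a Gamma
    integral on the other. *)
Lemma radial_integral n (f : T -> T) : (0 < n)%N ->
  measurable_fun (`[0%R, +oo[%classic : set (measurableTypeR T)) f ->
  (forall r, 0 <= r -> 0 <= f r) ->
  int_Rd (fun x : 'cV[T]_n => (f (enorm x ^+ 2))%:E) =
  ((pi `^ (n%:R / 2) / Gamma (n%:R / 2))%:E *
    \int[mu]_(r in `[0%R, +oo[) (r `^ (n%:R / 2 - 1) * f r)%:E)%E.
Proof.
move=> n0 mf f0; have [c c0 polar] := @polar_integral T n n0.
set s := n%:R / 2 in polar *.
pose J (h : T -> T) := (\int[mu]_(r in `[0%R, +oo[) (r `^ (s - 1) * h r)%:E)%E.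
have mJ (h : T -> T) (A : set (measurableTypeR T)) : measurable A -> measurable_fun A h ->
    measurable_fun A (fun r => (r `^ (s - 1) * h r)%:E).
  move=> mA mh; apply/measurable_EFinP; apply: measurable_funM => //.
  by apply: measurable_funTS; exact: measurable_powR.
have oc (h : T -> T) : measurable_fun (`[0%R, +oo[%classic : set (measurableTypeR T)) h ->
    (\int[mu]_(r in `]0%R, +oo[) (r `^ (s - 1) * h r)%:E)%E = J h.
  move=> mh; apply: integral_itv_obnd_cbnd; apply: mJ => //.
  by apply: measurable_funS mh => // x /=; rewrite !in_itv/= !andbT => /ltW.
have {}polar (h : T -> T) : measurable_fun (`[0%R, +oo[%classic : set (measurableTypeR T)) h ->
    (forall r, 0 <= r -> 0 <= h r) ->
    int_Rd (fun x : 'cV[T]_n => (h (enorm x ^+ 2))%:E) = (c%:E * J h)%E.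
  move=> mh h0; rewrite -oc//.
  pose h' := (EFin \o h) \_ `[0%R, +oo[%classic.
  transitivity (int_Rd (fun x : 'cV[T]_n => h' (enorm x ^+ 2))).
    congr int_Rd; apply/funext => x.
    by rewrite /h' patchE mem_set//= in_itv/= andbT sqr_ge0.
  rewrite polar.
  - congr (_ * _)%E; apply: eq_integral => r; rewrite inE/= in_itv/= andbT => r0.
    by rewrite /h' patchE mem_set//= in_itv/= andbT ltW.
  - apply/(measurable_restrictT _ _).1 => //.
    exact/measurable_EFinP.
  - move=> r; apply: erestrict_ge0 => {}r/=; rewrite in_itv/= andbT => r0.
    by rewrite lee_fin h0.
have me : measurable_fun (`[0%R, +oo[%classic : set (measurableTypeR T)) (fun r : T => expR (- r)).
  by apply: measurableT_comp => //; apply: measurable_funTS; exact: oppr_measurable.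
have GE := polar _ me (fun r _ => expR_ge0 _).
rewrite int_Rd_gauss -/s in GE.
have pi0 : 0 < (pi : T) `^ s by rewrite powR_gt0// pi_gt0.
have c1 : 0 < c.
  rewrite lt_neqAle c0 andbT; apply/eqP => c00.
  by move: GE; rewrite -c00 mul0e => -[] /eqP; rewrite gt_eqF.
have J0 : (0 <= J (fun r => expR (- r)))%E.
  by apply: integral_ge0 => r _; rewrite lee_fin mulr_ge0 ?powR_ge0 ?expR_ge0.
have Gam : c = pi `^ s / Gamma s.
  have : Gamma s = fine (J (fun r => expR (- r))) by [].
  move: GE J0; case: (J _) => [j|//|//] /=.
    move=> [piE] _ ->; rewrite piE mulfK//.
    by apply: contra_eqN piE => /eqP ->; rewrite mulr0 gt_eqF.
  by rewrite gt0_muley// lte_fin.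
by rewrite polar// Gam.
Qed.

End radial_moments.

(** * Moments of radial and elliptic densities *)

Section elliptic_moments.
Context {T : realType}.
Local Notation mu := (@lebesgue_measure T).
Local Notation tup n := (n.-tuple (measurableTypeR T)).

Lemma int_Rd_ge0 n (F : 'cV[T]_n -> \bar T) : (forall x, 0 <= F x)%E ->
  (0 <= int_Rd F)%E.
Proof. by move=> F0; exact: integral_ge0. Qed.

Lemma int_RdD n (F G : 'cV[T]_n -> \bar T) : mfunRd F -> mfunRd G ->
  (forall x, 0 <= F x)%E -> (forall x, 0 <= G x)%E ->
  int_Rd (fun x => F x + G x)%E = (int_Rd F + int_Rd G)%E.
Proof. by move=> mF mG F0 G0; rewrite /int_Rd ge0_integralD. Qed.

Lemma int_Rd_sum n (I : Type) (r : seq I) (F : I -> 'cV[T]_n -> \bar T) :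
  (forall i, mfunRd (F i)) -> (forall i x, 0 <= F i x)%E ->
  int_Rd (fun x => \sum_(i <- r) F i x)%E = (\sum_(i <- r) int_Rd (F i))%E.
Proof. by move=> mF F0; rewrite /int_Rd ge0_integral_sum. Qed.

Lemma int_Rd_orthogonal n (P : 'M[T]_n) (F : 'cV[T]_n -> \bar T) :
  P^T *m P = 1%:M -> mfunRd F -> (forall x, 0 <= F x)%E ->
  int_Rd (fun x => F (P *m x)) = int_Rd F.
Proof.
move=> PP mF F0; have [_ uP] := mulmx1_unit PP.
have := int_Rd_affine uP 0 mF F0.
have -> : `|\det P| = 1.
  apply/eqP; rewrite -sqrp_eq1 ?normr_ge0// -normrX expr2 -{1}det_tr -det_mulmx.
  by rewrite PP det1 normr1.
rewrite invr1 mul1e => <-; congr int_Rd; apply/funext => x.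
by rewrite addr0.
Qed.

Lemma enorm_orthogonal n (P : 'M[T]_n) (x : 'cV[T]_n) : P^T *m P = 1%:M ->
  enorm (P *m x) ^+ 2 = enorm x ^+ 2.
Proof.
by move=> PP; rewrite !enorm_sqr trmx_mul -mulmxA (mulmxA P^T) PP mul1mx.
Qed.

Lemma mfunRdR_linear n (u : 'cV[T]_n) (c : T) :
  mfunRdR (fun y : 'cV[T]_n => (u^T *m y) 0 0 + c).
Proof.
rewrite /mfunRdR; apply: measurable_funD => //; under eq_fun do rewrite mxE.
apply: measurable_sum => j; apply: measurable_funM => //.
exact: mfunRdR_coord.
Qed.

(** A generator is the profile of a radial probability density, and the finiteness
    of the integral of [r `^ (n / 2) * g r] says that it has a second moment. *)
Section generator.
Variables (n : nat) (g : T -> T).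
Hypotheses (n0 : (0 < n)%N) (hg : elliptic_generator n g).
Local Notation w y := (g (enorm y ^+ 2)).

Lemma generator_measurable :
  measurable_fun (`[0%R, +oo[%classic : set (measurableTypeR T)) g.
Proof. by case: hg => _ _ /integrableP[/measurable_EFinP]. Qed.

Lemma generator_gt0 r : 0 <= r -> 0 < g r.
Proof. by case: hg => _ + _ _ _; exact. Qed.

Lemma int_Rd_generator : int_Rd (fun y : 'cV[T]_n => (w y)%:E) = 1%E.
Proof.
rewrite radial_integral//; first by case: hg.
- exact: generator_measurable.
- by move=> r /generator_gt0/ltW.
Qed.

Lemma generator_second_moment_fin :
  (int_Rd (fun y : 'cV[T]_n => (enorm y ^+ 2 * w y)%:E) < +oo)%E.
Proof.
have -> : int_Rd (fun y : 'cV[T]_n => (enorm y ^+ 2 * w y)%:E) =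
    ((pi `^ (n%:R / 2) / Gamma (n%:R / 2))%:E *
      \int[mu]_(r in `[0%R, +oo[) (r `^ (n%:R / 2) * g r)%:E)%E.
  rewrite (@radial_integral _ n (fun r => r * g r))//.
  - congr (_ * _)%E; apply: eq_integral => r; rewrite inE/= in_itv/= andbT => r0.
    rewrite mulrA; congr (_ * _)%:E.
    have [->|rn0] := eqVneq r 0.
      by rewrite mulr0 powR0// mulf_neq0// pnatr_eq0 -lt0n.
    by rewrite -{2}(powRr1 r0) -powRD ?subrK// rn0 implybT.
  - by apply: measurable_funM => //; exact: generator_measurable.
  - by move=> r r0; rewrite mulr_ge0// ltW// generator_gt0.
have [_ _ _ _ [_ fin]] := hg.
have G0 : (0 <= \int[mu]_(r in `[0%R, +oo[) (r `^ (n%:R / 2) * g r)%:E)%E.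
  apply: integral_ge0 => r /=; rewrite in_itv/= andbT => r0.
  by rewrite lee_fin mulr_ge0 ?powR_ge0// ltW// generator_gt0.
by move: G0 fin; case: (integral _ _ _) => // r _ _; rewrite -EFinM ltry.
Qed.

Lemma mfunRdR_generator : mfunRdR (fun y : 'cV[T]_n => w y).
Proof.
rewrite /mfunRdR.
pose g' := g \_ (`[0%R, +oo[%classic : set (measurableTypeR T)).
have -> : (fun v : tup n => w (tcol v)) = (fun v => g' (enorm (tcol v) ^+ 2)).
  by apply/funext => v; rewrite /g' patchE mem_set//= in_itv/= andbT sqr_ge0.
apply: (@measurableT_comp _ _ _ _ _ (measurableTypeR T) g'); last exact: measurable_sq_enorm.
by apply/(measurable_restrictT _ _).1 => //; exact: generator_measurable.
Qed.

Let mq (u : 'cV[T]_n) (c : T) :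
  mfunRd (fun y : 'cV[T]_n => (((u^T *m y) 0 0 + c) ^+ 2 * w y)%:E).
Proof.
apply: mfunRd_EFin; rewrite /mfunRdR; apply: measurable_funM.
  by apply: measurable_funX; exact: mfunRdR_linear.
exact: mfunRdR_generator.
Qed.

Let q0 (u : 'cV[T]_n) (c : T) y : (0 <= (((u^T *m y) 0 0 + c) ^+ 2 * w y)%:E)%E.
Proof. by rewrite lee_fin mulr_ge0 ?sqr_ge0// ltW// generator_gt0// sqr_ge0. Qed.

(** Rotating [u] onto a coordinate axis shows that the second moment in the
    direction [u] is [|u|^2] times that of a coordinate, and the coordinates
    contribute equally to the total second moment. *)
Lemma second_moment_direction (u : 'cV[T]_n) :
  int_Rd (fun y : 'cV[T]_n => (((u^T *m y) 0 0) ^+ 2 * w y)%:E) =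
  (kappa n g * (u^T *m u) 0 0)%:E.
Proof.
have mq_ (v : 'cV[T]_n) : mfunRd (fun y : 'cV[T]_n => (((v^T *m y) 0 0) ^+ 2 * w y)%:E).
  by have := mq v 0; rewrite /mfunRd; under eq_fun do rewrite addr0.
have q0_ (v : 'cV[T]_n) y : (0 <= (((v^T *m y) 0 0) ^+ 2 * w y)%:E)%E.
  by have := q0 v 0 y; rewrite addr0.
have [k nE] : exists k, n = k.+1 by exists n.-1; rewrite prednK.
pose e0 : 'cV[T]_n := delta_mx (cast_ord (esym nE) ord0) 0.
pose M := int_Rd (fun y : 'cV[T]_n => (((e0^T *m y) 0 0) ^+ 2 * w y)%:E).
have ME (v : 'cV[T]_n) : int_Rd (fun y : 'cV[T]_n => (((v^T *m y) 0 0) ^+ 2 * w y)%:E) =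
    (((v^T *m v) 0 0)%:E * M)%E.
  have [H [Hs HH Hv]] : exists H : 'M[T]_n, [/\ H^T = H, H *m H = 1%:M &
      H *m v = Num.sqrt ((v^T *m v) 0 0) *: e0].
    rewrite /e0; move: (esym nE) v => En; case: _ / En => v.
    have := householder v; rewrite (_ : cast_ord _ _ = 0)//.
    exact/val_inj.
  rewrite -(int_Rd_orthogonal (P := H) _ (mq_ v) (q0_ v)); last by rewrite Hs.
  rewrite /M -(int_RdZl (sqnorm_ge0 v) (mq_ e0) (q0_ e0)).
  congr int_Rd; apply/funext => y.
  rewrite enorm_orthogonal ?Hs// mulmxA -{1}Hs -trmx_mul Hv linearZ/= -scalemxAl mxE.
  by rewrite exprMn (sqr_sqrtr (sqnorm_ge0 v)) -EFinM -[in LHS]mulrA.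
have ei (i : 'I_n) : ((delta_mx i 0 : 'cV[T]_n)^T *m (delta_mx i 0 : 'cV[T]_n)) 0 0 = 1.
  rewrite sqnormE (bigD1 i)//= mxE !eqxx expr1n big1 ?addr0// => j ji.
  by rewrite mxE (negbTE ji) expr0n.
have MT : int_Rd (fun y : 'cV[T]_n => (enorm y ^+ 2 * w y)%:E) = (n%:R%:E * M)%E.
  transitivity (int_Rd (fun y : 'cV[T]_n =>
     \sum_(i < n) ((((delta_mx i 0 : 'cV[T]_n)^T *m y) 0 0) ^+ 2 * w y)%:E)%E).
    congr int_Rd; apply/funext => y; rewrite sumEFin sq_enormE mulr_suml.
    congr EFin; apply: eq_bigr => i _; congr (_ ^+ 2 * _).
    by rewrite trmx_delta -rowE mxE.
  rewrite int_Rd_sum// (eq_bigr (fun=> M)) => [|i _]; last by rewrite ME ei mul1e.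
  rewrite big_const_ord; elim: (n) => [|j IH] /=; first by rewrite mul0e.
  by rewrite IH -nat1r EFinD ge0_muleDl ?lee_fin// mul1e.
have M0 : (0 <= M)%E by exact: int_Rd_ge0.
have := generator_second_moment_fin; rewrite ME /kappa MT.
have n0' : (0 : T) < n%:R by rewrite ltr0n.
move: M0; case: (M) => [m _|_|//]; last by rewrite gt0_muley// lte_fin.
move=> _; rewrite -!EFinM /=; congr EFin; field.
by rewrite gt_eqF.
Qed.

(** The cross term is odd: averaging the integrals at [y] and [- y] removes it
    without splitting an integral of a function without sign. *)
Lemma second_moment_affine (u : 'cV[T]_n) (c : T) :
  int_Rd (fun y : 'cV[T]_n => (((u^T *m y) 0 0 + c) ^+ 2 * w y)%:E) =
  (kappa n g * (u^T *m u) 0 0 + c ^+ 2)%:E.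
Proof.
set I := int_Rd _.
have NN : ((-1)%:M : 'M[T]_n)^T *m (-1)%:M = 1%:M.
  by rewrite tr_scalar_mx -scalar_mxM mulrNN mulr1.
have IN : I = int_Rd (fun y : 'cV[T]_n => ((- (u^T *m y) 0 0 + c) ^+ 2 * w y)%:E).
  rewrite /I -(int_Rd_orthogonal NN (mq u c) (q0 u c)); congr int_Rd.
  apply/funext => y; rewrite enorm_orthogonal// mul_scalar_mx scaleN1r mulmxN.
  by rewrite [X in X + c]mxE.
have mqN : mfunRd (fun y : 'cV[T]_n => ((- (u^T *m y) 0 0 + c) ^+ 2 * w y)%:E).
  have := mq (- u) c; rewrite /mfunRd; congr measurable_fun; apply/funext => v.
  by rewrite raddfN/= mulNmx [X in X + c]mxE.
have mq2 : mfunRd (fun y : 'cV[T]_n => (((u^T *m y) 0 0) ^+ 2 * w y)%:E).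
  by have := mq u 0; rewrite /mfunRd; under eq_fun do rewrite addr0.
have w0 y : 0 <= w y by rewrite ltW// generator_gt0// sqr_ge0.
have twice : (I + I = (2%R : T)%:E * (kappa n g * (u^T *m u) 0 0 + c ^+ 2)%:E)%E.
  rewrite {2}IN /I -int_RdD//; last first.
    by move=> y; rewrite lee_fin mulr_ge0// sqr_ge0.
  transitivity (int_Rd (fun y : 'cV[T]_n =>
     (2%R : T)%:E * ((((u^T *m y) 0 0) ^+ 2 * w y)%:E + (c ^+ 2)%:E * (w y)%:E))%E).
    congr int_Rd; apply/funext => y; rewrite -EFinM -!EFinD -?EFinM.
    by congr EFin; ring.
  have mw : mfunRd (fun y : 'cV[T]_n => (w y)%:E) by exact: mfunRd_EFin mfunRdR_generator.
  have mcw : mfunRd (fun y : 'cV[T]_n => (c ^+ 2)%:E * (w y)%:E)%E.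
    by apply: emeasurable_funM => //; exact: measurable_cst.
  have qy0 y : (0 <= (((u^T *m y) 0 0) ^+ 2 * w y)%:E)%E.
    by rewrite lee_fin mulr_ge0// sqr_ge0.
  have cw0 y : (0 <= (c ^+ 2)%:E * (w y)%:E)%E.
    by rewrite -EFinM lee_fin mulr_ge0// sqr_ge0.
  have wE0 y : (0 <= (w y)%:E)%E by rewrite lee_fin.
  rewrite (int_RdZl (ler0n _ 2) (emeasurable_funD mq2 mcw)); last first.
    by move=> y; exact: adde_ge0.
  rewrite (int_RdD mq2 mcw)// (int_RdZl (sqr_ge0 c) mw)//.
  by rewrite second_moment_direction int_Rd_generator mule1 -EFinD.
have I0 : (0 <= I)%E by exact: int_Rd_ge0.
clear IN; clearbody I; case: I twice I0 => [i|//|//]; rewrite -EFinM.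
by rewrite -EFinD => -[] H _; congr EFin; lra.
Qed.

End generator.

Lemma sqrtmx_det (n : nat) (S : 'M[T]_n) : spd S ->
  `|\det (sqrtmx S)| = Num.sqrt (\det S).
Proof.
by move=> /sqrtmx_spd[pS SS]; rewrite -{2}SS det_mulmx -expr2 sqrtr_sqr.
Qed.

(** A density with elliptic profile is the law of [m + sqrt S *m y] where [y]
    has the radial density [g (|y|^2)]. *)
Lemma int_Rd_elliptic n (g : T -> T) (m : 'cV[T]_n) (S : 'M[T]_n) rho
    (F : 'cV[T]_n -> T) : (0 < n)%N ->
  elliptic m S g rho -> mfunRdR F -> mfunRdR rho -> (forall x, 0 <= F x) ->
  int_Rd (fun x => (F x * rho x)%:E) =
  int_Rd (fun y => (F (sqrtmx S *m y + m) * g (enorm y ^+ 2))%:E).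
Proof.
move=> n0 [pS hg rhoE] mF mrho F0.
have [ph hh] := sqrtmx_spd pS; have [hs _] := ph; have uh := spd_unit ph.
have rho0 x : 0 <= rho x.
  rewrite rhoE mulr_ge0// ?invr_ge0// ltW// (generator_gt0 hg)//.
  have [Ss pSi] := spd_inv pS.
  by have [->|x0] := eqVneq (x - m) 0; [rewrite mulmx0 mxE|exact/ltW/pSi].
have mFr : mfunRd (fun x => (F x * rho x)%:E).
  by apply: mfunRd_EFin; exact: measurable_funM.
have Fr0 x : (0 <= (F x * rho x)%:E)%E by rewrite lee_fin mulr_ge0.
have := int_Rd_affine uh m mFr Fr0; rewrite sqrtmx_det//.
set d := Num.sqrt (\det S); have d0 : 0 < d by rewrite sqrtr_gt0 det_spd_gt0.
move=> H; transitivity (d%:E * ((d^-1)%:E * int_Rd (fun x => (F x * rho x)%:E)))%E.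
  by rewrite muleA -EFinM divff ?mul1e// gt_eqF.
rewrite -H -int_RdZl ?(ltW d0)//; last exact: mfunRd_affine (mFr).
congr int_Rd; apply/funext => y; rewrite -EFinM; congr EFin.
rewrite mulrCA; congr (_ * _); rewrite rhoE -/d mulrA divff ?gt_eqF// mul1r.
congr g; rewrite addrK enorm_sqr trmx_mul hs -!mulmxA; congr (_ 0 0).
congr (_ *m _); rewrite !mulmxA -[RHS]mul1mx; congr (_ *m _).
rewrite -[LHS](mulmxK uh) -(mulmxA (_ *m invmx S) (sqrtmx S) (sqrtmx S)) hh.
by rewrite mulmxKV ?spd_unit// mulmxV.
Qed.

End elliptic_moments.

(** * One-sided derivatives *)

Section one_sided_derivative.
Context {T : realType}.

Lemma has_derivative_withinP (A : set T) (h : T -> T) (t l : T) :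
  has_derivative_within A h t l <->
  (forall e, 0 < e -> exists2 dl, 0 < dl & forall s, `|t - s| < dl -> s != t ->
     A s -> `|l - (h s - h t) / (s - t)| < e).
Proof.
split=> [/cvgrPdist_lt H e e0|H].
  have /nbhs_ballP[dl /= dl0 dlH] := H e e0.
  by exists dl => // s ts st As; exact: (dlH s ts st As).
apply/cvgrPdist_lt => e e0; have [dl dl0 dlH] := H e e0.
by apply/nbhs_ballP; exists dl => //= s ts st As; exact: dlH.
Qed.

Lemma is_deriveP (h : T -> T) (t l : T) :
  is_derive t (1 : T) h l <->
  (forall e, 0 < e -> exists2 dl, 0 < dl & forall s, `|t - s| < dl -> s != t ->
     `|l - (h s - h t) / (s - t)| < e).
Proof.
have qE (s : T) : s^-1 *: ((h \o shift t) (s *: (1 : T)) - h t) =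
   (h (s + t) - h t) / (s + t - t).
  by rewrite /= -mulr_algl scaler1 addrK /GRing.scale/= mulr1 mulrC.
split=> [[dh <-] e e0|H].
  have /cvgrPdist_lt/(_ e e0)/nbhs_ballP[dl /= dl0 dlH] := dh.
  exists dl => // s ts st.
  have := dlH (s - t); rewrite /ball/= sub0r opprB => /(_ ts).
  by rewrite subr_eq0 => /(_ st); rewrite qE subrK.
have cv : s^-1 *: ((h \o shift t) (s *: (1 : T)) - h t) @[s --> 0^'] --> l.
  apply/cvgrPdist_lt => e e0; have [dl dl0 dlH] := H e e0.
  apply/nbhs_ballP; exists dl => //= s; rewrite /ball/= sub0r normrN => sdl s0.
  rewrite qE; apply: dlH; first by rewrite opprD addrCA subrr addr0 normrN.
  by rewrite -subr_eq0 addrK.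
apply: DeriveDef; first by apply/cvg_ex; exists l.
exact: cvg_lim cv.
Qed.

Lemma is_derive_within (A : set T) (h : T -> T) (t l : T) :
  is_derive t (1 : T) h l -> has_derivative_within A h t l.
Proof.
move=> /is_deriveP H; apply/has_derivative_withinP => e /H [dl dl0 dlH].
by exists dl => // s ts st _; exact: dlH.
Qed.

Lemma has_derivative_within_unique (h : T -> T) (t l1 l2 : T) :
  t \in `[0, 1] -> has_derivative_within `[0, 1] h t l1 ->
  has_derivative_within `[0, 1] h t l2 -> l1 = l2.
Proof.
rewrite in_itv/= => /andP[t0 t1] /has_derivative_withinP H1 /has_derivative_withinP H2.
apply/eqP; rewrite -subr_eq0 -normr_eq0; apply/eqP/le_anti; rewrite normr_ge0 andbT.
apply/ler_addgt0Pr => e e0; rewrite add0r.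
have e2 : 0 < e / 2 by rewrite divr_gt0.
have [d1 d10 {}H1] := H1 _ e2; have [d2 d20 {}H2] := H2 _ e2.
have [s [ts st sA]] : exists s, [/\ `|t - s| < Num.min d1 d2, s != t & `[0, 1]%classic s].
  pose r := Num.min (Num.min d1 d2) 1 / 2.
  have r0 : 0 < r by rewrite divr_gt0// !lt_min d10 d20 ltr01.
  have rd : r < Num.min d1 d2.
    have : r * 2 <= Num.min d1 d2 by rewrite /r divfK ?pnatr_eq0// ge_min lexx.
    by lra.
  have r1 : r <= 1 / 2 by rewrite ler_pM2r ?invr_gt0// ge_min lexx orbT.
  have [tl|tl] := leP t (1 / 2).
    exists (t + r); split.
    - by rewrite opprD addrA subrr add0r normrN gtr0_norm.
    - by rewrite -subr_eq0 addrAC subrr add0r gt_eqF.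
    - rewrite /= in_itv/=; lra.
  exists (t - r); split.
  - by rewrite opprB addrC subrK gtr0_norm.
  - by rewrite -subr_eq0 addrAC subrr add0r oppr_eq0 gt_eqF.
  - rewrite /= in_itv/=; lra.
move: ts; rewrite lt_min => /andP[ts1 ts2].
have {H1} := H1 s ts1 st sA; have {H2} := H2 s ts2 st sA.
set q := _ / _ => q2 q1; rewrite (splitr e) -(subrK q l1) -addrA ltW//.
apply: le_lt_trans (ler_normD _ _) _.
by rewrite ltrD// distrC.
Qed.

(** One-sided differentiability at [0] is turned into ordinary
    differentiability by continuing [h] along its tangent on the negative
    half-line. *)
Definition tangent_extension (h : T -> T) (l r : T) : T :=
  if 0 <= r then h r else h 0 + l * r.

Lemma is_derive_tangent_extension (h h' : T -> T) (t : T) :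
  (forall r, 0 <= r -> has_derivative_within `[0, +oo[ h r (h' r)) -> 0 <= t ->
  is_derive t (1 : T) (tangent_extension h (h' 0)) (h' t).
Proof.
move=> dh t0; apply/is_deriveP => e e0.
have /has_derivative_withinP/(_ e e0)[dl dl0 dlH] := dh t t0.
pose dl' := if t == 0 then dl else Num.min dl t.
exists dl'.
  rewrite /dl'; case: eqP => // /eqP tn0; rewrite lt_min dl0 lt_neqAle eq_sym tn0.
  exact: t0.
move=> s; rewrite /dl' /tangent_extension t0.
have [s0 ts st|s0] := leP 0 s.
  apply: dlH => //; last by rewrite /= in_itv/= s0.
  by move: ts; case: ifP => // _; rewrite lt_min => /andP[].
case: eqP => [-> _ sn0|_].
  by rewrite subr0 addrAC subrr add0r mulfK// subrr normr0.
by rewrite lt_min => /andP[_]; rewrite gtr0_norm ?subr_gt0 ?(lt_le_trans s0)//; lra.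
Qed.

End one_sided_derivative.

(** * Smooth functions of several variables *)

Section smooth_functions.
Context {T : realType} {n : nat}.
Implicit Types (f g : 'cV[T]_n -> T).

Lemma partialD i f g x : differentiable f x -> differentiable g x ->
  partial i (f \+ g) x = partial i f x + partial i g x.
Proof. by move=> df dg; rewrite /partial deriveD//; exact: diff_derivable. Qed.

Lemma partialM i f g x : differentiable f x -> differentiable g x ->
  partial i (f \* g) x = f x * partial i g x + g x * partial i f x.
Proof. by move=> df dg; rewrite /partial deriveM//; exact: diff_derivable. Qed.

Lemma partial_cst i c (x : 'cV[T]_n) : partial i (cst c) x = 0.
Proof. exact: derive_cst. Qed.

Lemma differentiable_entry j (x : 'cV[T]_n) : differentiable (fun y : 'cV[T]_n => y j 0) x.
Proof. exact: differentiable_coord. Qed.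

(** Covers coordinates, affine functions and quadratic forms at once. *)
Lemma derive_quadratic_line f (x v : 'cV[T]_n) (c1 c2 : T) :
  (forall h, f (h *: v + x) = f x + h * c1 + h ^+ 2 * c2) -> 'D_v f x = c1.
Proof.
move=> fE; apply: cvg_lim => //; apply/cvgrPdist_lt => e e0; apply/nbhs_ballP.
have c0 : 0 < `|c2| + 1 by rewrite ltr_wpDl.
exists (e / (`|c2| + 1)) => /=; first by rewrite divr_gt0.
move=> h; rewrite /ball/= sub0r normrN ltr_pdivlMr// => he h0.
have -> : h^-1 *: (f (h *: v + x) - f x) = c1 + h * c2.
  by rewrite fE /GRing.scale/=; field.
rewrite opprD addrA subrr add0r normrN normrM (le_lt_trans _ he)//.
by rewrite ler_wpM2l// lerDl.
Qed.

Lemma partial_entry i j (x : 'cV[T]_n) :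
  partial i (fun y : 'cV[T]_n => y j 0) x = (j == i)%:R.
Proof.
apply: (derive_quadratic_line (c2 := 0)) => h.
by rewrite !mxE eqxx andbT mulr0 addr0 addrC.
Qed.

Lemma Ck_continuous k f : Ck k f -> continuous f.
Proof. by case: k => // k [df _] x; apply: differentiable_continuous. Qed.

Lemma CkS k f : Ck k.+1 f -> Ck k f.
Proof.
elim: k f => [|k IH] f; first exact: Ck_continuous.
by move=> [df pf]; split=> // i; apply: IH.
Qed.

Lemma Ck_cst k c : Ck k (cst c : 'cV[T]_n -> T).
Proof.
elim: k c => [|k IH] c; first exact: cst_continuous.
split=> [x|i]; first exact: differentiable_cst.
rewrite (_ : partial i _ = cst 0)//; apply/funext => x.
exact: partial_cst.
Qed.

Lemma CkD k f g : Ck k f -> Ck k g -> Ck k (f \+ g).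
Proof.
elim: k f g => [|k IH] f g.
  by move=> cf cg x; apply: (@continuousD _ _ _ f g x); [exact: cf|exact: cg].
move=> [df pf] [dg pg]; split=> [x|i]; first exact: differentiableD.
rewrite (_ : partial i _ = partial i f \+ partial i g); first exact: IH (pf i) (pg i).
by apply/funext => x; rewrite partialD.
Qed.

Lemma CkM k f g : Ck k f -> Ck k g -> Ck k (f \* g).
Proof.
elim: k f g => [|k IH] f g.
  by move=> cf cg x; apply: (@continuousM _ _ f g x); [exact: cf|exact: cg].
move=> Cf Cg; have [df pf] := Cf; have [dg pg] := Cg.
split=> [x|i]; first exact: differentiableM.
rewrite (_ : partial i _ = (f \* partial i g) \+ (g \* partial i f)).
  by apply: CkD; [exact: IH (CkS Cf) (pg i)|exact: IH (CkS Cg) (pf i)].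
by apply/funext => x; rewrite partialM.
Qed.

Lemma Ck_sum k (I : Type) (r : seq I) (F : I -> 'cV[T]_n -> T) :
  (forall i, Ck k (F i)) -> Ck k (fun x => \sum_(i <- r) F i x).
Proof.
move=> CF; elim: r => [|i r IH].
  rewrite (_ : (fun x => _) = cst 0); first exact: Ck_cst.
  by apply/funext => x; rewrite big_nil.
rewrite (_ : (fun x => _) = F i \+ (fun x => \sum_(i <- r) F i x)); first exact: CkD.
by apply/funext => x; rewrite big_cons.
Qed.

Lemma smoothD f g : smooth f -> smooth g -> smooth (f \+ g).
Proof. by move=> sf sg k; apply: CkD. Qed.

Lemma smoothM f g : smooth f -> smooth g -> smooth (f \* g).
Proof. by move=> sf sg k; apply: CkM. Qed.

Lemma smooth_cst c : smooth (cst c : 'cV[T]_n -> T).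
Proof. by move=> k; exact: Ck_cst. Qed.

Lemma smooth_sum (I : Type) (r : seq I) (F : I -> 'cV[T]_n -> T) :
  (forall i, smooth (F i)) -> smooth (fun x => \sum_(i <- r) F i x).
Proof. by move=> sF k; apply: Ck_sum => i; exact: sF. Qed.

Lemma smooth_differentiable f x : smooth f -> differentiable f x.
Proof. by move=> /(_ 1%N)[]. Qed.

Lemma smooth_continuous f : smooth f -> continuous f.
Proof. by move=> /(_ 0%N). Qed.

Lemma smooth_partial i f : smooth f -> smooth (partial i f).
Proof. by move=> sf k; have [_ pf] := sf k.+1; exact: pf. Qed.

Lemma smooth_entry j : smooth (fun y : 'cV[T]_n => y j 0).
Proof.
case=> [|k]; first exact: coord_continuous.
split=> [x|i]; first exact: differentiable_entry.
rewrite (_ : partial i _ = cst (j == i)%:R); first exact: Ck_cst.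
by apply/funext => x; rewrite partial_entry.
Qed.

Lemma smooth_affine m (A : 'M[T]_(m, n)) (c : 'cV[T]_m) i :
  smooth (fun x : 'cV[T]_n => (A *m x + c) i 0).
Proof.
rewrite (_ : (fun x => _) = (fun x : 'cV[T]_n => \sum_j A i j * x j 0) \+ cst (c i 0)).
  apply: smoothD; last exact: smooth_cst.
  apply: smooth_sum => j; apply: smoothM; [exact: smooth_cst|exact: smooth_entry].
by apply/funext => x; rewrite !mxE.
Qed.

Lemma smooth_quadratic_form m (A : 'M[T]_(m, n)) (c : 'cV[T]_m) (S : 'M[T]_m) :
  smooth (fun x : 'cV[T]_n => ((A *m x + c)^T *m S *m (A *m x + c)) 0 0).
Proof.
pose a i (x : 'cV[T]_n) := (A *m x + c) i 0.
rewrite (_ : (fun x => _) = (fun x => \sum_i \sum_j (cst (S j i) \* (a j \* a i)) x)).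
  apply: smooth_sum => i; apply: smooth_sum => j.
  apply: smoothM; first exact: smooth_cst.
  by apply: smoothM; exact: smooth_affine.
apply/funext => x; rewrite mxE; apply: eq_bigr => i _; rewrite mxE mulr_suml.
by apply: eq_bigr => j _; rewrite mxE /= -/(a j x) -/(a i x); ring.
Qed.

Lemma smooth_quadratic (B : 'M[T]_n) b : smooth (quadratic B b).
Proof.
rewrite (_ : quadratic B b = (cst 2^-1 \*
   (fun x => ((1%:M *m x + 0)^T *m B *m (1%:M *m x + 0)) 0 0)) \+
   (fun x => (b^T *m x + 0) 0 0)).
  apply: smoothD; last exact: smooth_affine.
  by apply: smoothM; [exact: smooth_cst|exact: smooth_quadratic_form].
by apply/funext => x; rewrite /quadratic /= !addr0 mul1mx.
Qed.

Lemma grad_quadratic (B : 'M[T]_n) b x : B^T = B -> grad (quadratic B b) x = B *m x + b.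
Proof.
move=> Bs; apply/matrixP => i j; rewrite ord1 mxE /partial.
pose e : 'cV[T]_n := delta_mx i 0.
apply: (derive_quadratic_line (c2 := 2^-1 * (e^T *m B *m e) 0 0)) => h.
have eE (y : 'cV[T]_n) : (e^T *m y) 0 0 = y i 0 by rewrite trmx_delta -rowE mxE.
have ye (y : 'cV[T]_n) : (y^T *m e) 0 0 = y i 0 by rewrite mx11_mulC eE.
have tE : (h *: e + x)^T = h *: e^T + x^T by apply/matrixP => k l; rewrite !mxE.
rewrite /quadratic -/e tE !(mulmxDl, mulmxDr) -!scalemxAl.
rewrite -!scalemxAr -!mulmxA.
have -> : (x^T *m (B *m e)) = (e^T *m (B *m x)).
  by apply/matrixP => k l; rewrite !ord1 mx11_mulC trmx_mul Bs -mulmxA.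
rewrite [(B *m x + b) i 0]mxE -(eE (B *m x)) -(ye b).
move: (e^T *m (B *m x)) (b^T *m e) (e^T *m (B *m e)) (x^T *m (B *m x)) (b^T *m x).
by move=> ex be ee xx bx; rewrite !mxE; field.
Qed.

(** The outer function is differentiable on the closed half-line only, one-sidedly at
    0; its tangent extension agrees with it on the values of [q] and
    is differentiable there, so the chain rule applies at each order. *)
Lemma smooth_comp_halfline (h : nat -> T -> T) (q : 'cV[T]_n -> T) :
  (forall k r, 0 <= r -> has_derivative_within `[0, +oo[ (h k) r (h k.+1 r)) ->
  smooth q -> (forall x, 0 <= q x) -> forall j, smooth (h j \o q).
Proof.
move=> dh sq q0.
pose H j := tangent_extension (h j) (h j.+1 0).
have HE j : h j \o q = H j \o q.
  by apply/funext => x; rewrite /= /H /tangent_extension q0.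
have dH j x : is_derive (q x) (1 : T) (H j) (h j.+1 (q x)).
  exact: is_derive_tangent_extension (dh j) (q0 x).
have dfH j x : differentiable (H j) (q x).
  by apply/derivable1_diffP; case: (dH j x).
have dHq j x : differentiable (h j \o q) x.
  by rewrite HE; apply: differentiable_comp => //; exact: smooth_differentiable.
have pHq j i : partial i (h j \o q) = (h j.+1 \o q) \* partial i q.
  apply/funext => x; rewrite /partial deriveE// HE diff_comp//; last first.
    exact: smooth_differentiable.
  rewrite /= deriveE; last exact: smooth_differentiable.
  by rewrite diff1E//= mulrC; have [_ <-] := dH j x; rewrite derive1E.
move=> j k; elim: k j => [|k IH] j.
  by move=> x; apply: differentiable_continuous.
split=> // i; rewrite pHq; apply: CkM; first exact: IH.
exact: smooth_partial.
Qed.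

End smooth_functions.

(** * The integral of a divergence *)

Section divergence_theorem.
Context {T : realType} {n : nat}.
Local Notation tup n := (n.-tuple (measurableTypeR T)).
Local Notation lam := (lebesgue_tuple T n).
Implicit Types (W : 'cV[T]_n -> T).

Definition Rd_integrable W :=
  lam.-integrable setT (fun v : tup n => (W (tcol v))%:E).

Lemma int_Rd_shift (F : 'cV[T]_n -> \bar T) c : mfunRd F ->
  int_Rd (fun x => F (x + c)) = int_Rd F.
Proof.
move=> mF.
have ge0_shift (G : 'cV[T]_n -> \bar T) : mfunRd G -> (forall x, 0 <= G x)%E ->
    int_Rd (fun x => G (x + c)) = int_Rd G.
  move=> mG G0; have := int_Rd_affine (unitmx1 _ _) c mG G0.
  rewrite det1 normr1 invr1 mul1e => <-; congr int_Rd.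
  by apply/funext => x; rewrite mul1mx.
have posE (h : tup n -> 'cV[T]_n) : (fun v => F (h v))^\+%E = (fun v => F^\+%E (h v)).
  by apply/funext => v; rewrite !funeposE.
have negE (h : tup n -> 'cV[T]_n) : (fun v => F (h v))^\-%E = (fun v => F^\-%E (h v)).
  by apply/funext => v; rewrite !funenegE.
have mp : mfunRd F^\+%E by rewrite /mfunRd -posE; exact: measurable_funepos.
have mn : mfunRd F^\-%E by rewrite /mfunRd -negE; exact: measurable_funeneg.
rewrite /int_Rd integralE [RHS]integralE !posE !negE; congr (_ - _)%E.
  exact: ge0_shift mp (funepos_ge0 F).
exact: ge0_shift mn (funeneg_ge0 F).
Qed.

Definition vanishes_outside (M : T) W :=
  forall x : 'cV[T]_n, (exists i : 'I_n, M < `|x i 0|) -> W x = 0.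

Definition cube_indic (M : T) (x : 'cV[T]_n) : T :=
  \prod_i \1_(`[- M, M]%classic) (x i 0).

Lemma cube_indic_integrable M : 0 < M -> Rd_integrable (cube_indic M).
Proof.
move=> M0; pose f (y : T) : T := \1_(`[- M, M]%classic) y.
have mf : measurable_fun setT f by exact: measurable_indic.
have f0 y : 0 <= f y by rewrite /f.
have fI : (\int[@lebesgue_measure T]_y (f y)%:E = (M - - M)%:E)%E.
  rewrite /f integral_indic// setIT; apply: etrans (lebesgue_measure_itv `[- M, M]) _.
  by rewrite /= lte_fin ifT ?EFinB//; lra.
apply/integrableP; split; first exact: mfunRd_EFin (mfunRdR_prod mf).
under eq_integral do rewrite gee0_abs ?lee_fin ?prodr_ge0//.
by have := int_Rd_prod n mf f0 fI; rewrite /int_Rd => ->; rewrite ltry.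
Qed.

Lemma cube_indic_ge0 M x : 0 <= cube_indic M x.
Proof. by apply: prodr_ge0 => i _; rewrite indicE. Qed.

Lemma cube_indicE M (x : 'cV[T]_n) : (forall i : 'I_n, `|x i 0| <= M) -> cube_indic M x = 1.
Proof.
move=> xM; apply: big1 => i _; rewrite indicE mem_set//= in_itv/= -ler_norml.
exact: xM.
Qed.

(** [K] times the indicator of the cube is an integrable majorant. *)
Lemma bounded_support_integrable M K W : 0 < M -> mfunRdR W ->
  vanishes_outside M W -> (forall x : 'cV[T]_n, (forall i : 'I_n, `|x i 0| <= M) -> `|W x| <= K) ->
  Rd_integrable W.
Proof.
move=> M0 mW W0 WK.
apply: (@le_integrable _ _ _ _ _ _ _ (fun v => (K * cube_indic M (tcol v))%:E)) => //.
- exact: mfunRd_EFin.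
- move=> v _; rewrite !abse_EFin lee_fin normrM.
  have [/existsP[i iM]|/existsPn/= h] := boolP [exists i, M < `|tcol v i 0|].
    by rewrite W0 ?normr0 ?mulr_ge0//; exists i.
  have h' i : `|tcol v i 0| <= M by rewrite leNgt.
  by rewrite cube_indicE// normr1 mulr1 (le_trans (WK _ h'))// ler_norm.
- under eq_fun do rewrite EFinM.
  exact: (integrableZl measurableT K (cube_indic_integrable M0)).
Qed.

Lemma continuous_bounded_cube M W : continuous W ->
  exists2 K, 0 < K & forall x : 'cV[T]_n, (forall i : 'I_n, `|x i 0| <= M) -> `|W x| <= K.
Proof.
move=> cW; pose A := [set v : 'rV[T]_n | forall i, `[- M, M]%classic (v ord0 i)].
have cA : compact A.
  exact: (@rV_compact T n (fun=> `[- M, M]%classic) (fun=> @segment_compact T (- M) M)).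
have ct : continuous (fun v : 'rV[T]_n => W v^T).
  move=> v; apply: (@continuous_comp _ _ _ (fun v : 'rV[T]_n => v^T) W); last exact: cW.
  move=> B /nbhs_ballP[e e0 eB]; apply/nbhs_ballP; exists e => //= u [_ vu].
  by apply: eB; split=> // i j; rewrite !mxE; exact: vu.
have /compact_bounded[K [Kreal KP]] : compact ((fun v : 'rV[T]_n => W v^T) @` A).
  by apply: continuous_compact => //; exact: continuous_subspaceT.
exists (Num.max K 0 + 1); first by rewrite ltr_pwDr// le_max lexx orbT.
move=> x xM; apply: (KP (Num.max K 0 + 1)); first by rewrite ltr_pwDr// le_max lexx.
exists x^T; last by rewrite trmxK.
by move=> i; rewrite mxE/= in_itv/= -ler_norml.
Qed.

Lemma continuous_compact_support_integrable M W : 0 < M -> continuous W ->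
  vanishes_outside M W -> Rd_integrable W.
Proof.
move=> M0 cW W0; have [K K0 WK] := continuous_bounded_cube M cW.
exact: bounded_support_integrable M0 (continuous_mfunRdR cW) W0 WK.
Qed.

Lemma is_derive_line W (x v : 'cV[T]_n) (t : T) : differentiable W (t *: v + x) ->
  is_derive t (1 : T) (fun s => W (s *: v + x)) ('D_v W (t *: v + x)).
Proof.
move=> dW; have dv : derivable W (t *: v + x) v by exact: diff_derivable.
have E : (fun h : T => h^-1 *: (((fun s => W (s *: v + x)) \o shift t) (h *: (1 : T)) -
     W (t *: v + x))) = (fun h => h^-1 *: ((W \o shift (t *: v + x)) (h *: v) - W (t *: v + x))).
  apply/funext => h /=; congr (_ *: (W _ - _)).
  by rewrite [h *: 1]mulr1 scalerDl addrA.
apply: DeriveDef; first by rewrite /derivable E.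
by rewrite /derive E.
Qed.

(** Translation invariance makes the integral of every difference quotient
    vanish; the quotients converge boundedly to the partial derivative. *)
Lemma int_partial_eq0 M W i : 0 < M -> Ck 1 W -> vanishes_outside M W ->
  Rd_integrable (partial i W) /\
  (\int[lam]_v (partial i W (tcol v))%:E = 0)%E.
Proof.
move=> M0 [dW pW] W0; pose e : 'cV[T]_n := delta_mx i 0.
have cW : continuous W by move=> x; exact: differentiable_continuous.
have cp : continuous (partial i W) by exact: pW.
(* The shifts move points by at most 1: the quotients vanish outside the cube
   [M + 1], and the mean value theorem evaluates the derivative in [M + 2]. *)
have [K K0 WK] := continuous_bounded_cube (M + 2) cp.
pose s k : T := k.+1%:R^-1.
have s0 k : 0 < s k by rewrite invr_gt0.
have s1 k : s k <= 1 by rewrite invf_le1// ler1n.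
pose Dk k x := (W (x + s k *: e) - W x) * k.+1%:R.
have sh_entry k (x : 'cV[T]_n) (j : 'I_n) : (x + s k *: e) j 0 = x j 0 + s k * (j == i)%:R.
  by rewrite !mxE eqxx andbT.
have sh_le k (x : 'cV[T]_n) (j : 'I_n) (r : T) : 0 <= r <= s k ->
    `|(r *: e + x) j 0 - x j 0| <= 1.
  move=> /andP[r0 rs]; rewrite !mxE addrK eqxx andbT ger0_norm; last first.
    by rewrite mulr_ge0.
  by rewrite (le_trans _ (s1 k))// (le_trans _ rs)// ler_piMr// lern1 leq_b1.
have Dk0 k : vanishes_outside (M + 1) (Dk k).
  move=> x [j jM]; rewrite /Dk !W0 ?subrr ?mul0r//; exists j.
    by rewrite (lt_trans _ jM)// ltrDl.
  have := sh_le k x j (s k); rewrite lexx ltW// => /(_ isT).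
  rewrite [s k *: e + x]addrC => h; rewrite -(ltrD2r 1) (lt_le_trans jM)//.
  rewrite -{1}(subrK ((x + s k *: e) j 0) (x j 0)) addrC.
  by rewrite (le_trans (ler_normD _ _))// lerD2l distrC h.
have DkK k (x : 'cV[T]_n) : (forall j : 'I_n, `|x j 0| <= M + 1) -> `|Dk k x| <= K.
  move=> xM.
  have dline t : is_derive t (1 : T) (fun t => W (t *: e + x)) (partial i W (t *: e + x)).
    exact: is_derive_line (dW _).
  have cline : {within `[0, s k], continuous (fun t => W (t *: e + x))}.
    apply: continuous_subspaceT => r; apply/differentiable_continuous/derivable1_diffP.
    by case: (dline r).
  have [t] := MVT (s0 k) (fun t _ => dline t) cline.
  rewrite in_itv/= => /andP[t0 ts]; rewrite scale0r add0r subr0 => WE.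
  rewrite /Dk [x + _]addrC WE -mulrA mulVf ?pnatr_eq0// mulr1.
  apply: WK => j; have := sh_le k x j t; rewrite (ltW t0) (ltW ts) => /(_ isT) h.
  rewrite -(subrK (x j 0) ((t *: e + x) j 0)) (le_trans (ler_normD _ _))//.
  by have := xM j; lra.
have M1 : 0 < M + 1 by rewrite addr_gt0.
have cWs k : continuous (fun x : 'cV[T]_n => W (x + s k *: e)).
  move=> x; apply: (@continuous_comp _ _ _ (fun x : 'cV[T]_n => x + s k *: e) W); last exact: cW.
  apply: (@continuousD _ _ _ (@id 'cV[T]_n) (cst (s k *: e))); first exact: cvg_id.
  exact: cst_continuous.
have mDk k : mfunRdR (Dk k).
  apply: measurable_funM => //; apply: measurable_funB.
    exact: continuous_mfunRdR (cWs k).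
  exact: continuous_mfunRdR cW.
have iDk k : Rd_integrable (Dk k).
  exact: bounded_support_integrable M1 (mDk k) (Dk0 k) (DkK k).
have iW : Rd_integrable W by exact: continuous_compact_support_integrable M0 cW W0.
have iWs k : Rd_integrable (fun x : 'cV[T]_n => W (x + s k *: e)).
  apply: (@continuous_compact_support_integrable (M + 1)) => //.
  move=> x xM; have := Dk0 k x xM; rewrite /Dk.
  rewrite (W0 x) ?subr0; last by case: xM => j jM; exists j; rewrite (lt_trans _ jM)// ltrDl.
  by move=> /eqP; rewrite mulf_eq0 pnatr_eq0 orbF => /eqP.
have Dkint k : (\int[lam]_v (Dk k (tcol v))%:E = 0)%E.
  transitivity (\int[lam]_v (k.+1%:R%:E * ((W (tcol v + s k *: e))%:E - (W (tcol v))%:E)))%E.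
    by apply: eq_integral => v _; rewrite -EFinB -EFinM mulrC.
  rewrite (integralZl measurableT (integrableB measurableT (iWs k) iW)).
  rewrite (integralB measurableT (iWs k) iW).
  have mW : mfunRd (EFin \o W) by exact: mfunRd_EFin (continuous_mfunRdR cW).
  have := int_Rd_shift (s k *: e) mW; rewrite /int_Rd/= => ->.
  rewrite subee ?mule0//; exact: integrable_fin_num iW.
have cvD x : Dk k x @[k --> \oo] --> partial i W x.
  have dl := is_derive_line (v := e) (t := 0) (x := x) (dW _).
  rewrite scale0r add0r in dl.
  apply/cvgrPdist_lt => eps eps0; have /is_deriveP/(_ eps eps0)[del del0 H] := dl.
  near=> j.
  have sk : s j < del by near: j; exact: (near_infty_natSinv_lt (PosNum del0)).
  have := H (s j); rewrite sub0r normrN gtr0_norm// gt_eqF// => /(_ sk isT).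
  by rewrite subr0 scale0r add0r /s invrK /Dk [x + _]addrC.
have := @dominated_convergence _ _ _ lam setT measurableT
  (fun k v => (Dk k (tcol v))%:E) (fun v => (partial i W (tcol v))%:E)
  (fun v => (K * cube_indic (M + 1) (tcol v))%:E).
case.
- by move=> j; exact: mfunRd_EFin (mDk j).
- exact: mfunRd_EFin (continuous_mfunRdR cp).
- by apply: aeW => v _; apply/cvg_EFin; [exact: nearW|exact: cvD].
- under eq_fun do rewrite EFinM.
  exact: (integrableZl measurableT K (cube_indic_integrable M1)).
- apply: aeW => v l _; rewrite abse_EFin lee_fin.
  have [/existsP[j jM]|/existsPn/= h] := boolP [exists j, M + 1 < `|tcol v j 0|].
    by rewrite Dk0 ?normr0 ?mulr_ge0 ?cube_indic_ge0 ?ltW//; exists j.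
  have h' j : `|tcol v j 0| <= M + 1 by rewrite leNgt.
  by rewrite cube_indicE// mulr1 DkK.
move=> ip _ c; split; first exact: ip.
move: c; rewrite (_ : (fun k => _) = cst 0%E); last by apply/funext => k; exact: Dkint.
by move=> /(cvg_lim (@ereal_hausdorff T)) <-; rewrite lim_cst.
Unshelve. all: by end_near.
Qed.

Lemma int_Rd_divergence_eq0 M (V : 'I_n -> 'cV[T]_n -> T) : 0 < M ->
  (forall i, Ck 1 (V i)) -> (forall i, vanishes_outside M (V i)) ->
  Rd_integrable (fun x => \sum_i partial i (V i) x) /\
  (\int[lam]_v (\sum_i partial i (V i) (tcol v))%:E = 0)%E.
Proof.
move=> M0 CV V0.
have iV i : Rd_integrable (partial i (V i)).
  by case: (int_partial_eq0 i M0 (CV i) (V0 i)).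
split.
  rewrite /Rd_integrable; under eq_fun do rewrite -sumEFin.
  apply: integrable_sum => // i _; exact: iV.
under eq_integral do rewrite -sumEFin.
rewrite integral_sum// big1// => i _.
by case: (int_partial_eq0 i M0 (CV i) (V0 i)).
Qed.

End divergence_theorem.

(** * Cutoff functions and least energy *)

Section minimal_energy.
Context {T : realType} {n : nat}.
Local Notation tup n := (n.-tuple (measurableTypeR T)).
Local Notation lam := (lebesgue_tuple T n).

(** The truncation needs only one continuous derivative, so a piecewise quadratic
    profile suffices; it is 1 at 0 and vanishes beyond 1. *)
Definition cutoff_profile (s : T) : T := Num.max 0 (1 - s) ^+ 2.
Definition cutoff_slope (s : T) : T := - 2 * Num.max 0 (1 - s).

Lemma cutoff_taylor r s :
  `|cutoff_slope s * (r - s) - (cutoff_profile r - cutoff_profile s)| <= (r - s) ^+ 2.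
Proof.
rewrite /cutoff_slope /cutoff_profile ler_norml.
have sq (x y : T) : 0 <= x -> 0 <= y -> 0 <= x * y by exact: mulr_ge0.
have t2 := sqr_ge0 (r - s); have u2 := sqr_ge0 (r - 1); have v2 := sqr_ge0 (s - 1).
have [h1|h1] := leP (1 - r) 0; have [h2|h2] := leP (1 - s) 0; apply/andP.
- split; nra.
- have := sq (r - 1) (1 - s); split; nra.
- have := sq (s - 1) (1 - r); split; nra.
- split; nra.
Qed.

Lemma is_derive_cutoff s : is_derive s (1 : T) cutoff_profile (cutoff_slope s).
Proof.
apply/is_deriveP => e e0; exists e => // r sr rs.
have rs0 : r - s != 0 by rewrite subr_eq0.
have n0 : 0 < `|r - s| by rewrite normr_gt0.
apply: le_lt_trans sr; rewrite [leRHS]distrC -(ler_pM2r n0) -normrM -expr2 real_normK ?num_real//.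
by rewrite mulrBl divfK//; exact: cutoff_taylor.
Qed.

Lemma continuous_cutoff_slope : continuous cutoff_slope.
Proof.
move=> s; apply/cvgrPdist_lt => e e0; apply/nbhs_ballP.
exists (e / 2) => /=; first by rewrite divr_gt0.
move=> r; rewrite /ball/= !ltr_norml /cutoff_slope => /andP[h1 h2].
by have [s1|s1] := leP (1 - s) 0; have [r1|r1] := leP (1 - r) 0; apply/andP; split; lra.
Qed.

Lemma cutoff_profile_01 s : 0 <= s -> 0 <= cutoff_profile s <= 1.
Proof.
rewrite /cutoff_profile => s0; have [h|h] := leP (1 - s) 0.
  by rewrite expr0n/= lexx ler01.
by rewrite sqr_ge0/=; nra.
Qed.

Lemma cutoff_profile_ge s : 0 <= s -> 1 - cutoff_profile s <= 2 * s.
Proof.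
rewrite /cutoff_profile => s0; have [h|h] := leP (1 - s) 0; last by nra.
by rewrite expr0n/=; lra.
Qed.

Lemma cutoff_slope_le2 s : 0 <= s -> `|cutoff_slope s| <= 2.
Proof.
rewrite /cutoff_slope => s0; rewrite mulNr normrN.
by have [h|h] := leP (1 - s) 0; rewrite ger0_norm; lra.
Qed.

Lemma cutoff_slope_eq0 s : 1 <= s -> cutoff_slope s = 0.
Proof. by move=> s1; rewrite /cutoff_slope max_l ?mulr0//; lra. Qed.

Lemma cutoff_profile_eq0 s : 1 <= s -> cutoff_profile s = 0.
Proof. by move=> s1; rewrite /cutoff_profile max_l ?expr0n//; lra. Qed.

Lemma partial_comp (H : T -> T) (dH : T -> T) (q : 'cV[T]_n -> T) i x :
  is_derive (q x) (1 : T) H (dH (q x)) -> differentiable q x ->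
  differentiable (H \o q) x /\ partial i (H \o q) x = dH (q x) * partial i q x.
Proof.
move=> dHq dq.
have dfH : differentiable H (q x) by apply/derivable1_diffP; case: dHq.
split; first exact: differentiable_comp.
rewrite /partial deriveE; last exact: differentiable_comp.
rewrite diff_comp//= deriveE// diff1E//= mulrC.
by have [_ <-] := dHq; rewrite derive1E.
Qed.

(** The squared norm scaled so that [cutoff k] vanishes outside the ball of radius
    [k.+1]; hence the cutoffs tend to 1 pointwise. *)
Definition cutoff_arg (k : nat) (x : 'cV[T]_n) : T := (k.+1%:R ^- 2) * enorm x ^+ 2.
Definition cutoff k : 'cV[T]_n -> T := cutoff_profile \o cutoff_arg k.

Lemma cutoff_arg_ge0 k x : 0 <= cutoff_arg k x.
Proof. by rewrite mulr_ge0 ?sqr_ge0// invr_ge0 sqr_ge0. Qed.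

Lemma smooth_sq_enorm : smooth (fun x : 'cV[T]_n => enorm x ^+ 2).
Proof.
rewrite (_ : (fun x => _) = (fun x : 'cV[T]_n =>
    \sum_i ((fun y : 'cV[T]_n => y i 0) \* (fun y : 'cV[T]_n => y i 0)) x)).
  by apply: smooth_sum => i; apply: smoothM; exact: smooth_entry.
by apply/funext => x; rewrite sq_enormE; apply: eq_bigr => i _; rewrite expr2.
Qed.

Lemma smooth_cutoff_arg k : smooth (cutoff_arg k).
Proof. by apply: smoothM smooth_sq_enorm; exact: smooth_cst. Qed.

Lemma partial_cutoff_arg k i x : partial i (cutoff_arg k) x = (k.+1%:R ^- 2) * (2 * x i 0).
Proof.
pose e : 'cV[T]_n := delta_mx i 0.
apply: (derive_quadratic_line (c2 := (k.+1%:R ^- 2) * (e^T *m e) 0 0)) => h.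
have xe : (e^T *m x) 0 0 = x i 0 by rewrite trmx_delta -rowE mxE.
have tE : (h *: e + x)^T = h *: e^T + x^T by apply/matrixP => a b; rewrite !mxE.
rewrite /cutoff_arg !enorm_sqr -/e tE !(mulmxDl, mulmxDr) -!scalemxAl -!scalemxAr.
have := mx11_mulC x e; rewrite -xe.
move: (x^T *m e) (e^T *m x) (e^T *m e) (x^T *m x) => a b c d.
by rewrite !mxE => ->; ring.
Qed.

Lemma partial_cutoff k i x : differentiable (cutoff k) x /\
  partial i (cutoff k) x = cutoff_slope (cutoff_arg k x) * ((k.+1%:R ^- 2) * (2 * x i 0)).
Proof.
rewrite -partial_cutoff_arg; apply: partial_comp; first exact: is_derive_cutoff.
exact: smooth_differentiable (smooth_cutoff_arg k).
Qed.

Lemma Ck1_cutoff k : Ck 1 (cutoff k).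
Proof.
split=> [x|i].
  apply: differentiable_comp; first exact: smooth_differentiable (smooth_cutoff_arg k).
  by apply/derivable1_diffP; case: (is_derive_cutoff (cutoff_arg k x)).
rewrite (_ : partial i _ = (cutoff_slope \o cutoff_arg k) \* (cst (k.+1%:R ^- 2) \*
    (cst 2 \* (fun y : 'cV[T]_n => y i 0)))); last first.
  by apply/funext => x; rewrite (partial_cutoff k i x).2.
apply: (@CkM _ _ 0).
  move=> x; apply: continuous_comp; last exact: continuous_cutoff_slope.
  exact: smooth_continuous (smooth_cutoff_arg k) x.
apply: (smoothM _ _ 0%N); first exact: smooth_cst.
apply: smoothM; [exact: smooth_cst|exact: smooth_entry].
Qed.

Lemma cutoff_vanishes k : vanishes_outside k.+1%:R (cutoff k).
Proof.
move=> x [i xi]; rewrite /cutoff /= cutoff_profile_eq0//.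
rewrite /cutoff_arg mulrC ler_pdivlMr ?exprn_gt0// mul1r.
apply: (@le_trans _ _ (x i 0 ^+ 2)).
  by rewrite -[x i 0 ^+ 2]real_normK ?num_real// ler_pXn2r ?nnegrE// ltW.
rewrite sq_enormE (bigD1 i)//= lerDl sumr_ge0// => j _; exact: sqr_ge0.
Qed.

End minimal_energy.

Section energy_comparison.
Context {T : realType} {n : nat}.
Local Notation tup n := (n.-tuple (measurableTypeR T)).
Local Notation lam := (lebesgue_tuple T n).

Lemma otto_phiE (rho f : 'cV[T]_n -> T) x :
  otto_phi rho f x = - \sum_i partial i (rho \* partial i f) x.
Proof.
rewrite /otto_phi /divergence; congr (- _); apply: eq_bigr => i _.
by congr partial; apply/funext => y; rewrite !mxE.
Qed.

Lemma otto_metricE (rho f : 'cV[T]_n -> T) :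
  otto_metric rho f = int_Rd (fun x => (\sum_i partial i f x ^+ 2 * rho x)%:E).
Proof.
congr int_Rd; apply/funext => x; congr EFin.
rewrite sq_enormE mulr_suml; apply: eq_bigr => i _.
by rewrite mxE.
Qed.

(** The energy of [f] under [rho] is compared with that of another potential
    [f'] that induces the same tangent vector.  Formally, [f] is the
    orthogonal projection of [f'], since the integral of
    [rho (grad f' - grad f) . grad f] is zero.  To integrate by parts, [f] is
    multiplied by [cutoff k]; as nothing is assumed on the growth of [f'], the
    inequality is derived with the compactly supported field [w k], the gradient of
    [cutoff k * f], in place of [grad f], and the error tends to 0. *)
Variables (rho f f' : 'cV[T]_n -> T) (c : T).
Hypotheses (srho : smooth rho) (rho0 : forall x, 0 < rho x).
Hypothesis rho2 : (int_Rd (fun x => (enorm x ^+ 2 * rho x)%:E) < +oo)%E.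
Hypotheses (sf : smooth f) (sf' : smooth f').
Hypothesis fc : forall x, `|f x| <= c * (1 + enorm x ^+ 2).
Hypothesis ffin : (otto_metric rho f < +oo)%E.
Hypothesis same_phi : forall x, otto_phi rho f x = otto_phi rho f' x.

Let c0 : 0 <= c.
Proof.
have := fc 0; rewrite sq_enormE big1 => [|i _]; last by rewrite mxE expr0n.
by rewrite addr0 mulr1; apply: le_trans.
Qed.

Let U i := (rho \* partial i f') \+ (cst (-1) \* (rho \* partial i f)).

Let sU i : smooth (U i).
Proof.
apply: smoothD; first by apply: smoothM => //; exact: smooth_partial.
apply: smoothM; first exact: smooth_cst.
by apply: smoothM => //; exact: smooth_partial.
Qed.

Let UE i x : U i x = rho x * (partial i f' x - partial i f x).
Proof. by rewrite /U /=; ring. Qed.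

Let divU x : \sum_i partial i (U i) x = 0.
Proof.
have srp i (h : 'cV[T]_n -> T) : smooth h -> smooth (rho \* partial i h).
  by move=> sh; apply: smoothM => //; exact: smooth_partial.
rewrite (eq_bigr (fun i => partial i (rho \* partial i f') x -
    partial i (rho \* partial i f) x)) => [|i _]; last first.
  rewrite partialD; last 2 first.
  - exact: smooth_differentiable (srp i f' sf').
  - by apply: smooth_differentiable; apply: smoothM; [exact: smooth_cst|exact: srp].
  rewrite (@partialM _ _ i (cst (-1))); last 2 first.
  - exact: differentiable_cst.
  - exact: smooth_differentiable (srp i f sf).
  by rewrite partial_cst mulr0 addr0 /= mulN1r.
have E := same_phi x; rewrite (otto_phiE rho f) (otto_phiE rho f') in E.
by rewrite sumrB (oppr_inj E) subrr.
Qed.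

Let w k i := partial i (cutoff k \* f).

Let Ck1f k : Ck 1 (cutoff k \* f).
Proof. by apply: CkM; [exact: Ck1_cutoff|exact: sf]. Qed.

Let wE k i x : w k i x = cutoff k x * partial i f x +
  f x * (cutoff_slope (cutoff_arg k x) * ((k.+1%:R ^- 2) * (2 * x i 0))).
Proof.
have [dc <-] := partial_cutoff k i x.
by rewrite /w partialM//; exact: smooth_differentiable.
Qed.

(** The flux [rho *: (grad f' - grad f)] is divergence free, hence orthogonal
    to the gradient of every compactly supported function. *)
Let flux_orthogonal k :
  Rd_integrable (fun x => \sum_i w k i x * U i x) /\
  (\int[lam]_v (\sum_i w k i (tcol v) * U i (tcol v))%:E = 0)%E.
Proof.
have k0 : 0 < k.+1%:R :> T by [].
pose V i := (cutoff k \* f) \* U i.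
have CV i : Ck 1 (V i) by apply: CkM => //; exact: sU.
have V0 i : vanishes_outside k.+1%:R (V i).
  by move=> x xk; rewrite /V /= cutoff_vanishes// !mul0r.
have E x : \sum_i partial i (V i) x = \sum_i w k i x * U i x.
  rewrite (eq_bigr (fun i => cutoff k x * f x * partial i (U i) x + U i x * w k i x)) => [|i _].
    rewrite big_split/= -mulr_sumr divU mulr0 add0r.
    by apply: eq_bigr => i _; rewrite mulrC.
  rewrite partialM//; first by have [d _] := Ck1f k; exact: d.
  exact: smooth_differentiable.
have := int_Rd_divergence_eq0 k0 CV V0.
by rewrite (_ : (fun x => _) = (fun x => \sum_i w k i x * U i x));
  [under eq_integral do rewrite E|apply/funext].
Qed.

Let err k x := \sum_i (partial i f x - w k i x) ^+ 2 * rho x.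

Let err_ge0 k x : 0 <= err k x.
Proof. by apply: sumr_ge0 => i _; rewrite mulr_ge0 ?sqr_ge0// ltW. Qed.

Let cf : continuous f. Proof. exact: smooth_continuous. Qed.

Let merr k : mfunRdR (err k).
Proof.
apply: measurable_sum => i; apply: measurable_funM.
  apply: measurable_funX; apply: measurable_funB; apply: continuous_mfunRdR.
    exact: smooth_continuous (smooth_partial i sf).
  by have [_ p] := Ck1f k; exact: p.
exact: continuous_mfunRdR (smooth_continuous srho).
Qed.

(** An integrable majorant of [err k], uniform in [k].  The constant 128 is
    [2 * 8^2], with 8 coming from [tail_bound]. *)
Let dom x := \sum_i (2 * (partial i f x ^+ 2 * rho x) + 128 * c ^+ 2 * (x i 0 ^+ 2 * rho x)).

(** On the support of the slope, [enorm x] is at most [k.+1], so the quadratic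
    growth of [f] is compensated by the factor [k.+1 ^- 2]. *)
Let tail_bound k i x :
  `|f x * (cutoff_slope (cutoff_arg k x) * ((k.+1%:R ^- 2) * (2 * x i 0)))| <=
  8 * c * `|x i 0|.
Proof.
have q0 := cutoff_arg_ge0 k x.
have [q1|q1] := leP 1 (cutoff_arg k x).
  by rewrite cutoff_slope_eq0// mul0r mulr0 normr0 mulr_ge0// mulr_ge0.
have N1 : 1 <= k.+1%:R ^+ 2 :> T by rewrite exprn_ege1// ler1n.
have N0 : 0 < k.+1%:R ^+ 2 :> T by rewrite (lt_le_trans ltr01).
set N := k.+1%:R ^+ 2 in N1 N0 *.
have xN : enorm x ^+ 2 <= N.
  by move: q1; rewrite /cutoff_arg -/N mulrC ltr_pdivrMr// mul1r => /ltW.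
have f2 : `|f x| <= 2 * c * N.
  by apply: (le_trans (fc x)); have := c0; nra.
move: (cutoff_slope_le2 q0); move: (cutoff_slope _) => sl.
rewrite !normrM (ger0_norm (ler0n _ 2)) (gtr0_norm (_ : 0 < N^-1)) ?invr_gt0//.
set s := `|sl|; set X := `|x i 0| => s2.
have X0 : 0 <= X by exact: normr_ge0.
have h1 : `|f x| * N^-1 <= 2 * c by rewrite ler_pdivrMr.
have h2 : s * (2 * X) <= 2 * (2 * X) by rewrite ler_wpM2r// mulr_ge0.
rewrite (_ : `|f x| * _ = `|f x| * N^-1 * (s * (2 * X))); last by ring.
rewrite (_ : 8 * c * X = 2 * c * (2 * (2 * X))); last by ring.
apply: ler_pM => //; first by rewrite mulr_ge0// invr_ge0 ltW.
by apply: mulr_ge0 (normr_ge0 _) _; rewrite mulr_ge0.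
Qed.

Let err_dom k x : err k x <= dom x.
Proof.
apply: ler_sum => i _; have r0 := ltW (rho0 x).
rewrite !mulrA -mulrDl ler_wpM2r// wE.
have := tail_bound k i x; set t := f x * _ => tb.
have t2 : t ^+ 2 <= 64 * c ^+ 2 * x i 0 ^+ 2.
  rewrite -[t ^+ 2]real_normK ?num_real// -[x i 0 ^+ 2]real_normK ?num_real//.
  have -> : 64 * c ^+ 2 * `|x i 0| ^+ 2 = (8 * c * `|x i 0|) ^+ 2 by ring.
  by rewrite ler_pXn2r ?nnegrE// !mulr_ge0.
have /andP[u0 u1] := cutoff_profile_01 (cutoff_arg_ge0 k x).
rewrite -[cutoff_profile _]/(cutoff k x) in u0 u1.
set u := cutoff k x in u0 u1 *; set a := partial i f x.
have : (1 - u) ^+ 2 * a ^+ 2 <= a ^+ 2.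
  by rewrite ler_piMl ?sqr_ge0//; nra.
have -> : (a - (u * a + t)) ^+ 2 =
    2 * ((1 - u) ^+ 2 * a ^+ 2) + 2 * t ^+ 2 - ((1 - u) * a + t) ^+ 2 by ring.
have := sqr_ge0 ((1 - u) * a + t); lra.
Qed.

Let toint (F : 'cV[T]_n -> T) : mfunRdR F -> (forall x, 0 <= F x) ->
  (int_Rd (fun x => (F x)%:E) < +oo)%E -> Rd_integrable F.
Proof.
move=> mF F0 fin; apply/integrableP; split; first exact: mfunRd_EFin.
by under eq_integral do rewrite gee0_abs ?lee_fin//.
Qed.

Let menergy h : smooth h -> mfunRdR (fun x => \sum_i partial i h x ^+ 2 * rho x).
Proof.
move=> sh; apply: measurable_sum => i; apply: measurable_funM; last first.
  exact: continuous_mfunRdR (smooth_continuous srho).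
apply: measurable_funX.
exact: continuous_mfunRdR (smooth_continuous (smooth_partial i sh)).
Qed.

Let energy_ge0 (h : 'cV[T]_n -> T) x : 0 <= \sum_i partial i h x ^+ 2 * rho x.
Proof. by apply: sumr_ge0 => i _; rewrite mulr_ge0 ?sqr_ge0// ltW. Qed.

Let ienergy h : smooth h -> (otto_metric rho h < +oo)%E ->
  Rd_integrable (fun x => \sum_i partial i h x ^+ 2 * rho x).
Proof. by move=> sh; rewrite otto_metricE; apply: toint; [exact: menergy|]. Qed.

Let idom : Rd_integrable dom.
Proof.
have mr : mfunRdR rho by exact: continuous_mfunRdR (smooth_continuous srho).
have i1 := ienergy sf ffin.
have i2 : Rd_integrable (fun x => enorm x ^+ 2 * rho x).
  apply: toint rho2.
    by apply: measurable_funM => //; exact: measurable_sq_enorm.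
  by move=> x; rewrite mulr_ge0 ?sqr_ge0// ltW.
rewrite /Rd_integrable (_ : (fun v => _) = (fun v =>
  (2%:E * (\sum_i partial i f (tcol v) ^+ 2 * rho (tcol v))%:E +
   (128 * c ^+ 2)%:E * (enorm (tcol v) ^+ 2 * rho (tcol v))%:E)%E)); last first.
  apply/funext => v; rewrite -!EFinM -EFinD; congr EFin.
  by rewrite /dom big_split/= -!mulr_sumr sq_enormE mulr_suml.
apply: integrableD => //; exact: integrableZl.
Qed.

Let ierr k : Rd_integrable (err k).
Proof.
apply: (le_integrable measurableT _ _ idom); first exact: mfunRd_EFin (merr k).
move=> v _; rewrite !abse_EFin lee_fin ger0_norm// (le_trans (err_dom k _))//.
exact: ler_norm.
Qed.

Let err_cvg x : err k x @[k --> \oo] --> 0.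
Proof.
(* The [i]-th component of the error gradient is at most [Ci i / k.+1]. *)
pose Ci i := 2 * enorm x ^+ 2 * `|partial i f x| + `|f x| * (4 * `|x i 0|).
pose K := \sum_i Ci i ^+ 2 * rho x.
have Ci0 i : 0 <= Ci i.
  by apply: addr_ge0; apply: mulr_ge0 => //; apply: mulr_ge0; rewrite ?sqr_ge0.
apply: (@squeeze_cvgr _ _ _ _ (cst 0) (fun k => k.+1%:R^-1 * K)).
- apply: nearW => k; rewrite err_ge0/= mulr_sumr; apply: ler_sum => i _.
  rewrite mulrA ler_wpM2r ?(ltW (rho0 x))// wE.
  set N := k.+1%:R : T; have N1 : 1 <= N by rewrite ler1n.
  have N0 : 0 < N by rewrite (lt_le_trans ltr01).
  have q0 := cutoff_arg_ge0 k x.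
  have h1 := cutoff_profile_ge q0; have /andP[u0 u1] := cutoff_profile_01 q0.
  have h2 := cutoff_slope_le2 q0.
  rewrite -[cutoff_profile _]/(cutoff k x) in h1 u0 u1.
  have d1 : `|(1 - cutoff k x) * partial i f x| <= N ^- 2 * (2 * enorm x ^+ 2 * `|partial i f x|).
    rewrite normrM ger0_norm ?subr_ge0// mulrA ler_wpM2r//.
    by apply: (le_trans h1); rewrite /cutoff_arg -/N mulrCA.
  have d2 : `|f x * (cutoff_slope (cutoff_arg k x) * (N ^- 2 * (2 * x i 0)))| <=
      N ^- 2 * (`|f x| * (4 * `|x i 0|)).
    move: h2; move: (cutoff_slope _) => sl h2.
    rewrite !normrM (ger0_norm (ler0n _ 2)) (ger0_norm (_ : 0 <= N ^- 2)); last first.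
      by rewrite invr_ge0 sqr_ge0.
    rewrite [leLHS](_ : _ = N ^- 2 * (`|f x| * (`|sl| * (2 * `|x i 0|)))); last by ring.
    rewrite ler_wpM2l ?invr_ge0 ?sqr_ge0// ler_wpM2l// mulrA ler_wpM2r//; lra.
  have d : `|partial i f x - (cutoff k x * partial i f x + f x *
      (cutoff_slope (cutoff_arg k x) * (N ^- 2 * (2 * x i 0))))| <= N^-1 * Ci i.
    rewrite opprD addrA -{1}(mul1r (partial i f x)) -mulrBl.
    rewrite (le_trans (ler_normB _ _))// (le_trans (lerD d1 d2))// -mulrDr -/(Ci i).
    by rewrite ler_wpM2r// lef_pV2 ?posrE ?exprn_gt0// expr2 ler_peMl// ltW.
  rewrite -[leLHS]real_normK ?num_real// (le_trans (_ : _ <= (N^-1 * Ci i) ^+ 2))//.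
    by rewrite ler_pXn2r ?nnegrE// mulr_ge0// invr_ge0 ltW.
  rewrite exprMn ler_wpM2r ?sqr_ge0// expr2 ler_piMl ?invr_ge0 ?(ltW N0)//.
  by rewrite invf_le1.
- exact: cvg_cst.
- rewrite -(mul0r K); apply: cvgMr_tmp; exact: cvg_harmonic.
Qed.

Let err_int_cvg : (\int[lam]_v (err k (tcol v))%:E)%E @[k --> \oo] --> 0%E.
Proof.
have := @dominated_convergence _ _ _ lam setT measurableT
  (fun k v => (err k (tcol v))%:E) (cst 0%E) (fun v => (dom (tcol v))%:E).
case.
- by move=> k; exact: mfunRd_EFin (merr k).
- exact: measurable_cst.
- by apply: aeW => v _; apply/cvg_EFin; [exact: nearW|exact: err_cvg].
- exact: idom.
- by apply: aeW => v k _; rewrite abse_EFin lee_fin ger0_norm.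
by move=> _ _; rewrite integral0.
Qed.

(** Pointwise, [|a|^2 + 2 w . (b - a) <= |b|^2 + |a - w|^2] for the gradients [a] of
    [f] and [b] of [f'], because the difference of the two sides is
    [|b - w|^2]; the middle term has zero integral. *)
Let energy_error k :
  (otto_metric rho f <= otto_metric rho f' + \int[lam]_v (err k (tcol v))%:E)%E.
Proof.
have e0 : (0 <= \int[lam]_v (err k (tcol v))%:E)%E.
  by apply: integral_ge0 => v _; rewrite lee_fin.
have [f'fin|] := ltP (otto_metric rho f') +oo%E; last first.
  by rewrite leye_eq => /eqP ->; rewrite addye ?leey// gt_eqF// (lt_le_trans _ e0).
have i1 := ienergy sf ffin; have i2 := ienergy sf' f'fin.
have [iz z0] := flux_orthogonal k.
have i2z := integrableZl measurableT 2 iz.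
rewrite !otto_metricE /int_Rd -(integralD measurableT i2 (ierr k)).
have -> : (\int[lam]_v (\sum_i partial i f (tcol v) ^+ 2 * rho (tcol v))%:E =
    \int[lam]_v ((\sum_i partial i f (tcol v) ^+ 2 * rho (tcol v))%:E +
       2%:E * (\sum_i w k i (tcol v) * U i (tcol v))%:E))%E.
  by rewrite (integralD measurableT i1 i2z) (integralZl measurableT iz) z0 mule0 adde0.
apply: le_integral => //.
- exact: (integrableD measurableT i1 i2z).
- exact: (integrableD measurableT i2 (ierr k)).
move=> v _; rewrite -EFinM -!EFinD lee_fin mulr_sumr -!big_split/=.
apply: ler_sum => i _; rewrite UE.
have := mulr_ge0 (sqr_ge0 (partial i f' (tcol v) - w k i (tcol v))) (ltW (rho0 (tcol v))).
lra.
Qed.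

(** Let [k] tend to infinity in [energy_error]. *)
Theorem energy_le : (otto_metric rho f <= otto_metric rho f')%E.
Proof.
have A0 h : (0 <= otto_metric rho h)%E.
  by rewrite otto_metricE; apply: integral_ge0 => v _; rewrite lee_fin.
have [f'fin|] := ltP (otto_metric rho f') +oo%E; last first.
  by rewrite leye_eq => /eqP ->; rewrite leey.
have cv : (otto_metric rho f' + \int[lam]_v (err k (tcol v))%:E)%E @[k --> \oo] -->
    (otto_metric rho f' + 0)%E.
  apply: cvgeD => //; last exact: cvg_cst.
  by rewrite fin_num_adde_defl.
rewrite -[leRHS]adde0 -(cvg_lim (@ereal_hausdorff T) cv).
by apply: lime_ge; [apply/cvg_ex; exists (otto_metric rho f' + 0)%E|exact: nearW].
Qed.

End energy_comparison.

(** * Elliptic densities *)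

Section elliptic_densities.
Context {T : realType} {n : nat}.
Hypothesis n0 : (0 < n)%N.
Implicit Types (m u : 'cV[T]_n) (S : 'M[T]_n) (g : T -> T) (rho : 'cV[T]_n -> T).

Lemma quad_inv_ge0 S (x : 'cV[T]_n) : spd S -> 0 <= (x^T *m invmx S *m x) 0 0.
Proof.
move=> pS; have [_ pSi] := spd_inv pS.
by have [->|x0] := eqVneq x 0; [rewrite mulmx0 mxE|exact/ltW/pSi].
Qed.

Lemma smooth_elliptic m S g rho : elliptic m S g rho -> smooth rho.
Proof.
move=> [pS [[h [h0 dh]] _ _ _ _] rhoE].
pose q (x : 'cV[T]_n) := ((1%:M *m x + - m)^T *m invmx S *m (1%:M *m x + - m)) 0 0.
have q0 x : 0 <= q x by exact: quad_inv_ge0.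
rewrite (_ : rho = cst (Num.sqrt (\det S))^-1 \* (h 0%N \o q)).
  apply: smoothM; first exact: smooth_cst.
  apply: smooth_comp_halfline => //; exact: smooth_quadratic_form.
by apply/funext => x; rewrite rhoE h0 /= /q mul1mx.
Qed.

Lemma elliptic_gt0 m S g rho x : elliptic m S g rho -> 0 < rho x.
Proof.
move=> [pS hg rhoE]; rewrite rhoE mulr_gt0 ?invr_gt0 ?sqrtr_gt0 ?det_spd_gt0//.
by apply: (generator_gt0 hg); exact: quad_inv_ge0.
Qed.

Lemma mfunRdR_elliptic m S g rho : elliptic m S g rho -> mfunRdR rho.
Proof. by move=> hrho; exact: continuous_mfunRdR (smooth_continuous (smooth_elliptic hrho)). Qed.

Lemma int_Rd_elliptic_eq1 m S g rho : elliptic m S g rho ->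
  int_Rd (fun x => (rho x)%:E) = 1%E.
Proof.
move=> hrho; have [_ hg _] := hrho.
have := int_Rd_elliptic n0 hrho (F := cst 1) _ (mfunRdR_elliptic hrho) _.
rewrite -(int_Rd_generator n0 hg) => H.
transitivity (int_Rd (fun x => (cst 1 x * rho x)%:E)).
  by congr int_Rd; apply/funext => x; rewrite mul1r.
rewrite H//; last exact: measurable_cst.
by congr int_Rd; apply/funext => x; rewrite mul1r.
Qed.

Lemma elliptic_smooth_pos_density m S g rho : elliptic m S g rho ->
  smooth_pos_density rho.
Proof.
move=> hrho; split; first exact: smooth_elliptic hrho.
  by move=> x; exact: elliptic_gt0 hrho.
exact: int_Rd_elliptic_eq1 hrho.
Qed.

(** Substitute [x = m + sqrtmx S *m y] and use the moments of the radial density. *)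
Lemma elliptic_second_moment m S g rho u (c : T) : elliptic m S g rho ->
  int_Rd (fun x => (((u^T *m x) 0 0 + c) ^+ 2 * rho x)%:E) =
  (kappa n g * (u^T *m S *m u) 0 0 + ((u^T *m m) 0 0 + c) ^+ 2)%:E.
Proof.
move=> hrho; have [pS hg _] := hrho.
have [[hs _] hh] := sqrtmx_spd pS.
rewrite (int_Rd_elliptic n0 hrho (F := fun x => ((u^T *m x) 0 0 + c) ^+ 2)); last 3 first.
- by apply: measurable_funX; exact: mfunRdR_linear.
- exact: mfunRdR_elliptic hrho.
- by move=> x; exact: sqr_ge0.
have -> : u^T *m S *m u = (sqrtmx S *m u)^T *m (sqrtmx S *m u).
  by rewrite trmx_mul hs -!mulmxA (mulmxA (sqrtmx S)) hh.
rewrite -(second_moment_affine n0 hg); congr int_Rd; apply/funext => y.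
congr (_ ^+ 2 * _)%:E.
by rewrite mulmxDr trmx_mul hs mulmxA [X in X + c]mxE -addrA.
Qed.

Lemma elliptic_second_moment_fin m S g rho : elliptic m S g rho ->
  (int_Rd (fun x => (enorm x ^+ 2 * rho x)%:E) < +oo)%E.
Proof.
move=> hrho; pose e i : 'cV[T]_n := delta_mx i 0.
rewrite (_ : int_Rd _ = int_Rd (fun x =>
   \sum_(i < n) ((((e i)^T *m x) 0 0 + 0) ^+ 2 * rho x)%:E))%E.
  rewrite int_Rd_sum; last 2 first.
  - move=> i; apply: mfunRd_EFin; apply: measurable_funM.
      by apply: measurable_funX; exact: mfunRdR_linear.
    exact: mfunRdR_elliptic hrho.
  - by move=> i x; rewrite lee_fin mulr_ge0 ?sqr_ge0// ltW// (elliptic_gt0 _ hrho).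
  under eq_bigr do rewrite (elliptic_second_moment _ _ hrho).
  by rewrite sumEFin ltry.
congr int_Rd; apply/funext => x; rewrite sumEFin sq_enormE mulr_suml; congr EFin.
by apply: eq_bigr => i _; rewrite addr0 trmx_delta -rowE mxE.
Qed.

Lemma quadratic_growth (B : 'M[T]_n) (b : 'cV[T]_n) :
  exists c, forall x, `|quadratic B b x| <= c * (1 + enorm x ^+ 2).
Proof.
exists (\sum_i \sum_j `|B i j| + \sum_i `|b i 0|) => x.
set Q := enorm x ^+ 2; have Q0 : 0 <= Q by exact: sqr_ge0.
have xQ i : x i 0 ^+ 2 <= Q.
  by rewrite /Q sq_enormE (bigD1 i)//= lerDl sumr_ge0// => j _; exact: sqr_ge0.
have x1 i : `|x i 0| <= 1 + Q.
  have := xQ i; rewrite -real_normK ?num_real//; have := sqr_ge0 (`|x i 0| - 1); nra.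
have xx i j : `|x i 0 * x j 0| <= 1 + Q.
  have := xQ i; have := xQ j; rewrite ler_norml.
  have := sqr_ge0 (x i 0 - x j 0); have := sqr_ge0 (x i 0 + x j 0).
  by move=> ? ? ? ?; apply/andP; split; nra.
rewrite /quadratic mulrDl (le_trans (ler_normD _ _))// lerD//.
  rewrite normrM gtr0_norm ?invr_gt0// -[leRHS]mul1r ler_pM ?invr_ge0//; first by lra.
  rewrite mxE (le_trans (ler_norm_sum _ _ _))// exchange_big/= mulr_suml.
  apply: ler_sum => j _; rewrite mxE !mulr_suml (le_trans (ler_norm_sum _ _ _))//.
  apply: ler_sum => i _; rewrite mxE -mulrA mulrCA normrM ler_wpM2l//.
rewrite mxE mulr_suml (le_trans (ler_norm_sum _ _ _))//.
by apply: ler_sum => i _; rewrite mxE normrM ler_wpM2l.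
Qed.

End elliptic_densities.

(** * The flow of a quadratic potential *)

Section real_flow.
Context {T : realType}.

Lemma is_derive_mul (f g : T -> T) (t df dg : T) :
  is_derive t (1 : T) f df -> is_derive t (1 : T) g dg ->
  is_derive t (1 : T) (fun s => f s * g s) (f t * dg + g t * df).
Proof. by move=> df' dg'; exact: is_deriveM. Qed.

Lemma is_derive_bigsum n (h : 'I_n -> T -> T) (t : T) (dh : 'I_n -> T) :
  (forall i, is_derive t (1 : T) (h i) (dh i)) ->
  is_derive t (1 : T) (fun s => \sum_i h i s) (\sum_i dh i).
Proof.
move=> hd; rewrite (_ : (fun s => _) = \sum_i h i); first exact: is_derive_sum.
by apply/funext => s; rewrite fct_sumE.
Qed.

Lemma is_derive_scale (f : T -> T) (t k df : T) :
  is_derive t (1 : T) f df -> is_derive t (1 : T) (fun s => k * f s) (k * df).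
Proof. by move=> hf; exact: is_deriveZ. Qed.

Lemma is_derive_expR_lin (a t : T) :
  is_derive t (1 : T) (fun s => expR (s * a)) (a * expR (t * a)).
Proof.
have lin : is_derive t (1 : T) (fun s => s * a) a.
  have := is_derive_scale a (is_derive_id t (1 : T)); rewrite mulr1.
  by congr is_derive; apply/funext => s; rewrite mulrC.
have := is_derive1_comp (g := fun s => s * a) (x := t) (is_derive_expR (t * a)) lin.
by rewrite mulrC.
Qed.

(** [flow_time t a] is the integral of [expR (s * a)] for [s] from 0 to [t]. *)
Definition flow_time (t a : T) : T := if a == 0 then t else (expR (t * a) - 1) / a.

Lemma mul_flow_time t a : a * flow_time t a = expR (t * a) - 1.
Proof.
rewrite /flow_time; have [->|a0] := eqVneq a 0.
  by rewrite mul0r mulr0 expR0 subrr.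
by rewrite mulrC divfK.
Qed.

Lemma flow_time0 a : flow_time 0 a = 0.
Proof. by rewrite /flow_time mul0r expR0 subrr mul0r if_same. Qed.

Lemma flow_time_gt0 a : 0 < flow_time 1 a.
Proof.
rewrite /flow_time mul1r; case: eqVneq => // a0.
have [ag|al] := ltP 0 a.
  by rewrite divr_gt0// subr_gt0 -expR0 ltr_expR.
have {al}a0 : a < 0 by rewrite lt_neqAle a0.
by rewrite nmulr_rgt0 ?invr_lt0// subr_lt0 -expR0 ltr_expR.
Qed.

Lemma flow_timeN t a : expR (- t * a) * flow_time t a = - flow_time (- t) a.
Proof.
rewrite /flow_time; case: eqVneq => [->|a0].
  by rewrite mulr0 expR0 mul1r opprK.
by rewrite mulrA mulrBr -expRD !mulNr addNr expR0 mulr1 -[RHS]mulNr opprB.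
Qed.

Lemma is_derive_flow_time t a :
  is_derive t (1 : T) (fun s => flow_time s a) (expR (t * a)).
Proof.
rewrite /flow_time; have [->|a0] := eqVneq a 0.
  by rewrite mulr0 expR0; exact: is_derive_id.
have := is_derive_scale a^-1
  (is_deriveB (is_derive_expR_lin a t) (is_derive_cst (1 : T) t (1 : T))).
rewrite subr0 mulrA mulVf// mul1r; congr is_derive.
by apply/funext => s; rewrite mulrC.
Qed.

Lemma is_derive_flipN (f : T -> T) (t df : T) :
  is_derive (- t) (1 : T) f df -> is_derive t (1 : T) (fun s => f (- s)) (- df).
Proof.
move=> hf; have := is_derive1_comp (g := -%R) (x := t) hf (is_deriveNid t (1 : T)).
by rewrite mulrN1.
Qed.

End real_flow.

Section elliptic_flow.
Context {T : realType} {n : nat}.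
(** The gradient of the quadratic potential is the affine field
    [x |-> B (x - m0) + beta] with [B = drift_mx].  It flows
    [y] at time 0 to [m0 + exp(t B) (y - m0) + flow_time(t, B) beta] at time [t], and
    transports an elliptic density to the elliptic density with mean [flow_mean t]
    and scatter matrix [flow_cov t]. *)
Variables (g : T -> T) (m0 beta : 'cV[T]_n) (S0 P : 'M[T]_n) (l : 'I_n -> T).
Hypotheses (n0 : (0 < n)%N) (hg : elliptic_generator n g) (pS0 : spd S0).
Hypothesis PP : P^T *m P = 1%:M.

Definition drift_mx : 'M[T]_n := spmx P l.
Definition drift_vec : 'cV[T]_n := beta - drift_mx *m m0.
Definition flow_mx (t : T) : 'M[T]_n := spmx P (fun i => expR (t * l i)).
Definition flow_mean (t : T) : 'cV[T]_n :=
  m0 + spmx P (fun i => flow_time t (l i)) *m beta.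
Definition flow_cov (t : T) : 'M[T]_n := flow_mx t *m S0 *m flow_mx t.
Definition flow_density (t : T) (x : 'cV[T]_n) : T :=
  (Num.sqrt (\det (flow_cov t)))^-1 *
  g (((x - flow_mean t)^T *m invmx (flow_cov t) *m (x - flow_mean t)) 0 0).

Lemma flow_mx_unit t : flow_mx t \in unitmx.
Proof. by apply: (spmx_inv PP _).1 => i; rewrite gt_eqF// expR_gt0. Qed.

Lemma flow_mxN t : flow_mx t *m flow_mx (- t) = 1%:M.
Proof.
rewrite /flow_mx spmxM// -(spmx1 PP); apply: eq_spmx => i.
by rewrite -expRD mulNr subrr expR0.
Qed.

Lemma flow_mx0 : flow_mx 0 = 1%:M.
Proof.
rewrite /flow_mx -(spmx1 PP); apply: eq_spmx => i.
by rewrite mul0r expR0.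
Qed.

Lemma flow_mean0 : flow_mean 0 = m0.
Proof.
rewrite /flow_mean (eq_spmx P (g := fun=> 0 * 0)) => [|i]; last by rewrite flow_time0 mul0r.
by rewrite -spmxZ scale0r mul0mx addr0.
Qed.

Lemma flow_cov0 : flow_cov 0 = S0.
Proof. by rewrite /flow_cov flow_mx0 mul1mx mulmx1. Qed.

Lemma flow_cov_spd t : spd (flow_cov t).
Proof. by apply: spd_congr => //; [exact: flow_mx_unit|exact: trmx_spmx]. Qed.

Lemma flow_elliptic t : elliptic (flow_mean t) (flow_cov t) g (flow_density t).
Proof. by split => //; exact: flow_cov_spd. Qed.

Lemma invmx_flow_cov t :
  invmx (flow_cov t) = flow_mx (- t) *m invmx S0 *m flow_mx (- t).
Proof.
have u0 := spd_unit pS0; have N := flow_mxN (- t); rewrite opprK in N.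
have BC : flow_mx (- t) *m invmx S0 *m flow_mx (- t) *m flow_cov t = 1%:M.
  rewrite /flow_cov mulmxA mulmxA -(mulmxA _ (flow_mx (- t))) N mulmx1.
  by rewrite -(mulmxA _ (invmx S0)) mulVmx// mulmx1.
by rewrite -[RHS](mulmxK (spd_unit (flow_cov_spd t))) BC mul1mx.
Qed.

(** The volume factor of the flow is the exponential of [t] times the trace of
    the drift. *)
Lemma sqrt_det_flow_cov t : (Num.sqrt (\det (flow_cov t)))^-1 =
  (Num.sqrt (\det S0))^-1 * expR (t * - \tr drift_mx).
Proof.
have dE : \det (flow_mx t) = expR (t * \tr drift_mx).
  rewrite det_spmx// -expR_sum /drift_mx -[spmx P l]mul1mx tr_spmx mulmx1 PP.
  by rewrite mulr_sumr; congr expR; apply: eq_bigr => i _; rewrite mxE eqxx mulr1.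
rewrite /flow_cov det_mulmx (det_mulmx (flow_mx t)) dE mulrAC -expr2.
rewrite sqrtrM ?sqr_ge0// sqrtr_sqr.
by rewrite gtr0_norm ?expR_gt0// invfM mulrC -expRN mulrN.
Qed.

Lemma grad_drift x : grad (quadratic drift_mx drift_vec) x =
  drift_mx *m (x - m0) + beta.
Proof.
rewrite grad_quadratic ?trmx_spmx// /drift_vec mulmxBr.
by rewrite addrCA addrC addrAC.
Qed.

(** Up to the shift by [m0], the point from which the flow reaches [x] at time [t].
    The quadratic form in the density is constant along trajectories, so at
    time [t] it is the form of [invmx S0] at the pullback. *)
Definition pullback t (x : 'cV[T]_n) : 'cV[T]_n :=
  flow_mx (- t) *m (x - m0) + spmx P (fun i => flow_time (- t) (l i)) *m beta.

Lemma pullbackE t x : pullback t x = flow_mx (- t) *m (x - flow_mean t).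
Proof.
rewrite /pullback /flow_mean opprD addrA [RHS]mulmxBr mulmxA /flow_mx spmxM//.
congr (_ + _); rewrite -mulNmx -[X in _ = X *m _]scaleN1r spmxZ; congr (_ *m _).
by apply: eq_spmx => i; rewrite flow_timeN mulN1r opprK.
Qed.

Lemma spmx_entry (f : 'I_n -> T) (v : 'cV[T]_n) i :
  (spmx P f *m v) i 0 = \sum_k P i k * (f k * (P^T *m v) k 0).
Proof.
rewrite /spmx -!mulmxA mxE; apply: eq_bigr => k _; congr (_ * _).
by rewrite mul_diag_mx !mxE.
Qed.

Lemma is_derive_spmx (f : T -> 'I_n -> T) (df : 'I_n -> T) (v : 'cV[T]_n) (t : T) i :
  (forall k, is_derive t (1 : T) (f^~ k) (df k)) ->
  is_derive t (1 : T) (fun s => (spmx P (f s) *m v) i 0) ((spmx P df *m v) i 0).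
Proof.
move=> hf; rewrite spmx_entry (_ : (fun s => _) =
   (fun s => \sum_k P i k * (f s k * (P^T *m v) k 0))); last first.
  by apply/funext => s; rewrite spmx_entry.
apply: is_derive_bigsum => k; apply: is_derive_scale.
have := is_derive_scale ((P^T *m v) k 0) (hf k); rewrite mulrC.
by congr is_derive; apply/funext => s; rewrite mulrC.
Qed.

Lemma is_derive_pullback (t : T) x i :
  is_derive t (1 : T) (fun s => pullback s x i 0)
    (- (flow_mx (- t) *m (drift_mx *m (x - m0) + beta)) i 0).
Proof.
have dE : forall k, is_derive t (1 : T) (fun s => expR (- s * l k)) (- (l k * expR (- t * l k))).
  move=> k; exact: (is_derive_flipN (f := fun s => expR (s * l k))
    (is_derive_expR_lin (l k) (- t))).
have dF : forall k, is_derive t (1 : T) (fun s => flow_time (- s) (l k)) (- expR (- t * l k)).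
  move=> k; exact: (is_derive_flipN (f := fun s => flow_time s (l k))
    (is_derive_flow_time (- t) (l k))).
have := is_deriveD (is_derive_spmx (x - m0) i dE) (is_derive_spmx beta i dF).
rewrite (_ : _ + _ = (fun s => pullback s x i 0)); last first.
  by apply/funext => s; rewrite /pullback [RHS]mxE.
congr is_derive; rewrite mulmxDr mulmxA /flow_mx /drift_mx spmxM// [in RHS]mxE opprD.
have N f v : - (spmx P f *m v) i 0 = (spmx P (fun k => - f k) *m v) i 0.
  have -> : (fun k => - f k) = (fun k => - 1 * f k) by apply/funext => k; rewrite mulN1r.
  by rewrite -spmxZ scaleN1r mulNmx [RHS]mxE.
rewrite !N; congr ((spmx _ _ *m _) i 0 + _).
by apply/funext => k; rewrite mulrC.
Qed.

Definition pullback_form t x := ((pullback t x)^T *m invmx S0 *m pullback t x) 0 0.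

Lemma pullback_formE t x : pullback_form t x =
  ((x - flow_mean t)^T *m invmx (flow_cov t) *m (x - flow_mean t)) 0 0.
Proof.
rewrite /pullback_form pullbackE trmx_mul trmx_spmx invmx_flow_cov.
by rewrite !mulmxA.
Qed.

Lemma pullback_form_ge0 t x : 0 <= pullback_form t x.
Proof. exact: quad_inv_ge0. Qed.

Lemma is_derive_pullback_form (t : T) x :
  is_derive t (1 : T) (fun s => pullback_form s x)
   (- 2 * ((drift_mx *m (x - m0) + beta)^T *m invmx (flow_cov t) *m (x - flow_mean t)) 0 0).
Proof.
set v := _ + beta; pose y s i := pullback s x i 0.
pose dy i := - (flow_mx (- t) *m v) i 0; pose M := invmx S0.
have [Ms _] : spd M by exact: spd_inv.
have hy i : is_derive t (1 : T) (y^~ i) (dy i) by exact: is_derive_pullback.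
have E (a b : 'cV[T]_n) : (a^T *m M *m b) 0 0 = \sum_i \sum_j M j i * (a j 0 * b i 0).
  rewrite mxE; apply: eq_bigr => i _; rewrite mxE mulr_suml; apply: eq_bigr => j _.
  by rewrite mxE; ring.
have : is_derive t (1 : T) (fun s => \sum_i \sum_j M j i * (y s j * y s i))
    (\sum_i \sum_j M j i * (y t j * dy i + y t i * dy j)).
  apply: is_derive_bigsum => i; apply: is_derive_bigsum => j.
  by apply: is_derive_scale; exact: is_derive_mul.
rewrite (_ : (fun s => _) = (fun s => pullback_form s x)); last first.
  by apply/funext => s; rewrite /pullback_form E.
congr is_derive.
have -> : (v^T *m invmx (flow_cov t) *m (x - flow_mean t)) 0 0 =
    ((flow_mx (- t) *m v)^T *m M *m pullback t x) 0 0.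
  by rewrite pullbackE invmx_flow_cov trmx_mul trmx_spmx !mulmxA.
have sym : ((flow_mx (- t) *m v)^T *m M *m pullback t x) 0 0 =
    ((pullback t x)^T *m M *m (flow_mx (- t) *m v)) 0 0.
  by rewrite -mulmxA mx11_mulC trmx_mul Ms.
rewrite mulNr mulr_natl mulr2n opprD {1}sym !E -!sumrN -big_split/=.
apply: eq_bigr => i _; rewrite -!sumrN -big_split/=; apply: eq_bigr => j _.
by rewrite /y /dy; ring.
Qed.

Lemma partial_form (N : 'M[T]_n) (m x : 'cV[T]_n) i : N^T = N ->
  partial i (fun z => ((z - m)^T *m N *m (z - m)) 0 0) x = 2 * (N *m (x - m)) i 0.
Proof.
move=> Ns; pose e : 'cV[T]_n := delta_mx i 0.
apply: (derive_quadratic_line (c2 := (e^T *m N *m e) 0 0)) => h.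
have tE : (h *: e + x - m)^T = h *: e^T + (x - m)^T by apply/matrixP => a b; rewrite !mxE addrA.
have eE (y : 'cV[T]_n) : (e^T *m y) 0 0 = y i 0 by rewrite trmx_delta -rowE mxE.
have sym : ((x - m)^T *m N *m e) 0 0 = (e^T *m N *m (x - m)) 0 0.
  by rewrite -mulmxA mx11_mulC trmx_mul Ns.
rewrite -/e tE -(addrA (h *: e)) -eE mulmxA.
move: (x - m) sym => z; rewrite !(mulmxDl, mulmxDr) -!(scalemxAl, scalemxAr).
move: (z^T *m N *m e) (e^T *m N *m z) (e^T *m N *m e) (z^T *m N *m z) => a b c dd.
by rewrite !mxE => ->; ring.
Qed.

(** Both sides of the continuity equation are the same combination of [g] and
    its derivative at the value of the quadratic form. *)
Lemma flow_continuity (t : T) x :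
  is_derive t (1 : T) (fun s => flow_density s x)
    (otto_phi (flow_density t) (quadratic drift_mx drift_vec) x).
Proof.
have [[h [h0 dh]] _ _ _ _] := hg.
pose G := tangent_extension g (h 1%N 0).
have Gg (r : T) : 0 <= r -> G r = g r by move=> r0; rewrite /G /tangent_extension r0.
have dG (r : T) : 0 <= r -> is_derive r (1 : T) G (h 1%N r).
  by move=> r0; apply: is_derive_tangent_extension => // s s0; rewrite -h0; exact: dh.
set v := drift_mx *m (x - m0) + beta.
pose c s := (Num.sqrt (\det (flow_cov s)))^-1.
pose F := (v^T *m invmx (flow_cov t) *m (x - flow_mean t)) 0 0.
set q := pullback_form t x.
have dens s : flow_density s x = c s * G (pullback_form s x).
  by rewrite Gg ?pullback_form_ge0// pullback_formE.
have dc : is_derive t (1 : T) c (- \tr drift_mx * c t).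
  rewrite (_ : c = fun s => (Num.sqrt (\det S0))^-1 * expR (s * - \tr drift_mx)); last first.
    by apply/funext => s; exact: sqrt_det_flow_cov.
  have := is_derive_scale (Num.sqrt (\det S0))^-1 (is_derive_expR_lin (- \tr drift_mx) t).
  by rewrite mulrCA.
have dGq : is_derive t (1 : T) (fun s => G (pullback_form s x)) (h 1%N q * (- 2 * F)).
  exact: (is_derive1_comp (g := fun s => pullback_form s x) (x := t)
     (dG _ (pullback_form_ge0 t x)) (is_derive_pullback_form t x)).
have := is_derive_mul dc dGq.
rewrite (_ : (fun s => _) = (fun s => flow_density s x)); last by apply/funext => s; rewrite dens.
congr is_derive; rewrite otto_phiE.
have pf i : partial i (quadratic drift_mx drift_vec) = fun z => (drift_mx *m (z - m0) + beta) i 0.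
  by apply/funext => z; rewrite -grad_drift mxE.
have sr : smooth (flow_density t) := smooth_elliptic (flow_elliptic t).
have spf i : smooth (partial i (quadratic drift_mx drift_vec)).
  by apply: smooth_partial; exact: smooth_quadratic.
have ppf i : partial i (partial i (quadratic drift_mx drift_vec)) x = drift_mx i i.
  rewrite pf; apply: (derive_quadratic_line (c2 := 0)) => s.
  rewrite -addrA mulmxDr -scalemxAr -colE -addrA [LHS]mxE [X in X + _]mxE [X in _ * X]mxE.
  by rewrite mulr0 addr0 addrC.
have pr i : partial i (flow_density t) x =
    c t * (h 1%N q * (2 * (invmx (flow_cov t) *m (x - flow_mean t)) i 0)).
  pose Q (z : 'cV[T]_n) := ((z - flow_mean t)^T *m invmx (flow_cov t) *m (z - flow_mean t)) 0 0.
  have QE z : Q z = pullback_form t z by rewrite pullback_formE.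
  have sQ : smooth Q.
    have := smooth_quadratic_form 1%:M (- flow_mean t) (invmx (flow_cov t)).
    by congr smooth; apply/funext => z; rewrite mul1mx.
  have dQ : is_derive (Q x) (1 : T) G (h 1%N (Q x)).
    by apply: dG; rewrite QE pullback_form_ge0.
  have [dGQ pGQ] := partial_comp i dQ (smooth_differentiable x sQ).
  rewrite (_ : flow_density t = cst (c t) \* (G \o Q)); last first.
    by apply/funext => z; rewrite /= Gg// QE pullback_form_ge0.
  rewrite partialM; [|exact: smooth_differentiable (smooth_cst _)|exact: dGQ].
  rewrite partial_cst mulr0 addr0 pGQ partial_form; last by case: (spd_inv (flow_cov_spd t)).
  by rewrite QE.
rewrite (eq_bigr (fun i => c t * G q * drift_mx i i +
    c t * h 1%N q * 2 * (v i 0 * (invmx (flow_cov t) *m (x - flow_mean t)) i 0))) => [|i _].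
  rewrite big_split/= -!mulr_sumr -/(\tr drift_mx).
  have -> : \sum_i v i 0 * (invmx (flow_cov t) *m (x - flow_mean t)) i 0 = F.
    by rewrite /F -mulmxA [RHS]mxE; apply: eq_bigr => i _; rewrite [v^T _ _]mxE.
  by ring.
rewrite partialM; [|exact: smooth_differentiable..].
rewrite ppf pr dens pf -/v; ring.
Qed.

End elliptic_flow.

(** * The action of the flow *)

Section flow_energy.
Context {T : realType} {n : nat}.
Variables (g : T -> T) (m0 beta : 'cV[T]_n) (S0 P : 'M[T]_n) (l : 'I_n -> T).
Hypotheses (n0 : (0 < n)%N) (hg : elliptic_generator n g) (pS0 : spd S0).
Hypothesis PP : P^T *m P = 1%:M.

Lemma spmx_congr_diag (f : 'I_n -> T) (S : 'M[T]_n) k :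
  (P^T *m (spmx P f *m S *m spmx P f) *m P) k k =
  f k ^+ 2 * (P^T *m S *m P) k k.
Proof.
have -> : P^T *m (spmx P f *m S *m spmx P f) *m P =
    diag_mx (\row_i f i) *m (P^T *m S *m P) *m diag_mx (\row_i f i).
  rewrite /spmx !mulmxA PP mul1mx -!mulmxA PP mulmx1.
  by rewrite !mulmxA.
by rewrite mul_mx_diag mxE mul_diag_mx !mxE mulrC mulrA -expr2.
Qed.

Let f := quadratic (drift_mx P l) (drift_vec m0 beta P l).
Let rho := flow_density g m0 beta S0 P l.

(** The part of the energy at time 0 that is carried by the [k]-th eigenvector of
    the drift: the variance and the squared mean of that component of the
    velocity. *)
Definition mode_energy k : T :=
  kappa n g * l k ^+ 2 * (P^T *m S0 *m P) k k + (P^T *m beta) k 0 ^+ 2.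

Lemma mode_energy_ge0 k : 0 <= mode_energy k.
Proof.
rewrite /mode_energy addr_ge0 ?sqr_ge0// mulr_ge0 ?(mulr_ge0 _ (sqr_ge0 _))//.
  rewrite /kappa mulr_ge0 ?invr_ge0// fine_ge0// int_Rd_ge0// => y.
  by rewrite lee_fin mulr_ge0 ?sqr_ge0// ltW// (generator_gt0 hg)// sqr_ge0.
rewrite (_ : _ k k = ((col k P)^T *m S0 *m col k P) 0 0).
  by have [->|v0] := eqVneq (col k P) 0; [rewrite mulmx0 mxE|exact/ltW/pS0.2].
rewrite tr_col -row_mul [LHS]mxE [RHS]mxE; apply: eq_bigr => j _.
by rewrite [row _ _ _ _]mxE [col _ _ _ _]mxE.
Qed.

(** The velocity field is affine, so its energy involves only the first two
    moments; in the eigenbasis of the drift each coordinate grows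
    exponentially. *)
Lemma flow_metric t :
  otto_metric (rho t) f = (\sum_k expR (2 * t * l k) * mode_energy k)%:E.
Proof.
have hrho : elliptic _ _ g (rho t) := flow_elliptic m0 beta l hg pS0 PP t.
pose u k : 'cV[T]_n := l k *: col k P.
pose c k := (P^T *m beta) k 0 - l k * (P^T *m m0) k 0.
have uE k (x : 'cV[T]_n) : ((u k)^T *m x) 0 0 = l k * (P^T *m x) k 0.
  by rewrite /u linearZ/= -scalemxAl mxE tr_col -row_mul mxE.
have gradE x : enorm (grad f x) ^+ 2 = \sum_k (((u k)^T *m x) 0 0 + c k) ^+ 2.
  rewrite grad_drift// enorm_sqr -(sqnorm_orth _ PP) mxE; apply: eq_bigr => k _.
  rewrite mxE -expr2; congr (_ ^+ 2).
  rewrite mulmxDr mxE /drift_mx (spmx_mulr _ _ _ PP) mulmxBr uE /c.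
  by rewrite [in LHS]mxE [X in _ * (_ + X)]mxE; ring.
rewrite /otto_metric.
transitivity (int_Rd (fun x =>
    \sum_(k < n) ((((u k)^T *m x) 0 0 + c k) ^+ 2 * rho t x)%:E)%E).
  by congr int_Rd; apply/funext => x; rewrite gradE mulr_suml sumEFin.
rewrite int_Rd_sum; last 2 first.
- move=> k; apply: mfunRd_EFin; apply: measurable_funM.
    by apply: measurable_funX; exact: mfunRdR_linear.
  exact: mfunRdR_elliptic hrho.
- by move=> k x; rewrite lee_fin mulr_ge0 ?sqr_ge0// ltW// (elliptic_gt0 _ hrho).
rewrite -sumEFin; apply: eq_bigr => k _.
rewrite (elliptic_second_moment _ _ _ hrho)//; congr EFin.
have -> : ((u k)^T *m flow_mean m0 beta P l t) 0 0 + c k =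
    expR (t * l k) * (P^T *m beta) k 0.
  rewrite uE /c /flow_mean mulmxDr mxE (spmx_mulr _ _ _ PP).
  by rewrite -(subrK 1 (expR _)) -mul_flow_time; ring.
have -> : ((u k)^T *m flow_cov S0 P l t *m u k) 0 0 =
    l k ^+ 2 * (expR (t * l k) ^+ 2 * (P^T *m S0 *m P) k k).
  rewrite -mulmxA uE /u -scalemxAr -scalemxAr mxE.
  rewrite -(spmx_congr_diag (fun i => expR (t * l i))) -/(flow_mx P l t) -/(flow_cov S0 P l t).
  rewrite mulrA -expr2 mulmxA; congr (_ * _); rewrite [RHS]mxE mxE.
  by apply: eq_bigr => j _; rewrite [col _ _ _ _]mxE.
have -> : expR (2 * t * l k) = expR (t * l k) ^+ 2.
  by rewrite -expRM_natl; congr expR; ring.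
rewrite /mode_energy; ring.
Qed.

End flow_energy.

Section time_integral.
Context {T : realType}.
Notation mu := (@lebesgue_measure T).

(** A primitive of [t * expR (2 * t * l)]. *)
Definition time_primitive (l t : T) : T :=
  if l == 0 then 2^-1 * t ^+ 2
  else (t / (2 * l) - (4 * l ^+ 2)^-1) * expR (t * (2 * l)).

Definition time_weight l := time_primitive l 1 - time_primitive l 0.

Lemma is_derive_time_primitive (l t : T) :
  is_derive t (1 : T) (time_primitive l) (t * expR (t * (2 * l))).
Proof.
rewrite /time_primitive; have [->|l0] := eqVneq l 0.
  have := is_derive_scale 2^-1 (is_derive_mul (is_derive_id t (1 : T)) (is_derive_id t (1 : T))).
  rewrite !mulr0 expR0; congr is_derive; lra.
have lin : is_derive t (1 : T) (fun s => s / (2 * l) - (4 * l ^+ 2)^-1) (2 * l)^-1.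
  have := is_deriveB (is_derive_scale (2 * l)^-1 (is_derive_id t (1 : T)))
    (is_derive_cst (4 * l ^+ 2)^-1 t (1 : T)).
  rewrite mulr1 subr0; congr is_derive.
  by apply/funext => s; congr (_ - _); exact: mulrC.
have := is_derive_mul lin (is_derive_expR_lin (2 * l) t).
by congr is_derive; field.
Qed.

Lemma time_weight_action l : 4 * l ^+ 2 * time_weight l = action_weight l.
Proof.
rewrite /time_weight /time_primitive /action_weight; have [->|l0] := eqVneq l 0.
  by rewrite !(mulr0, mul0r, expR0); ring.
by rewrite !(mul0r, expR0, mul1r); field.
Qed.

Lemma time_weight_mean l :
  4 * time_weight l / flow_time 1 l ^+ 2 = mean_weight l.
Proof.
rewrite /mean_weight -time_weight_action /flow_time.
have [->|l0] := eqVneq l 0.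
  by rewrite /time_weight /time_primitive eqxx; field.
rewrite mul1r; have e1 : expR l - 1 != 0.
  by rewrite expR_sub1_eq0.
by field; rewrite e1 l0.
Qed.

Lemma time_integral n (l c : 'I_n -> T) :
  (\int[mu]_(t in `[0%R, 1%R])
     (t%:E * (\sum_k expR (2 * t * l k) * c k)%:E) =
  (\sum_k time_weight (l k) * c k)%R%:E)%E.
Proof.
pose f t := \sum_k c k * (t * expR (t * (2 * l k))).
pose F t := \sum_k c k * time_primitive (l k) t.
have dF t : is_derive t (1 : T) F (f t).
  apply: is_derive_bigsum => k; apply: is_derive_scale.
  exact: is_derive_time_primitive.
have cf : {within `[0, 1], continuous f}.
  apply: continuous_subspaceT => t.
  have : is_derive t (1 : T) f (\sum_k c k *
      (t * ((2 * l k) * expR (t * (2 * l k))) + expR (t * (2 * l k)) * 1)).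
    apply: is_derive_bigsum => k; apply: is_derive_scale; apply: is_derive_mul.
    exact: is_derive_expR_lin.
  by move=> [/derivable1_diffP /differentiable_continuous].
transitivity (\int[mu]_(t in `[0%R, 1%R]) (f t)%:E)%E.
  apply: eq_integral => t _; rewrite -EFinM /f mulr_sumr; congr EFin.
  apply: eq_bigr => k _; have -> : t * (2 * l k) = 2 * t * l k by ring.
  by ring.
rewrite (FTC2_is_derive ltr01 cf (fun t _ => dF t)) /F -sumrB; congr EFin.
by apply: eq_bigr => k _; rewrite -mulrBr mulrC.
Qed.

End time_integral.

(** * The divergence between elliptic densities *)

(** The integral of a nonnegative function is a supremum over the simple functions
    below it, hence monotone even for functions that are not measurable.  It is
    applied to the energy of an arbitrary potential along a curve, whose
    measurability in time is not clear. *)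
Lemma le_integral_ge0 d (X : measurableType d) (T : realType)
    (mu : {measure set X -> \bar T}) (D : set X) (f h : X -> \bar T) :
  (forall x, D x -> (0 <= f x)%E) -> (forall x, D x -> (f x <= h x)%E) ->
  (\int[mu]_(x in D) f x <= \int[mu]_(x in D) h x)%E.
Proof.
move=> f0 fh; have h0 x : D x -> (0 <= h x)%E.
  by move=> Dx; exact: le_trans (f0 _ Dx) (fh _ Dx).
rewrite !ge0_integralE//; apply: ereal_sup_le => _ [s sf <-]; exists s => // x.
apply: (le_trans (sf x)); rewrite !patchE; case: ifPn => // /set_mem; exact: fh.
Qed.

Lemma has_derivative_within_eq (T : realType) (A : set T) (h k : T -> T) (t a : T) :
  A t -> (forall s, A s -> h s = k s) ->
  has_derivative_within A h t a -> has_derivative_within A k t a.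
Proof.
move=> At hk /has_derivative_withinP H; apply/has_derivative_withinP => e /H.
by move=> [dl dl0 dlH]; exists dl => // s ts sd As; rewrite -!hk//; exact: dlH.
Qed.

Section divergence_elliptic.
Context {T : realType} {n : nat}.
Variables (g : T -> T) (m0 beta : 'cV[T]_n) (S0 P : 'M[T]_n) (l : 'I_n -> T).
Hypotheses (n0 : (0 < n)%N) (hg : elliptic_generator n g) (pS0 : spd S0).
Hypothesis PP : P^T *m P = 1%:M.
Let f := quadratic (drift_mx P l) (drift_vec m0 beta P l).
Let rho := flow_density g m0 beta S0 P l.

Lemma flow_geodesic : otto_dual_geodesic (rho 0) (rho 1) rho f.
Proof.
split => //; first exact: smooth_quadratic.
  by move=> t _; exact: (elliptic_smooth_pos_density n0 (flow_elliptic m0 beta l hg pS0 PP t)).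
by move=> t x _; apply: is_derive_within; exact: flow_continuity.
Qed.

Lemma flow_action :
  otto_action rho f = (\sum_k time_weight (l k) * mode_energy g beta S0 P l k)%:E.
Proof.
rewrite -time_integral; apply: eq_integral => t _.
by rewrite flow_metric.
Qed.

Lemma flow_action_min f' :
  otto_dual_geodesic (rho 0) (rho 1) rho f' ->
  (otto_action rho f <= otto_action rho f')%E.
Proof.
move=> [sf' dens' der' _ _]; have [sf _ der _ _] := flow_geodesic.
apply: le_integral_ge0 => t /= t01.
  have t0 : 0 <= t by move: t01; rewrite in_itv/= => /andP[].
  rewrite flow_metric// -EFinM lee_fin mulr_ge0// sumr_ge0// => k _.
  by rewrite mulr_ge0 ?expR_ge0 ?mode_energy_ge0.
have t0 : 0 <= t by move: t01; rewrite in_itv/= => /andP[].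
apply: lee_wpmul2l; first by rewrite lee_fin.
have ell := flow_elliptic m0 beta l hg pS0 PP t.
have [c fc] := quadratic_growth (drift_mx P l) (drift_vec m0 beta P l).
have same x : otto_phi (rho t) f x = otto_phi (rho t) f' x.
  exact: has_derivative_within_unique t01 (der t x t01) (der' t x t01).
have fin : (otto_metric (rho t) f < +oo)%E by rewrite flow_metric// ltry.
exact: (energy_le (smooth_elliptic ell) (fun x => elliptic_gt0 x ell)
  (elliptic_second_moment_fin n0 ell) sf sf' fc fin same).
Qed.

(** By uniqueness of the curve, every competitor differs from the quadratic
    one only by its potential, on the time interval that the action sees. *)
Lemma flow_divergence :
  quadratic_dual_geodesic_unique (rho 0) (rho 1) ->
  otto_divergence (rho 0) (rho 1) =
  (\sum_k time_weight (l k) * mode_energy g beta S0 P l k)%:E.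
Proof.
move=> huniq; have geo := flow_geodesic; rewrite -flow_action.
apply/eqP; rewrite eq_le; apply/andP; split.
  by apply: ereal_inf_lbound; exists rho, f.
apply: le_ereal_inf_tmp => _ [gamma' [f' [geo' ->]]].
have E : forall t, t \in `[0, 1] -> gamma' t = rho t.
  by move=> t; exact: (huniq _ _ _ (trmx_spmx _ _) geo _ _ geo').
have -> : otto_action gamma' f' = otto_action rho f'.
  by apply: eq_integral => t /set_mem/= t01; rewrite E.
apply: flow_action_min; move: geo' => [sf' dens' der' _ _]; split => //.
  by move=> t t01; rewrite -E//; exact: dens'.
move=> t x t01; rewrite -E//; apply: has_derivative_within_eq (der' t x t01) => //.
by move=> s s01; rewrite E.
Qed.

(** The time integrals turn into the two families of weights of the closed
    formula; [flow_time 1 (l k)] converts the initial velocity of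
    a component of the mean into its total displacement. *)
Lemma flow_energy_sum (Dm : 'cV[T]_n) :
  beta = spmx P (fun k => (flow_time 1 (l k))^-1) *m Dm ->
  \sum_k time_weight (l k) * mode_energy g beta S0 P l k =
  kappa n g / 4 * (\sum_k action_weight (l k) * (P^T *m S0 *m P) k k) +
  4^-1 * \sum_k mean_weight (l k) * (P^T *m Dm) k 0 ^+ 2.
Proof.
move=> ->; rewrite !mulr_sumr -big_split/=; apply: eq_bigr => k _.
rewrite /mode_energy spmx_mulr// -time_weight_action -time_weight_mean.
have := flow_time_gt0 (l k); move: (flow_time 1 (l k)) => z z0.
by field; rewrite gt_eqF.
Qed.

End divergence_elliptic.

(** At time 1 the linear part of the flow is the transport matrix [R], and
    [R S0 R = S1]. *)
Lemma flow_density_ends (T : realType) n (g : T -> T) (m0 m1 : 'cV[T]_n)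
    (S0 S1 P : 'M[T]_n) (l : 'I_n -> T) rho nu :
  elliptic m0 S0 g rho -> elliptic m1 S1 g nu ->
  P^T *m P = 1%:M -> transport_mx S0 S1 = spmx P (fun k => expR (l k)) ->
  let beta := spmx P (fun k => (flow_time 1 (l k))^-1) *m (m1 - m0) in
  rho = flow_density g m0 beta S0 P l 0 /\ nu = flow_density g m0 beta S0 P l 1.
Proof.
move=> [p0 _ rhoE] [p1 _ nuE] PP RE beta.
have [_ RSR] := transport_mx_spd p0 p1.
split; apply/funext => x; rewrite /flow_density.
  by rewrite flow_cov0// flow_mean0 rhoE.
have -> : flow_mean m0 beta P l 1 = m1.
  rewrite /flow_mean /beta mulmxA spmxM// (eq_spmx P (g := fun=> 1)) ?spmx1//.
    by rewrite mul1mx addrC subrK.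
  by move=> k; rewrite mulfV// gt_eqF// flow_time_gt0.
have <- : S1 = flow_cov S0 P l 1; last by rewrite nuE.
have FE : flow_mx P l 1 = transport_mx S0 S1.
  by rewrite RE; apply: eq_spmx => k; rewrite mul1r.
by rewrite /flow_cov FE RSR.
Qed.

Unset Implicit Arguments.
Local Close Scope classical_set_scope.

Theorem theorem4p10 (T : realType) (d : nat) (hd : (0 < d)%N)
    (g : T -> T) (m0 m1 : 'cV[T]_d) (S0 S1 : 'M[T]_d)
    (rho nu : 'cV[T]_d -> T)
    (hrho : elliptic m0 S0 g rho) (hnu : elliptic m1 S1 g nu)
    (huniq : quadratic_dual_geodesic_unique rho nu) :
  let Dm := m1 - m0 in
  let S0h := sqrtmx S0 in
  let R := invmx S0h *m sqrtmx (S0h *m S1 *m S0h) *m invmx S0h in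
  let R2 := R *m R in
  let Q := mp_inv (R - 1%:M) *m (logmx R2 *m R2 - R2 + 1%:M) *m mp_inv (R - 1%:M) in
  let mean_term :=
    4^-1 * enorm (sqrtmx (Q + 2 *: perpmx (logmx R)) *m Dm) ^+ 2 in
  otto_divergence rho nu =
    (kappa d g / 4 * \tr (S0 - S1 + S0 *m R2 *m logmx R2) + mean_term)%:E
  /\
  (S0 *m S1 = S1 *m S0 ->
   otto_divergence rho nu =
     (kappa d g / 4 * fnorm (sqrtmx Q *m (sqrtmx S1 - sqrtmx S0)) ^+ 2
        + mean_term)%:E).
Proof.
move=> Dm S0h R R2 Q mean_term.
have [pS0 hg _] := hrho; have [pS1 _ _] := hnu.
have [P [l [PP RE trE meanE commE]]] := divergence_formula_spectral Dm pS0 pS1.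
have [rho0 nu1] := flow_density_ends hrho hnu PP RE.
move: trE meanE commE; rewrite -/R2 -/Q => trE meanE commE.
have DE : otto_divergence rho nu = (kappa d g / 4 *
    (\sum_k action_weight (l k) * (P^T *m S0 *m P) k k) + mean_term)%:E.
  rewrite /mean_term meanE -(flow_energy_sum g S0 PP (erefl _)).
  rewrite -(flow_divergence (m0 := m0) hd hg pS0 PP); last by rewrite -rho0 -nu1.
  by rewrite -rho0 -nu1.
split; first by rewrite DE -trE.
by move=> /commE C; rewrite DE -C.
Qed.
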